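(* Let $T$ be the universal theory of unital, stably finite C$^*$-algebras, and let enforceability be with respect to $T$. Let $\mathcal Q$ be the universal UHF algebra and $\mathcal U$ a nonprincipal ultrafilter on $\mathbb N$. The following are equivalent: (1) The MF problem has a positive solution, i.e. every (unital) stably finite C$^*$-algebra embeds into an ultrapower of $\mathcal Q$. (2) $\sigma_{\mathrm{UHF}}^{T^f}=0$, i.e. the property $\sigma_{\mathrm{UHF}}=0$ of the compiled structure is enforceable. (3) $\mathcal Q$ is enforceable. (4) $\sigma_{\mathrm{QD}}^{T^f}=0$, i.e. the property $\sigma_{\mathrm{QD}}=0$ of the compiled structure is enforceable. (5) $\mathcal Q^{\mathcal U}$-embeddability is enforceable, i.e. the property that the compiled C$^*$-algebra embeds into $\mathcal Q^{\mathcal U}$ is enforceable.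
   Context: Unital C$^*$-algebras are regarded as structures in a many-sorted continuous language $L$: for each $k\ge1$ a sort for the closed operator-norm ball of radius $k$ with metric $\|x-y\|$, function symbols for the $*$-algebra operations (addition, multiplication, adjoint, multiplication by scalars in $\mathbb Q(i)$), constants $0,1$ and inclusion maps between balls. Embeddings are injective unital $*$-homomorphisms; ultrapowers are norm ultrapowers. $T$ is a universal $L$-theory whose models are exactly the unital stably finite C$^*$-algebras. Game. Fix a countable set $C$ of new constant symbols, infinitely many of each sort, and set $L(C)=L\cup C$. A restricted formula is one built using a fixed countable family of continuous connectives whose compositions are uniformly dense among all continuous connectives. A condition is a finite set $p$ of expressions $\varphi<r$, with $\varphi$ a quantifier-free restricted $L(C)$-sentence and $r\in\mathbb R$, such that $T\cup p$ is satisfiable. Two players $\forall$ and $\exists$ alternately play conditions $p_0\subseteq p_1\subseteq p_2\subseteq\cdots$ ($\forall$ moves first; each move contains the previous one) for $\omega$ steps; let $\bar p=\bigcup_i p_i$. The play is definitive if for every atomic $L(C)$-sentence $\varphi$ there is a unique real $r$ with $T\cup\bar p\models\varphi=r$; then $\bar p$ determines a prestructure on the algebra of closed $L(C)$-terms, whose completion is the compiled structure. A property $P$ is enforceable (with respect to $T$) if $\exists$ has a strategy guaranteeing, whatever $\forall$ plays, that the play is definitive and the compiled structure has $P$. A structure $A$ is enforceable if the property ''the $L$-reduct of the compiled structure is isomorphic to $A$'' is enforceable. A $\sup\bigvee\inf$-sentence is an infinitary sentence $\sup_x\inf_n\varphi_n(x)$ with $x$ a finite tuple and each $\varphi_n$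 existential (i.e. $\inf_y\psi$ with $\psi$ quantifier-free). For separable unital C$^*$-algebras, being UHF and being quasidiagonal are each defined by countably many $\sup\bigvee\inf$-sentences (an algebra has the property iff all these sentences take value $0$ in it); $\sigma_{\mathrm{UHF}}$ and $\sigma_{\mathrm{QD}}$ denote the respective suprema of these countable families. The notation $\sigma^{T^f}=0$ means that the property $\sigma=0$ is enforceable. *)

(* Defs.v *)
From HB Require Import structures.
From mathcomp Require Import all_boot all_order all_algebra.
From mathcomp Require Import generic_quotient complex ring.
From mathcomp Require Import all_classical all_reals all_analysis.

Set Implicit Arguments.
Unset Strict Implicit.
Unset Printing Implicit Defensive.

Import Order.TTheory GRing.Theory Num.Theory numFieldNormedType.Exports.

Local Open Scope classical_set_scope.
Local Open Scope ring_scope.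
Local Open Scope complex_scope.
Local Open Scope quotient_scope.

HB.mixin Record isStarAlgebra (R : realType) A of GRing.Algebra R[i] A := {
  star : A -> A;
  starK : involutive star;
  starD : {morph star : x y / x + y};
  starZ : forall (a : R[i]) x, star (a *: x) = a^* *: star x;
  starM : forall x y, star (x * y) = star y * star x
}.

#[short(type="starAlgType")]
HB.structure Definition StarAlgebra (R : realType) :=
  {A of isStarAlgebra R A & GRing.Algebra R[i] A}.

(* The norm takes values in [R], not in [R[i]].  Since an [algType] is
   nontrivial, the zero algebra is excluded. *)
HB.mixin Record isCStarAlgebra (R : realType) A of StarAlgebra R A := {
  cnorm : A -> R;
  cnorm0_eq0 : forall x, cnorm x = 0 -> x = 0;
  ler_cnormD : forall x y, cnorm (x + y) <= cnorm x + cnorm y;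
  cnormZ : forall (a : R[i]) x, cnorm (a *: x) = Normc.normc a * cnorm x;
  ler_cnormM : forall x y, cnorm (x * y) <= cnorm x * cnorm y;
  cnorm_starM : forall x, cnorm (star x * x) = cnorm x ^+ 2;
  cnorm_complete : forall u : nat -> A,
    (forall e : R, 0 < e -> exists N, forall m n,
       (N <= m)%N -> (N <= n)%N -> cnorm (u m - u n) < e) ->
    exists l, forall e : R, 0 < e -> exists N, forall n,
       (N <= n)%N -> cnorm (u n - l) < e
}.

#[short(type="cstarAlgType")]
HB.structure Definition CStarAlgebra (R : realType) :=
  {A of isCStarAlgebra R A & StarAlgebra R A}.

Section StarAlgebraTheory.
Variable R : realType.

Definition star_preserving (A B : starAlgType R) (f : A -> B) :=
  forall x, f (star x) = star (f x).

Definition embeds (A B : starAlgType R) :=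
  exists f : {lrmorphism A -> B}, star_preserving f /\ injective f.

Definition isomorphic (A B : starAlgType R) :=
  exists f : {lrmorphism A -> B}, star_preserving f /\ bijective f.

Definition star_mx (A : starAlgType R) m (X : 'M[A]_m) : 'M[A]_m :=
  (map_mx star X)^T.

Definition stably_finite (A : starAlgType R) :=
  forall n (v : 'M[A]_n), star_mx v *m v = 1%:M -> v *m star_mx v = 1%:M.

Definition positive_mx (A : starAlgType R) m (X : 'M[A]_m) :=
  exists Y : 'M[A]_m, X = star_mx Y *m Y.

Lemma star_inj (A : starAlgType R) : injective (@star R A).
Proof. exact: can_inj starK. Qed.

Lemma star0 (A : starAlgType R) : star (0 : A) = 0.
Proof. by apply: (addrI (star 0)); rewrite -starD !addr0. Qed.

Lemma starN (A : starAlgType R) (x : A) : star (- x) = - star x.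
Proof. by apply: (addrI (star x)); rewrite -starD !subrr star0. Qed.

Lemma starB (A : starAlgType R) (x y : A) : star (x - y) = star x - star y.
Proof. by rewrite starD starN. Qed.

End StarAlgebraTheory.

Section MatrixAlgebra.
Variables (R : realType) (n : nat).
Implicit Types X Y : 'M[R[i]]_n.+1.

Definition adjmx X : 'M[R[i]]_n.+1 := (map_mx conjc X)^T.

Lemma adjmxK : involutive adjmx.
Proof. by move=> X; apply/matrixP => i j; rewrite !mxE conjcK. Qed.

Lemma adjmxD : {morph adjmx : X Y / X + Y}.
Proof. by move=> X Y; apply/matrixP => i j; rewrite !mxE rmorphD. Qed.

Lemma adjmxZ (a : R[i]) X : adjmx (a *: X) = a^* *: adjmx X.
Proof. by apply/matrixP => i j; rewrite !mxE rmorphM. Qed.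

Lemma adjmxM X Y : adjmx (X * Y) = adjmx Y * adjmx X.
Proof. by rewrite /adjmx -[X * Y]/(X *m Y) map_mxM trmx_mul. Qed.

HB.instance Definition _ := isStarAlgebra.Build R 'M[R[i]]_n.+1
  adjmxK adjmxD adjmxZ adjmxM.

Definition l2norm (v : 'cV[R[i]]_n.+1) : R :=
  Num.sqrt (\sum_i Normc.normc (v i 0) ^+ 2).

Definition opnorm (X : 'M[R[i]]_n.+1) : R :=
  sup [set l2norm (X *m v) | v in [set v | l2norm v <= 1]].

End MatrixAlgebra.

Section CNormTheory.
Variables (R : realType) (A : cstarAlgType R).
Implicit Types x y : A.

Lemma cnorm0 : cnorm (0 : A) = 0.
Proof. by rewrite -(scale0r (0 : A)) cnormZ Normc.normc0 mul0r. Qed.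

Lemma cnormN x : cnorm (- x) = cnorm x.
Proof.
by rewrite -scaleN1r cnormZ (normcN (1 : Rcomplex R)) Normc.normc1 mul1r.
Qed.

Lemma cnorm_ge0 x : 0 <= cnorm x.
Proof.
have := ler_cnormD x (- x); rewrite subrr cnorm0 cnormN -mulr2n.
by rewrite pmulrn_lge0.
Qed.

Lemma cnorm_distC x y : cnorm (x - y) = cnorm (y - x).
Proof. by rewrite -cnormN opprB. Qed.

Lemma cnorm_dist_trans y x z : cnorm (x - z) <= cnorm (x - y) + cnorm (y - z).
Proof. by rewrite (_ : x - z = (x - y) + (y - z)) ?ler_cnormD// addrA subrK. Qed.

Lemma cnorm_star x : cnorm (star x) = cnorm x.
Proof.
have le (z : A) : cnorm z <= cnorm (star z).
  have := ler_cnormM (star z) z; rewrite cnorm_starM expr2.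
  have := cnorm_ge0 z; rewrite le_eqVlt => /orP[/eqP <-|z0].
    by rewrite cnorm_ge0.
  by rewrite ler_pM2r.
by apply/eqP; rewrite eq_le le -{2}(starK x) le.
Qed.

End CNormTheory.

Section Ultrapower.
Variables (R : realType) (A : cstarAlgType R) (I : Type) (U : set_system I).

Record linfty := Linfty {
  linf_val :> I -> A;
  linf_bounded : exists M : R, forall i, cnorm (linf_val i) <= M }.

Implicit Types f g : linfty.

Lemma linfty_eq f g : (forall i, f i = g i) -> f = g.
Proof.
case: f g => [f bf] [g bg] /= /funext fg; case: _ / fg in bg *.
by congr Linfty; exact: Prop_irrelevance.
Qed.

HB.instance Definition _ := gen_eqMixin linfty.
HB.instance Definition _ := gen_choiceMixin linfty.

Program Definition linf_cst (x : A) := @Linfty (fun=> x) _.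
Next Obligation. by move=> x; exists (cnorm x). Qed.

Program Definition linf_add (f g : linfty) := @Linfty (fun i => f i + g i) _.
Next Obligation.
move=> f g; have [[M Mf] [N Ng]] := (linf_bounded f, linf_bounded g).
by exists (M + N) => i; rewrite (le_trans (ler_cnormD _ _))// lerD.
Qed.

Program Definition linf_mul (f g : linfty) := @Linfty (fun i => f i * g i) _.
Next Obligation.
move=> f g; have [[M Mf] [N Ng]] := (linf_bounded f, linf_bounded g).
exists (M * N) => i; rewrite (le_trans (ler_cnormM _ _))//.
by rewrite ler_pM// cnorm_ge0.
Qed.

Program Definition linf_scale (a : R[i]) (f : linfty) :=
  @Linfty (fun i => a *: f i) _.
Next Obligation.
move=> a f; have [M Mf] := linf_bounded f.
exists (Normc.normc a * M) => i; rewrite cnormZ ler_wpM2l//.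
by case: a => b c; exact: sqrtr_ge0.
Qed.

Program Definition linf_opp (f : linfty) := @Linfty (fun i => - f i) _.
Next Obligation.
by move=> f; have [M Mf] := linf_bounded f; exists M => i; rewrite cnormN.
Qed.

Program Definition linf_star (f : linfty) := @Linfty (fun i => star (f i)) _.
Next Obligation.
by move=> f; have [M Mf] := linf_bounded f; exists M => i; rewrite cnorm_star.
Qed.

Definition ultra_eq (f g : linfty) : bool :=
  `[< forall e : R, 0 < e -> \forall i \near U, cnorm (f i - g i) < e >].

Hypothesis FU : UltraFilter U.

Lemma ultra_eq_refl : reflexive ultra_eq.
Proof.
by move=> f; apply/asboolP => e e0; near=> i; rewrite subrr cnorm0.
Unshelve. all: by end_near. Qed.

Lemma ultra_eq_sym : symmetric ultra_eq.
Proof.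
by move=> f g; apply/asboolP/asboolP => fg e /fg;
  apply: filterS => i; rewrite cnorm_distC.
Qed.

Lemma ultra_eq_trans : transitive ultra_eq.
Proof.
move=> g f h /asboolP fg /asboolP gh; apply/asboolP => e e0.
have e20 : 0 < e / 2 by rewrite divr_gt0.
apply: filterS2 (fg _ e20) (gh _ e20) => i fgi ghi.
by rewrite (le_lt_trans (cnorm_dist_trans (g i) _ _))// (splitr e) ltrD.
Qed.

Canonical ultra_equiv :=
  EquivRel ultra_eq ultra_eq_refl ultra_eq_sym ultra_eq_trans.

Definition ultrapower := {eq_quot ultra_equiv}.

HB.instance Definition _ := EqQuotient.on ultrapower.
HB.instance Definition _ := Choice.on ultrapower.

Definition ucls (f : linfty) : ultrapower := \pi_ultrapower f.

Lemma uclsP (P : ultrapower -> Prop) : (forall f, P (ucls f)) -> forall x, P x.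
Proof. by move=> H x; rewrite -[x]reprK; exact: H. Qed.

Lemma ucls_eqP f g : ucls f = ucls g <->
  forall e : R, 0 < e -> \forall i \near U, cnorm (f i - g i) < e.
Proof.
by split=> [/eqquotP/asboolP //|fg]; apply/eqquotP/asboolP.
Qed.

Lemma ucls_ext f g : (forall i, f i = g i) -> ucls f = ucls g.
Proof. by move=> fg; congr ucls; exact: linfty_eq. Qed.

Lemma repr_ucls f : forall e : R, 0 < e ->
  \forall i \near U, cnorm (repr (ucls f) i - f i) < e.
Proof. by apply/ucls_eqP; rewrite /ucls reprK. Qed.

Definition uadd (x y : ultrapower) := ucls (linf_add (repr x) (repr y)).
Definition umul (x y : ultrapower) := ucls (linf_mul (repr x) (repr y)).
Definition uscale (a : R[i]) (x : ultrapower) := ucls (linf_scale a (repr x)).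
Definition uopp (x : ultrapower) := ucls (linf_opp (repr x)).
Definition ustar (x : ultrapower) := ucls (linf_star (repr x)).

(* The infimum is the limit of [cnorm (f i)] along the ultrafilter. *)
Definition linf_norm (f : linfty) : R :=
  inf [set r | 0 <= r /\ \forall i \near U, cnorm (f i) <= r].
Definition unorm (x : ultrapower) : R := linf_norm (repr x).

Lemma uaddE f g : uadd (ucls f) (ucls g) = ucls (linf_add f g).
Proof.
apply/ucls_eqP => e e0; have e20 : 0 < e / 2 by rewrite divr_gt0.
apply: filterS2 (repr_ucls f e20) (repr_ucls g e20) => i /= fi gi.
rewrite opprD addrACA (le_lt_trans (ler_cnormD _ _))//.
by rewrite (splitr e) ltrD.
Qed.

Lemma umulE f g : umul (ucls f) (ucls g) = ucls (linf_mul f g).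
Proof.
apply/ucls_eqP => e e0.
have [[M Mf] [N Ng]] := (linf_bounded (repr (ucls f)), linf_bounded g).
have M0 : 0 < `|M| + 1 by rewrite ltr_wpDl.
have N0 : 0 < `|N| + 1 by rewrite ltr_wpDl.
have e1 : 0 < e / 2 / (`|N| + 1) by rewrite !divr_gt0.
have e2 : 0 < e / 2 / (`|M| + 1) by rewrite !divr_gt0.
apply: filterS2 (repr_ucls f e1) (repr_ucls g e2) => i /= fi gi.
set f' := repr (ucls f) in Mf fi *; set g' := repr (ucls g) in gi *.
have -> : f' i * g' i - f i * g i = f' i * (g' i - g i) + (f' i - f i) * g i.
  by rewrite mulrBr mulrBl addrA subrK.
rewrite (le_lt_trans (ler_cnormD _ _))// (splitr e) ltrD//.
- rewrite (le_lt_trans (ler_cnormM _ _))//.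
  rewrite (@le_lt_trans _ _ ((`|M| + 1) * cnorm (g' i - g i)))//.
    rewrite ler_wpM2r ?cnorm_ge0// (le_trans (Mf i))//.
    by rewrite (le_trans (ler_norm _))// lerDl.
  by rewrite mulrC -ltr_pdivlMr.
- rewrite (le_lt_trans (ler_cnormM _ _))//.
  rewrite (@le_lt_trans _ _ (cnorm (f' i - f i) * (`|N| + 1)))//.
    rewrite ler_wpM2l ?cnorm_ge0// (le_trans (Ng i))//.
    by rewrite (le_trans (ler_norm _))// lerDl.
  by rewrite -ltr_pdivlMr.
Qed.

Lemma normc_ge0 (a : R[i]) : 0 <= Normc.normc a.
Proof. by case: a => b c; exact: sqrtr_ge0. Qed.

Lemma uscaleE a f : uscale a (ucls f) = ucls (linf_scale a f).
Proof.
apply/ucls_eqP => e e0.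
have a0 : 0 < Normc.normc a + 1 by rewrite ltr_wpDl ?normc_ge0.
have e1 : 0 < e / (Normc.normc a + 1) by rewrite divr_gt0.
apply: filterS (repr_ucls f e1) => i /= fi.
rewrite -scalerBr cnormZ.
rewrite (@le_lt_trans _ _ ((Normc.normc a + 1) *
  cnorm (repr (ucls f) i - f i)))//.
  by rewrite ler_wpM2r ?cnorm_ge0// lerDl.
by rewrite mulrC -ltr_pdivlMr.
Qed.

Lemma uoppE f : uopp (ucls f) = ucls (linf_opp f).
Proof.
apply/ucls_eqP => e e0; apply: filterS (repr_ucls f e0) => i /= fi.
by rewrite opprK addrC cnorm_distC.
Qed.

Lemma ustarE f : ustar (ucls f) = ucls (linf_star f).
Proof.
apply/ucls_eqP => e e0; apply: filterS (repr_ucls f e0) => i /=.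
by rewrite -starB cnorm_star.
Qed.

Let uE := (uaddE, umulE, uscaleE, uoppE, ustarE).

Let u0 := ucls (linf_cst 0).
Let u1 := ucls (linf_cst 1).

Lemma uaddA : associative uadd.
Proof.
elim/uclsP=> f; elim/uclsP=> g; elim/uclsP=> h; rewrite !uE.
by apply: ucls_ext => i /=; rewrite addrA.
Qed.

Lemma uaddC : commutative uadd.
Proof.
elim/uclsP=> f; elim/uclsP=> g; rewrite !uE.
by apply: ucls_ext => i /=; rewrite addrC.
Qed.

Lemma uadd0 : left_id u0 uadd.
Proof. by elim/uclsP=> f; rewrite !uE; apply: ucls_ext => i /=; rewrite add0r. Qed.

Lemma uaddN : left_inverse u0 uopp uadd.
Proof. by elim/uclsP=> f; rewrite !uE; apply: ucls_ext => i /=; rewrite addNr. Qed.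

HB.instance Definition _ :=
  GRing.isZmodule.Build ultrapower uaddA uaddC uadd0 uaddN.

Lemma umulA : associative umul.
Proof.
elim/uclsP=> f; elim/uclsP=> g; elim/uclsP=> h; rewrite !uE.
by apply: ucls_ext => i /=; rewrite mulrA.
Qed.

Lemma umul1l : left_id u1 umul.
Proof. by elim/uclsP=> f; rewrite !uE; apply: ucls_ext => i /=; rewrite mul1r. Qed.

Lemma umul1r : right_id u1 umul.
Proof. by elim/uclsP=> f; rewrite !uE; apply: ucls_ext => i /=; rewrite mulr1. Qed.

Lemma umulDl : left_distributive umul uadd.
Proof.
elim/uclsP=> f; elim/uclsP=> g; elim/uclsP=> h; rewrite !uE.
by apply: ucls_ext => i /=; rewrite mulrDl.
Qed.

Lemma umulDr : right_distributive umul uadd.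
Proof.
elim/uclsP=> f; elim/uclsP=> g; elim/uclsP=> h; rewrite !uE.
by apply: ucls_ext => i /=; rewrite mulrDr.
Qed.

Lemma u1_neq0 : u1 != u0.
Proof.
apply/eqP => /ucls_eqP h.
have n1 : 0 < cnorm (1 : A).
  rewrite lt_neqAle cnorm_ge0 eq_sym andbT; apply/eqP => /cnorm0_eq0/eqP.
  by rewrite oner_eq0.
by have [i /=] := filter_ex (h _ n1); rewrite subr0 ltxx.
Qed.

HB.instance Definition _ := GRing.Zmodule_isNzRing.Build ultrapower
  umulA umul1l umul1r umulDl umulDr u1_neq0.

Lemma uscaleA (a b : R[i]) x : uscale a (uscale b x) = uscale (a * b) x.
Proof.
by elim/uclsP: x => f; rewrite !uE; apply: ucls_ext => i /=; rewrite scalerA.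
Qed.

Lemma uscale1 : left_id 1 uscale.
Proof. by elim/uclsP=> f; rewrite !uE; apply: ucls_ext => i /=; rewrite scale1r. Qed.

Lemma uscaleDr : right_distributive uscale +%R.
Proof.
move=> a; elim/uclsP=> f; elim/uclsP=> g.
change (uscale a (uadd (ucls f) (ucls g)) =
  uadd (uscale a (ucls f)) (uscale a (ucls g))).
by rewrite !uE; apply: ucls_ext => i /=; rewrite scalerDr.
Qed.

Lemma uscaleDl x : {morph uscale^~ x : a b / a + b}.
Proof.
move=> a b; elim/uclsP: x => f.
change (uscale (a + b) (ucls f) =
  uadd (uscale a (ucls f)) (uscale b (ucls f))).
by rewrite !uE; apply: ucls_ext => i /=; rewrite scalerDl.
Qed.

HB.instance Definition _ := GRing.Zmodule_isLmodule.Build R[i] ultrapower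
  uscaleA uscale1 uscaleDr uscaleDl.

Lemma uscaleAl (a : R[i]) (x y : ultrapower) : a *: (x * y) = a *: x * y.
Proof.
elim/uclsP: x => f; elim/uclsP: y => g.
change (uscale a (umul (ucls f) (ucls g)) = umul (uscale a (ucls f)) (ucls g)).
by rewrite !uE; apply: ucls_ext => i /=; rewrite scalerAl.
Qed.

HB.instance Definition _ :=
  GRing.Lmodule_isLalgebra.Build R[i] ultrapower uscaleAl.

Lemma uscaleAr (a : R[i]) (x y : ultrapower) : a *: (x * y) = x * (a *: y).
Proof.
elim/uclsP: x => f; elim/uclsP: y => g.
change (uscale a (umul (ucls f) (ucls g)) = umul (ucls f) (uscale a (ucls g))).
by rewrite !uE; apply: ucls_ext => i /=; rewrite scalerAr.
Qed.

HB.instance Definition _ :=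
  GRing.Lalgebra_isAlgebra.Build R[i] ultrapower uscaleAr.

Lemma ustarK : involutive ustar.
Proof. by elim/uclsP=> f; rewrite !uE; apply: ucls_ext => i /=; rewrite starK. Qed.

Lemma ustarD : {morph ustar : x y / x + y}.
Proof.
elim/uclsP=> f; elim/uclsP=> g.
change (ustar (uadd (ucls f) (ucls g)) =
  uadd (ustar (ucls f)) (ustar (ucls g))).
by rewrite !uE; apply: ucls_ext => i /=; rewrite starD.
Qed.

Lemma ustarZ (a : R[i]) x : ustar (a *: x) = a^* *: ustar x.
Proof.
elim/uclsP: x => f.
change (ustar (uscale a (ucls f)) = uscale a^* (ustar (ucls f))).
by rewrite !uE; apply: ucls_ext => i /=; rewrite starZ.
Qed.

Lemma ustarM (x y : ultrapower) : ustar (x * y) = ustar y * ustar x.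
Proof.
elim/uclsP: x => f; elim/uclsP: y => g.
change (ustar (umul (ucls f) (ucls g)) =
  umul (ustar (ucls g)) (ustar (ucls f))).
by rewrite !uE; apply: ucls_ext => i /=; rewrite starM.
Qed.

HB.instance Definition _ :=
  isStarAlgebra.Build R ultrapower ustarK ustarD ustarZ ustarM.

Let nset (f : linfty) : set R :=
  [set r | 0 <= r /\ \forall i \near U, cnorm (f i) <= r].

Let nset_inf f : has_inf (nset f).
Proof.
split; last by exists 0 => r [].
have [M Mf] := linf_bounded f; exists `|M|; split => //.
by apply: filterE => i; rewrite (le_trans (Mf i))// ler_norm.
Qed.

Lemma linf_norm_ge0 f : 0 <= linf_norm f.
Proof. by apply: lb_le_inf; [case: (nset_inf f)|move=> r []]. Qed.

Lemma linf_norm_le f r : 0 <= r ->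
  (\forall i \near U, cnorm (f i) <= r) -> linf_norm f <= r.
Proof. by move=> r0 fr; apply: ge_inf => //; case: (nset_inf f). Qed.

Lemma linf_norm_lt f r : linf_norm f < r -> \forall i \near U, cnorm (f i) < r.
Proof.
move=> /(inf_lt (nset_inf f).1) [s [_ fs] sr].
by apply: filterS fs => i; move=> /le_lt_trans; apply.
Qed.

Lemma unormE f : unorm (ucls f) = linf_norm f.
Proof.
rewrite /unorm; set g := repr _.
have gf : forall e : R, 0 < e -> \forall i \near U, cnorm (g i - f i) < e.
  exact: repr_ucls.
have le (h k : linfty) : (forall e : R, 0 < e ->
    \forall i \near U, cnorm (h i - k i) < e) -> linf_norm h <= linf_norm k.
  move=> hk; apply/ler_addgt0Pr => e e0.
  have e20 : 0 < e / 2 by rewrite divr_gt0.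
  apply: linf_norm_le; first by rewrite addr_ge0 ?linf_norm_ge0// ltW.
  have kk : linf_norm k < linf_norm k + e / 2 by rewrite ltrDl.
  apply: filterS2 (hk _ e20) (linf_norm_lt kk) => i hki ki.
  rewrite -(subrK (k i) (h i)) (le_trans (ler_cnormD _ _))//.
  by rewrite addrC [in leRHS](splitr e) addrA lerD// ltW.
apply/eqP; rewrite eq_le !le// => e /gf.
by apply: filterS => i; rewrite cnorm_distC.
Qed.

Lemma unorm_ge0 x : 0 <= unorm x. Proof. exact: linf_norm_ge0. Qed.

Lemma unorm0_eq0 x : unorm x = 0 -> x = 0.
Proof.
elim/uclsP: x => f; rewrite unormE => f0.
apply/ucls_eqP => e e0; rewrite -f0 in e0.
by apply: filterS (linf_norm_lt e0) => i /=; rewrite subr0.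
Qed.

Lemma unormD (x y : ultrapower) : unorm (x + y) <= unorm x + unorm y.
Proof.
elim/uclsP: x => f; elim/uclsP: y => g.
rewrite -[_ + _]/(uadd _ _) !uE !unormE; apply/ler_addgt0Pr => e e0.
have e20 : 0 < e / 2 by rewrite divr_gt0.
apply: linf_norm_le; first by rewrite !addr_ge0 ?linf_norm_ge0// ltW.
have lt h : linf_norm h < linf_norm h + e / 2 by rewrite ltrDl.
apply: filterS2 (linf_norm_lt (lt f)) (linf_norm_lt (lt g)) => i fi gi /=.
by rewrite (le_trans (ler_cnormD _ _))// (splitr e) addrACA lerD// ltW.
Qed.

Let le_mul_approx (x a b : R) : 0 <= a -> 0 <= b ->
  (forall c d, a < c -> b < d -> x <= c * d) -> x <= a * b.
Proof.
move=> a0 b0 H; apply/ler_addgt0Pr => e e0.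
have ab : 0 < a + b + 1 by rewrite ltr_wpDl// addr_ge0.
set t := Num.min 1 (e / (a + b + 1)).
have t0 : 0 < t by rewrite lt_min ltr01 divr_gt0.
have te : t * (a + b + 1) <= e.
  by rewrite -ler_pdivlMr// ge_min lexx orbT.
have t1 : t <= 1 by rewrite ge_min lexx.
apply: (le_trans (H (a + t) (b + t) _ _)); rewrite ?ltrDl//.
have -> : (a + t) * (b + t) = a * b + t * (a + b + t) by ring.
by rewrite lerD2l (le_trans _ te)// ler_pM2l// lerD2l.
Qed.

Lemma unormM (x y : ultrapower) : unorm (x * y) <= unorm x * unorm y.
Proof.
elim/uclsP: x => f; elim/uclsP: y => g.
rewrite -[_ * _]/(umul _ _) !uE !unormE.
apply: le_mul_approx; rewrite ?linf_norm_ge0// => c d fc gd.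
apply: linf_norm_le.
  by rewrite mulr_ge0//; [move: fc|move: gd]; move=> /ltW;
    apply: le_trans; rewrite linf_norm_ge0.
apply: filterS2 (linf_norm_lt fc) (linf_norm_lt gd) => i fi gi /=.
by rewrite (le_trans (ler_cnormM _ _))// ler_pM ?cnorm_ge0// ltW.
Qed.

Lemma unorm_star (x : ultrapower) : unorm (star x) = unorm x.
Proof.
elim/uclsP: x => f; rewrite -[star _]/(ustar _) uE !unormE.
rewrite /linf_norm; congr inf; apply/seteqP.
by split=> r [r0 fr]; split => //; apply: filterS fr => i /=;
  rewrite cnorm_star.
Qed.

Lemma unorm_starM (x : ultrapower) : unorm (star x * x) = unorm x ^+ 2.
Proof.
apply/eqP; rewrite eq_le expr2 -{1}(unorm_star x) unormM /=.
elim/uclsP: x => f.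
have -> : star (ucls f) * ucls f = ucls (linf_mul (linf_star f) f).
  by rewrite -umulE -ustarE.
rewrite !unormE.
apply/ler_addgt0Pr => e e0; set g := linf_mul _ _.
have ge0 : 0 <= linf_norm g + e by rewrite addr_ge0 ?linf_norm_ge0// ltW.
have lt : linf_norm g < linf_norm g + e by rewrite ltrDl.
have : linf_norm f <= Num.sqrt (linf_norm g + e).
  apply: linf_norm_le; first exact: sqrtr_ge0.
  apply: filterS (linf_norm_lt lt) => i /=; rewrite cnorm_starM => /ltW fi.
  by rewrite -(ger0_norm (cnorm_ge0 (f i))) -sqrtr_sqr ler_wsqrtr.
move=> h; rewrite -[leRHS]sqr_sqrtr// expr2.
by rewrite ler_pM ?linf_norm_ge0.
Qed.

Let unormZ_le (a : R[i]) (x : ultrapower) :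
  unorm (a *: x) <= Normc.normc a * unorm x.
Proof.
elim/uclsP: x => f; rewrite -[_ *: _]/(uscale _ _) uE !unormE.
apply: le_mul_approx; rewrite ?linf_norm_ge0 ?normc_ge0// => c d ac fd.
have c0 : 0 <= c by rewrite (le_trans (normc_ge0 a))// ltW.
apply: linf_norm_le.
  by rewrite mulr_ge0// (le_trans (linf_norm_ge0 f))// ltW.
apply: filterS (linf_norm_lt fd) => i fi /=.
by rewrite cnormZ ler_pM ?cnorm_ge0 ?normc_ge0// ltW.
Qed.

Lemma unormZ (a : R[i]) (x : ultrapower) :
  unorm (a *: x) = Normc.normc a * unorm x.
Proof.
apply/eqP; rewrite eq_le unormZ_le /=.
have [->|a0] := eqVneq a 0; first by rewrite Normc.normc0 mul0r unorm_ge0.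
have na0 : 0 < Normc.normc a.
  rewrite lt_neqAle normc_ge0 andbT eq_sym.
  by apply: contra a0 => /eqP/Normc.eq0_normc ->.
rewrite -ler_pdivlMl// -Normc.normcV.
by rewrite (le_trans _ (unormZ_le _ _))// scalerA mulVf// scale1r.
Qed.

Let half := (2^-1 : R).

Let geom_cauchy (B : cstarAlgType R) (v : nat -> B) :
  (forall k, cnorm (v k.+1 - v k) <= half ^+ k) ->
  forall k m, cnorm (v (k + m)%N - v k) <= 2 * half ^+ k.
Proof.
move=> H k m.
suff : cnorm (v (k + m)%N - v k) <= 2 * half ^+ k - 2 * half ^+ (k + m).
  move=> /le_trans; apply; rewrite gerDl oppr_le0 mulr_ge0//.
  by rewrite exprn_ge0// invr_ge0.
elim: m => [|m IH]; first by rewrite addn0 !subrr cnorm0.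
rewrite addnS (le_trans (cnorm_dist_trans (v (k + m)%N) _ _))//.
rewrite (le_trans (lerD (H _) IH))// exprS /half mulrA divff ?mul1r//.
by rewrite le_eqVlt; apply/orP; left; apply/eqP; ring.
Qed.

Let half_small (e : R) : 0 < e -> exists N, forall n, (N <= n)%N ->
  2 * half ^+ n < e.
Proof.
move=> e0.
have : half ^+ n @[n --> \oo] --> (0 : R).
  by apply: cvg_expr; rewrite ger0_norm ?invr_ge0// invf_lt1// ltr1n.
have e20 : 0 < e / 2 by rewrite divr_gt0.
move=> /cvgrPdist_lt /(_ _ e20) [N _ HN]; exists N => n /HN /=.
rewrite sub0r normrN ger0_norm ?exprn_ge0 ?invr_ge0// => h.
by rewrite mulrC -ltr_pdivlMr.
Qed.

Lemma unorm_complete (u : nat -> ultrapower) :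
  (forall e : R, 0 < e -> exists N, forall m n,
     (N <= m)%N -> (N <= n)%N -> unorm (u m - u n) < e) ->
  exists l, forall e : R, 0 < e -> exists N, forall n,
     (N <= n)%N -> unorm (u n - l) < e.
Proof.
move=> cu.
have half_gt0 k : 0 < half ^+ k by rewrite exprn_gt0// invr_gt0.
have [N HN] := choice (fun k => cu _ (half_gt0 k)).
pose Y k := repr (u (N k + N k.+1)%N).
pose d k i := Y k.+1 i - Y k i.
have dk k : \forall i \near U, cnorm (d k i) < half ^+ k.
  apply: (@linf_norm_lt (linf_add (Y k.+1) (linf_opp (Y k)))).
  have -> : linf_norm (linf_add (Y k.+1) (linf_opp (Y k))) =
      unorm (u (N k.+1 + N k.+2)%N - u (N k + N k.+1)%N).
    by rewrite -unormE -uaddE -uoppE /Y /ucls !reprK.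
  rewrite (@lt_trans _ _ (half ^+ k.+1))//.
    by apply: HN; rewrite ?leq_addr// leq_addl.
  by rewrite exprS gtr_pMl// invf_lt1// ltr1n.
pose d' k i := if cnorm (d k i) <= half ^+ k then d k i else 0.
pose z k i := Y 0%N i + \sum_(0 <= j < k) d' j i.
have zS k i : z k.+1 i - z k i = d' k i.
  by rewrite /z big_nat_recr//= opprD addrACA subrr add0r addrAC subrr add0r.
have zd i k : cnorm (z k.+1 i - z k i) <= half ^+ k.
  by rewrite zS /d'; case: ifP => // _; rewrite cnorm0 ltW.
have zY k : \forall i \near U, z k i = Y k i.
  elim: k => [|k IH]; first by apply: filterE => i; rewrite /z big_geq// addr0.
  apply: filterS2 IH (dk k) => i zk dki.
  rewrite -(subrK (z k i) (z k.+1 i)) zS zk /d' ltW// /d subrK //.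
have zl i : exists l, forall e : R, 0 < e -> exists M, forall n, (M <= n)%N ->
    cnorm (z n i - l) < e.
  apply: cnorm_complete => e e0.
  have e20 : 0 < e / 2 by rewrite divr_gt0.
  have [M HM] := half_small e20; exists M => m n Mm Mn.
  rewrite (le_lt_trans (cnorm_dist_trans (z M i) _ _))// (splitr e) ltrD//.
    rewrite -(subnKC Mm) (le_lt_trans (geom_cauchy (zd i) _ _))//.
    exact: HM.
  rewrite cnorm_distC -(subnKC Mn) (le_lt_trans (geom_cauchy (zd i) _ _))//.
  exact: HM.
have [l Hl] := choice zl.
have lz k i : cnorm (l i - z k i) <= 2 * half ^+ k.
  apply/ler_addgt0Pr => e e0; have [M HM] := Hl i _ e0.
  rewrite [leRHS]addrC (le_trans (cnorm_dist_trans (z (k + M)%N i) _ _))// lerD//.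
    by rewrite cnorm_distC ltW// HM// leq_addl.
  exact: (@geom_cauchy _ (z^~ i) (zd i)).
have lb : exists M : R, forall i, cnorm (l i) <= M.
  have [M HM] := linf_bounded (Y 0%N); exists (2 + M) => i.
  rewrite -(subrK (z 0%N i) (l i)) (le_trans (ler_cnormD _ _))// lerD//.
    by rewrite (le_trans (lz _ _))// expr0 mulr1.
  by rewrite /z big_geq// addr0.
pose L := Linfty lb.
have YL k : unorm (ucls (Y k) - ucls L) <= 2 * half ^+ k.
  have -> : ucls (Y k) - ucls L = ucls (linf_add (Y k) (linf_opp L)).
    by rewrite -uaddE -uoppE.
  rewrite unormE; apply: linf_norm_le; first by rewrite mulr_ge0// ltW.
  by apply: filterS (zY k) => i zYi /=; rewrite -zYi cnorm_distC.
exists (ucls L) => e e0; have e20 : 0 < e / 2 by rewrite divr_gt0.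
have [M HM] := half_small e20.
have YE k : ucls (Y k) = u (N k + N k.+1)%N by rewrite /Y /ucls reprK.
have [K MK NK] : exists2 K, (M <= K)%N & forall n, (N K <= n)%N ->
    unorm (u n - ucls (Y K)) < e / 2.
  exists M => // n Nn; rewrite YE.
  rewrite (@lt_trans _ _ (half ^+ M)) ?HN ?leq_addr//.
  by rewrite (le_lt_trans _ (HM _ (leqnn M)))// ler_peMl ?ler1n// ltW.
exists (N K) => n Nn.
have -> : u n - ucls L = (u n - ucls (Y K)) + (ucls (Y K) - ucls L).
  by rewrite addrA subrK.
rewrite (le_lt_trans (unormD _ _))// (splitr e) ltrD ?NK//.
by rewrite (le_lt_trans (YL K))// HM.
Qed.

HB.instance Definition _ := isCStarAlgebra.Build R ultrapower
  unorm0_eq0 unormD unormZ unormM unorm_starM unorm_complete.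

End Ultrapower.

Section Classes.
Variable R : realType.
Implicit Type A : cstarAlgType R.

Definition separable A := exists d : nat -> A,
  forall x (e : R), 0 < e -> exists n, cnorm (x - d n) < e.

(* [A] is the closure of an increasing union of unital *-subalgebras, the n-th
   one being a copy of the full matrix algebra of size [(k n).+1].  Full matrix
   algebras are UHF under this definition. *)
Definition matrix_tower A (k : nat -> nat) :=
  exists f : forall n, {lrmorphism 'M[R[i]]_((k n).+1) -> A},
    [/\ forall n, star_preserving (f n) /\ injective (f n),
        forall n, range (f n) `<=` range (f n.+1)
      & forall x (e : R), 0 < e -> exists n X, cnorm (x - f n X) < e].

Definition UHF A := exists k, matrix_tower A k.

(* The UHF algebra whose supernatural number is divisible by every integer. *)
Definition universal_UHF A := exists2 k, matrix_tower A k &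
  forall m, (0 < m)%N -> exists n, (m %| (k n).+1)%N.

Definition completely_positive A n (f : A -> 'M[R[i]]_n.+1) :=
  forall m (X : 'M[A]_m), positive_mx X -> positive_mx (map_mx f X).

(* In terms of unital completely positive maps, by Voiculescu's theorem. *)
Definition quasidiagonal A := forall (F : seq A) (e : R), 0 < e ->
  exists n (f : {linear A -> 'M[R[i]]_n.+1}),
    [/\ f 1 = 1, completely_positive f,
        forall a b, a \in F -> b \in F -> opnorm (f (a * b) - f a * f b) < e
      & forall a, a \in F -> `|opnorm (f a) - cnorm a| < e].

(* The MF problem, for algebras of arbitrary density character; the index set
   of the ultrapower depends on the algebra. *)
Definition MF_problem_positive (Q : cstarAlgType R) :=
  forall A, stably_finite A -> exists (I : Type) (U : set_system I)
    (FU : UltraFilter U), embeds A (ultrapower Q FU).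

End Classes.

(* [cterm srt k] is the type of terms of the sort of the ball of radius [k],
   over generators (variables or constants) [g] of radius [(srt g).+1].
   [cterm srt 0] is empty. *)
Inductive cterm (G : Type) (srt : G -> nat) : nat -> Type :=
| TGen g : cterm srt (srt g).+1
| TZero : cterm srt 1
| TOne : cterm srt 1
| TAdd j k of cterm srt j & cterm srt k : cterm srt (j + k)
| TMul j k of cterm srt j & cterm srt k : cterm srt (j * k)
| TStar k of cterm srt k : cterm srt k
| TScale (a b : rat) j k of (a ^+ 2 + b ^+ 2) * j%:R ^+ 2 <= k%:R ^+ 2
    & (0 < k)%N & cterm srt j : cterm srt k
| TIncl j k of (j <= k)%N & cterm srt j : cterm srt k.

Section Formulas.
Variable R : realType.

(* Quantifier-free formulas, with arbitrary continuous connectives. *)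
Inductive qf (G : Type) (srt : G -> nat) : Type :=
| Dist k of cterm srt k & cterm srt k
| Conn n (f : 'rV[R]_n -> R) of continuous f & ('I_n -> qf srt).

Section Semantics.
Variables (A : cstarAlgType R) (G : Type) (srt : G -> nat) (v : G -> A).

Definition in_balls := forall g, cnorm (v g) <= (srt g).+1%:R.

Fixpoint teval k (t : cterm srt k) : A :=
  match t with
  | TGen g => v g
  | TZero => 0
  | TOne => 1
  | TAdd _ _ s t => teval s + teval t
  | TMul _ _ s t => teval s * teval t
  | TStar _ t => star (teval t)
  | TScale a b _ _ _ _ t => (ratr a +i* ratr b) *: teval t
  | TIncl _ _ _ t => teval t
  end.

Fixpoint qeval (phi : qf srt) : R :=
  match phi with
  | Dist _ s t => cnorm (teval s - teval t)
  | Conn n f _ args => f (\row_i qeval (args i))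
  end.

End Semantics.

Definition connectives := forall n, set ('rV[R]_n -> R).

Inductive generated (F : connectives) n : ('rV[R]_n -> R) -> Prop :=
| gen_proj i : generated F (fun x => x 0 i)
| gen_comp m (f : 'rV[R]_m -> R) (g : 'I_m -> 'rV[R]_n -> R) of
    F m f & (forall i, generated F (g i)) :
    generated F (fun x => f (\row_i g i x)).

(* Uniform density is meant on compact sets, as R^n itself is not compact.
   Density is required for connectives of positive arity only. *)
Definition admissible (F : connectives) :=
  [/\ forall n, countable (F n),
      forall n f, F n f -> continuous f
    & forall n (f : 'rV[R]_n.+1 -> R), continuous f ->
      forall M e : R, 0 < e -> exists g, generated F g /\
        forall x : 'rV[R]_n.+1, (forall i, `|x 0 i| <= M) -> `|f x - g x| < e].

Fixpoint restricted (F : connectives) G (srt : G -> nat) (phi : qf srt) : Prop :=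
  match phi with
  | Dist _ _ _ => True
  | Conn n f _ args => F n f /\ forall i, restricted F (args i)
  end.

Definition join_fun S T (U : Type) (f : S -> U) (g : T -> U) (z : S + T) : U :=
  match z with inl s => f s | inr t => g t end.

(* The sentence sup_x inf_n inf_y psi_n(x, y), where x is the tuple of variables
   indexed by ['I_(outer s)] and, for the n-th formula, y is indexed by
   ['I_(inner s n)].  As usual formulas take nonnegative values. *)
Record sup_inf_sentence := SupInf {
  outer : nat;
  outer_sort : 'I_outer -> nat;
  inner : nat -> nat;
  inner_sort : forall n, 'I_(inner n) -> nat;
  matrix_of : forall n, qf (join_fun outer_sort (@inner_sort n));
  matrix_ge0 : forall n (A : cstarAlgType R) (v : 'I_outer + 'I_(inner n) -> A),
    in_balls (join_fun outer_sort (@inner_sort n)) v ->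
    0 <= qeval v (matrix_of n) }.

Definition sentence_value (A : cstarAlgType R) (s : sup_inf_sentence) : \bar R :=
  ereal_sup [set ereal_inf [set
      ereal_inf [set (qeval (join_fun x y) (matrix_of s n))%:E
        | y in in_balls (@inner_sort s n)]
    | n in [set: nat]]
  | x in in_balls (@outer_sort s) (A := A)].

Definition sup_value (A : cstarAlgType R) (sigma : nat -> sup_inf_sentence) :
  \bar R := ereal_sup [set sentence_value A (sigma j) | j in [set: nat]].

Definition defined_by (P : cstarAlgType R -> Prop)
    (sigma : nat -> sup_inf_sentence) :=
  forall A, separable A -> P A <-> forall j, sentence_value A (sigma j) = 0%E.

End Formulas.

Section Game.
Variables (R : realType) (F : connectives R).

(* The constant [(k, n)] is the n-th new constant of the sort of radius [k.+1]. *)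
Definition cst : Type := (nat * nat)%type.
Definition cst_sort (c : cst) : nat := c.1.

(* [(phi, r)] stands for the expression phi < r. *)
Definition expr : Type := (qf R cst_sort * R)%type.

(* The models of T are the unital stably finite C*-algebras. *)
Definition models (A : cstarAlgType R) (c : cst -> A) (p : set expr) :=
  [/\ stably_finite A, in_balls cst_sort c
    & forall e, p e -> qeval c e.1 < e.2].

Definition condition (p : set expr) :=
  [/\ finite_set p, forall e, p e -> restricted F e.1
    & exists (A : cstarAlgType R) (c : cst -> A), models c p].

Definition entails_dist (p : set expr) k (s t : cterm cst_sort k) (r : R) :=
  forall (A : cstarAlgType R) (c : cst -> A), models c p ->
    cnorm (teval c s - teval c t) = r.

Definition definitive (p : set expr) :=
  forall k (s t : cterm cst_sort k), exists! r, entails_dist p s t r.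

(* [A], with [c] interpreting the constants, is a completion of the prestructure
   of closed terms determined by [p]. *)
Definition compiled (p : set expr) (A : cstarAlgType R) (c : cst -> A) :=
  [/\ in_balls cst_sort c,
      forall k (s t : cterm cst_sort k),
        entails_dist p s t (cnorm (teval c s - teval c t))
    & forall x (e : R), 0 < e -> exists k (t : cterm cst_sort k),
        cnorm (x - teval c t) < e].

(* A strategy for the second player maps the sequence of all previous moves to
   the next move. *)
Definition strategy := seq (set expr) -> set expr.

Definition legal_strategy (S : strategy) := forall h p, condition p ->
  condition (S (rcons h p)) /\ p `<=` S (rcons h p).

Definition play (S : strategy) (p : nat -> set expr) :=
  [/\ forall i, condition (p i), forall i, p i `<=` p i.+1
    & forall i, p i.*2.+1 = S (mkseq p i.*2.+1)].

Definition enforceable (P : cstarAlgType R -> Prop) :=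
  exists2 S, legal_strategy S & forall p, play S p ->
    let pbar := \bigcup_i p i in
    definitive pbar /\ exists (A : cstarAlgType R) (c : cst -> A),
      compiled pbar c /\ P A.

End Game.

(* Main.v *)
Require Import Defs.
From HB Require Import structures.
From mathcomp Require Import all_boot all_order all_algebra.
From mathcomp Require Import generic_quotient complex mxtens ring lra.
From mathcomp Require Import all_classical all_reals all_analysis.

(* If one of the last four properties is enforceable, letting the first player
   open with a condition [p] and then pass shows that [p] is realized in a
   separable algebra with that property.  All these algebras embed into an
   ultrapower of [Q]: a UHF algebra is quasidiagonal, by the conditional
   expectations for its trace, and a quasidiagonal algebra embeds locally into [Q]
   because every matrix algebra does.  Hence every condition is realized in [Q],
   so every stably finite algebra embeds locally into [Q], and into an ultrapower.

   Conversely, if every condition is realized in [Q], the second player can make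
   [Q] itself the compiled structure.  Through the play one keeps interpretations
   of the constants in [Q] which change by at most [2^-i] at round [i] on more and
   more constants.  This is possible because an answer may require some fresh
   constants to be approximate matrix units nearly generating finitely many given
   elements, and approximate matrix units in [Q] are unitarily conjugate to exact
   ones up to a small error.  So the four properties are enforceable as soon as [Q]
   has them. *)

Set Implicit Arguments.
Unset Strict Implicit.
Unset Printing Implicit Defensive.

Import Order.TTheory GRing.Theory Num.Theory numFieldNormedType.Exports.

Local Open Scope classical_set_scope.
Local Open Scope ring_scope.
Local Open Scope complex_scope.

(** * Elementary C*-algebra theory *)

(** The obstacle is that conditions never determine the values of the constants in [Q]: the next
    condition may be realized by any tuple, so closeness from round to round can only be had up to
    an automorphism of [Q]. Conditions are invariant under unitary conjugation, and approximate
    matrix units control the unitary orbit of a tuple; this is where finiteness of [Q] and a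
    comparison of ranks enter. Three further demands shape a round. A limit turns [phi < r] into
    [phi <= r], so every inequality is repeated with a smaller right-hand side. Definitiveness
    concerns all models of the union of the play, not only [Q], so distances of terms are decided
    explicitly, from above and from below. Density of the closed terms is met when an interpretation
    is chosen, by giving a fresh constant the next value of a dense sequence. A strategy sees only
    the past moves; it recomputes the interpretations from them by fixed choices. *)

Section CStarBasics.
Variables (R : realType) (A : cstarAlgType R).
Implicit Types (x y z w u : A) (r t e : R).

Lemma normcR r : Normc.normc r%:C = `|r|.
Proof. by rewrite /= expr0n addr0 sqrtr_sqr. Qed.

Lemma cnormZr r x : cnorm (r%:C *: x) = `|r| * cnorm x.
Proof. by rewrite cnormZ normcR. Qed.

Lemma conjE (a : R[i]) : Num.conj a = conjc a.
Proof. by []. Qed.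

Lemma starZr r x : star (r%:C *: x) = r%:C *: star x.
Proof. by rewrite starZ conjE conjc_real. Qed.

Lemma star1 : star (1 : A) = 1.
Proof. by apply: star_inj; rewrite -[star 1]mul1r starM starK mul1r. Qed.

Lemma star_sum I (s : seq I) (P : pred I) (f : I -> A) :
  star (\sum_(i <- s | P i) f i) = \sum_(i <- s | P i) star (f i).
Proof. exact: (big_morph _ (@starD _ A) (star0 A)). Qed.

Lemma cnorm_eq0 x : (cnorm x == 0) = (x == 0).
Proof. by apply/eqP/eqP => [/cnorm0_eq0 //|->]; rewrite cnorm0. Qed.

Lemma cnorm_gt0 x : (0 < cnorm x) = (x != 0).
Proof. by rewrite lt_neqAle cnorm_ge0 andbT eq_sym cnorm_eq0. Qed.

(** [star x * x] is self-adjoint, hence so is [x], and [x^2 = x]: the first hypothesis is a one-line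
    way of saying that [x] is a projection. *)
Lemma cnorm_proj x : star x * x = x -> x != 0 -> cnorm x = 1.
Proof.
move=> xx x0; have := cnorm_starM x; rewrite xx expr2 => h.
by apply: (@mulIf _ (cnorm x)); rewrite ?cnorm_eq0// mul1r -h.
Qed.

Lemma cnorm1 : cnorm (1 : A) = 1.
Proof. by rewrite cnorm_proj ?oner_eq0// star1 mul1r. Qed.

Lemma cnormA r : cnorm (r%:C%:A : A) = `|r|.
Proof. by rewrite cnormZr cnorm1 mulr1. Qed.

Lemma ler_cnormB x y : cnorm (x - y) <= cnorm x + cnorm y.
Proof. by rewrite -(cnormN y) ler_cnormD. Qed.

Lemma ler_cnorm_dist x y : `|cnorm x - cnorm y| <= cnorm (x - y).
Proof.
have le a b : cnorm a - cnorm b <= cnorm (a - b).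
  by rewrite lerBlDr (le_trans _ (ler_cnormD _ _))// subrK.
by rewrite ler_norml le andbT lerNl opprB cnorm_distC le.
Qed.

Lemma ler_cnorm_sum I (s : seq I) (P : pred I) (f : I -> A) :
  cnorm (\sum_(i <- s | P i) f i) <= \sum_(i <- s | P i) cnorm (f i).
Proof.
elim/big_ind2: _ => [|x a y b xa yb|//]; first by rewrite cnorm0.
by rewrite (le_trans (ler_cnormD _ _))// lerD.
Qed.

Lemma ler_cnormMl x y r : cnorm x <= r -> cnorm (x * y) <= r * cnorm y.
Proof.
by move=> xr; rewrite (le_trans (ler_cnormM _ _))// ler_wpM2r// cnorm_ge0.
Qed.

Lemma ler_cnormMr x y r : cnorm y <= r -> cnorm (x * y) <= cnorm x * r.
Proof.
by move=> yr; rewrite (le_trans (ler_cnormM _ _))// ler_wpM2l// cnorm_ge0.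
Qed.

(** Passage to the limit takes this form throughout: an identity is proved by bounding its defect by
    a multiple of every [e]. *)
Lemma cnorm_small_eq0 x (c : R) : (forall e, 0 < e -> cnorm x <= c * e) -> x = 0.
Proof.
move=> h; apply/eqP; rewrite -cnorm_eq0 eq_le cnorm_ge0 andbT.
apply/ler_addgt0Pr => e e0; rewrite add0r.
have c0 : 0 < `|c| + 1 by rewrite ltr_wpDl.
apply: le_trans (h (e / (`|c| + 1)) _) _; first by rewrite divr_gt0.
rewrite mulrCA ger_pMr// ler_pdivrMr// mul1r.
by rewrite (le_trans (ler_norm _))// lerDl.
Qed.


Lemma scale_half x : (2^-1)%:C *: (x + x) = x.
Proof.
rewrite scalerDr -scalerDl -(rmorphD (real_complex R)).
by rewrite (_ : 2^-1 + 2^-1 = 1) ?scale1r//; lra.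
Qed.

(* With [u = x + i y] the hypotheses say [u^* u = t], and [x = (u + u^* ) / 2]. *)
Lemma sum_sq_bound x y t : star x = x -> star y = y -> x * y = y * x ->
  0 <= t -> x * x + y * y = t%:C%:A -> cnorm x ^+ 2 <= t.
Proof.
move=> sx sy xy t0 xyt.
set u := x + 'i%C *: y.
have su : star u = x - 'i%C *: y.
  by rewrite /u starD sx starZ sy conjE -scaleNr; congr (_ + _ *: _); simpc.
have uu : star u * u = t%:C%:A.
  have ii : 'i%C * 'i%C = -1 :> R[i] by rewrite -expr2 sqr_i.
  rewrite su /u mulrDr !mulrBl -!scalerAr -!scalerAl scalerA ii -xyt xy.
  by rewrite scaleN1r opprK addrA subrK.
have nu : cnorm u ^+ 2 = t by rewrite -cnorm_starM uu cnormA ger0_norm.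
have hx : (2^-1)%:C *: (u + star u) = x.
  by rewrite su /u addrACA subrr addr0 scale_half.
have : cnorm x <= cnorm u.
  rewrite -hx cnormZr ger0_norm ?invr_ge0// ler_pdivrMl// (le_trans (ler_cnormD _ _))//.
  by rewrite cnorm_star -mulr2n mulr_natl.
by rewrite -nu => xu; rewrite ler_pXn2r// ?nnegrE ?cnorm_ge0.
Qed.

Let sq_dist (a b : A) (p q : R) : cnorm a <= p -> cnorm b <= q ->
  cnorm (a - b) <= p - q -> cnorm (a * a - b * b) <= p * p - q * q.
Proof.
move=> ap bq abpq.
have -> : a * a - b * b = a * (a - b) + (a - b) * b.
  by rewrite mulrBr mulrBl addrA subrK.
have pq : 0 <= p - q by exact: le_trans (cnorm_ge0 _) abpq.
rewrite (le_trans (ler_cnormD _ _))//.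
rewrite (_ : p * p - q * q = p * (p - q) + (p - q) * q); last by ring.
by rewrite lerD// (le_trans (ler_cnormM _ _))// ler_pM ?cnorm_ge0.
Qed.

(* [y = lim y_n] with [y_0 = 0] and [y_(n+1) = (w + y_n^2) / 2] solves
   [(1 - y)^2 = 1 - w]; the same recursion started from [cnorm w] dominates the
   increments, so no strict inequality [cnorm w < 1] is needed. *)
Lemma sqrt_1B w : star w = w -> cnorm w <= 1 -> exists s,
  [/\ star s = s, s * s = 1 - w, forall x, x * w = w * x -> x * s = s * x
    & cnorm (1 - s) <= cnorm w].
Proof.
move=> sw w1; set t := cnorm w.
have t0 : 0 <= t := cnorm_ge0 w.
have half0 : 0 <= (2^-1 : R) by rewrite invr_ge0.
pose y := fix y n := if n is n.+1 then (2^-1)%:C *: (w + y n * y n) else 0.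
pose q := fix q n := if n is n.+1 then 2^-1 * (t + q n * q n) else 0.
have q0 n : 0 <= q n.
  by case: n => //= n; rewrite mulr_ge0// addr_ge0// -expr2 sqr_ge0.
have yq n : cnorm (y n) <= q n.
  elim: n => [|n IH]; first by rewrite cnorm0.
  rewrite cnormZr ger0_norm//= ler_wpM2l// (le_trans (ler_cnormD _ _))//.
  by rewrite lerD2l (le_trans (ler_cnormM _ _))// ler_pM ?cnorm_ge0.
have yqS n : cnorm (y n.+1 - y n) <= q n.+1 - q n.
  elim: n => [|n IH].
    by rewrite /= !mulr0 !addr0 !subr0 cnormZr ger0_norm.
  have -> : y n.+2 - y n.+1 = (2^-1)%:C *: (y n.+1 * y n.+1 - y n * y n).
    have h (a b : A) : (2^-1)%:C *: (w + a) - (2^-1)%:C *: (w + b) =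
        (2^-1)%:C *: (a - b) by rewrite -scalerBr opprD addrACA subrr add0r.
    exact: h.
  have -> : q n.+2 - q n.+1 = 2^-1 * (q n.+1 * q n.+1 - q n * q n).
    by have h (a b : R) : 2^-1 * (t + a) - 2^-1 * (t + b) = 2^-1 * (a - b);
      [ring|exact: h].
  by rewrite cnormZr ger0_norm// ler_wpM2l// sq_dist.
have qS n : q n <= q n.+1.
  by rewrite -subr_ge0 (le_trans (cnorm_ge0 _) (yqS n)).
have qt n : q n <= t.
  elim: n => // n IH /=.
  have : q n * q n <= 1 * t by rewrite ler_pM// (le_trans IH).
  lra.
have ndq : nondecreasing_seq q by apply/nondecreasing_seqP.
have qcvg : q n @[n --> \oo] --> sup (range q).
  by apply: nondecreasing_cvgn => //; exists t => _ [n _ <-].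
have ydist n m : cnorm (y (n + m)%N - y n) <= q (n + m)%N - q n.
  elim: m => [|m IH]; first by rewrite addn0 !subrr cnorm0.
  rewrite addnS (le_trans (cnorm_dist_trans (y (n + m)%N) _ _))//.
  by rewrite (le_trans (lerD (yqS _) IH))// addrA subrK.
have [l yl] : exists l, forall e : R, 0 < e -> exists N, forall n,
    (N <= n)%N -> cnorm (y n - l) < e.
  apply: cnorm_complete => e e0.
  have e20 : 0 < e / 2 by rewrite divr_gt0.
  move/cvgrPdist_lt : qcvg => /(_ _ e20) [N _ HN]; exists N => m n Nm Nn.
  have H k : (N <= k)%N -> cnorm (y k - y N) < e / 2.
    move=> Nk; rewrite -(subnKC Nk) (le_lt_trans (ydist _ _))//.
    rewrite (le_lt_trans _ (HN N (leqnn N)))//= (le_trans _ (ler_norm _))//.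
    rewrite lerB//; apply: ub_le_sup; first by exists t => _ [i _ <-].
    by exists (N + (k - N))%N.
  rewrite (le_lt_trans (cnorm_dist_trans (y N) _ _))// (splitr e) ltrD ?H//.
  by rewrite cnorm_distC H.
have approx e : 0 < e -> exists2 n, cnorm (y n - l) < e & cnorm (y n.+1 - l) < e.
  by move=> /yl[N HN]; exists N; rewrite HN.
have lt : cnorm l <= t.
  apply/ler_addgt0Pr => e /approx[n ynl _].
  rewrite -(subrK (y n) l) (le_trans (ler_cnormD _ _))// addrC lerD//.
    by rewrite (le_trans (yq n)).
  by rewrite cnorm_distC ltW.
have sy n : star (y n) = y n.
  by elim: n => [|n IH]; rewrite /= ?star0// starZr starD sw starM IH.
have sl : star l = l.
  apply/eqP; rewrite -subr_eq0; apply/eqP/(@cnorm_small_eq0 _ 2) => e /approx[n yn _].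
  rewrite (le_trans (cnorm_dist_trans (y n) _ _))// mulr_natl mulr2n lerD//.
    by rewrite -{1}sy -starB cnorm_star cnorm_distC ltW.
  exact: ltW.
have ll : l + l = w + l * l.
  apply/eqP; rewrite -subr_eq0; apply/eqP/(@cnorm_small_eq0 _ 4) => e /approx[n yn ynS].
  have hy : y n.+1 + y n.+1 = w + y n * y n.
    by rewrite /= -scalerDr scale_half.
  have -> : l + l - (w + l * l) =
      (l - y n.+1) + (l - y n.+1) + (y n * y n - l * l).
    rewrite (addrACA l (- _)) -opprD hy -(addrA (l + l)).
    by congr (_ + _); rewrite !opprD -addrA addKr.
  have ab : cnorm (y n * y n - l * l) <= e + e.
    have -> : y n * y n - l * l = y n * (y n - l) + (y n - l) * l.
      by rewrite mulrBr mulrBl addrA subrK.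
    have h (a b : R) : 0 <= a -> a <= 1 -> 0 <= b -> b < e -> a * b <= e.
      by move=> a0 a1 b0 be; rewrite (le_trans (ler_piMl _ _))// ltW.
    rewrite (le_trans (ler_cnormD _ _))// lerD// (le_trans (ler_cnormM _ _))//.
      by rewrite h ?cnorm_ge0// (le_trans (yq n))// (le_trans (qt n)).
    by rewrite mulrC h ?cnorm_ge0// (le_trans lt).
  have ynS' : cnorm (l - y n.+1) < e by rewrite cnorm_distC.
  have := ler_cnormD (l - y n.+1 + (l - y n.+1)) (y n * y n - l * l).
  have := ler_cnormD (l - y n.+1) (l - y n.+1).
  lra.
exists (1 - l); split.
- by rewrite starB star1 sl.
- have -> : w = l + l - l * l by rewrite ll addrK.
  rewrite mulrBl mul1r mulrBr mulr1 !opprB -addrA; congr (1 + _).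
  by rewrite addrCA opprD.
- move=> x xw; suff xl : x * l = l * x by rewrite mulrBl mulrBr mul1r mulr1 xl.
  have xy n : x * y n = y n * x.
    elim: n => [|n IH]; rewrite /= ?mulr0 ?mul0r// -scalerAr -scalerAl.
    by rewrite mulrDr mulrDl xw mulrA IH -!mulrA IH.
  apply/eqP; rewrite -subr_eq0; apply/eqP/(@cnorm_small_eq0 _ (2 * cnorm x)).
  move=> e /approx[n yn _].
  have -> : x * l - l * x = x * (l - y n) + (y n - l) * x.
    by rewrite mulrBr mulrBl xy addrA subrK.
  rewrite (le_trans (ler_cnormD _ _))// -mulrA mulr_natl mulr2n lerD//.
    by rewrite ler_cnormMr// cnorm_distC ltW.
  by rewrite [leRHS]mulrC ler_cnormMl// ltW.
- by rewrite opprB addrC subrK.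
Qed.

(* [|z| = s = v^2]. *)
Lemma absz_sqrt z : star z = z -> cnorm z <= 1 -> exists s v : A,
  [/\ star s = s, star v = v, s * s = z * z, s = v * v
    & forall x, x * z = z * x -> x * s = s * x /\ x * v = v * x].
Proof.
move=> sz z1.
have szz : star (z * z) = z * z by rewrite starM sz.
have zz1 : cnorm (z * z) <= 1.
  by rewrite (le_trans (ler_cnormM _ _))// mulr_ile1// cnorm_ge0.
(* All three roots have the form [sqrt (1 - w)]: [b] is a root of [1 - z^2], [s] of [1 - b^2 = z^2],
   and [v] of [1 - (1 - s) = s]. *)
have [b [sb bb zb _]] := sqrt_1B szz zz1.
have cz x : x * z = z * x -> x * (z * z) = (z * z) * x.
  by move=> xz; rewrite mulrA xz -!mulrA xz.
have b1 : cnorm (b * b) <= 1.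
  rewrite -{1}sb cnorm_starM (@sum_sq_bound _ z)//.
  - by rewrite -zb// cz.
  - by rewrite bb subrK scale1r.
have sbb : star (b * b) = b * b by rewrite starM sb.
have [s [ss sE xs s1]] := sqrt_1B sbb b1.
have s1s : star (1 - s) = 1 - s by rewrite starB star1 ss.
have [v [sv vE xv _]] := sqrt_1B s1s (le_trans s1 b1).
exists s, v; split => //.
- by rewrite sE bb opprB addrC subrK.
- by rewrite vE opprB addrC subrK.
- move=> x xz; have xb : x * (b * b) = b * b * x.
    by rewrite bb mulrBr mulrBl mulr1 mul1r cz.
  have xsx := xs _ xb; split => //; apply: xv.
  by rewrite mulrBr mulrBl mulr1 mul1r xsx.
Qed.

(** Uniqueness of positive square roots. With [d = x^2 - y^2] the hypothesis gives
    [d (x^2 + y^2) = 0], so the squares of the self-adjoint elements [x d] and [y d] add up to 0.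
    Both vanish by [sum_sq_bound], and so does [d^2 = x (x d) - y (y d)]. *)
Lemma sq_inj x y : star x = x -> star y = y -> x * y = y * x ->
  x * x * (x * x) = y * y * (y * y) -> x * x = y * y.
Proof.
move=> sx sy xy e4; set d := x * x - y * y.
have sd : star d = d by rewrite starB !starM sx sy.
have xX : GRing.comm x (x * x) by apply: commrM.
have yY : GRing.comm y (y * y) by apply: commrM.
have xY : GRing.comm x (y * y) by apply: commrM.
have yX : GRing.comm y (x * x) by apply: commrM; exact: commr_sym.
have xd : x * d = d * x by apply: commrB.
have yd : y * d = d * y by apply: commrB.
have d0 : d * (x * x + y * y) = 0.
  have YX : y * y * (x * x) = x * x * (y * y) by apply/commr_sym/commrM; apply/commr_sym.
  by rewrite /d mulrDr !mulrBl e4 YX addrA subrK subrr.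
have sxd : star (x * d) = x * d by rewrite starM sd sx -xd.
have syd : star (y * d) = y * d by rewrite starM sd sy -yd.
have xdyd : x * d * (y * d) = y * d * (x * d).
  by apply: commrM; apply/commr_sym/commrM => //; apply: commr_sym.
have e0 : x * d * (x * d) + y * d * (y * d) = (0 : R)%:C%:A.
  rewrite {1}xd {1}yd -!mulrA (mulrA x) (mulrA y) -mulrDr -mulrDl mulrA d0.
  by rewrite mul0r scale0r.
have sq0 (a : A) : cnorm a ^+ 2 <= 0 -> a = 0.
  move=> h; apply/cnorm0_eq0/eqP; rewrite -sqrf_eq0 eq_le h.
  exact: sqr_ge0.
have xd0 : x * d = 0 by apply/sq0/(sum_sq_bound sxd syd) => //.
have yd0 : y * d = 0.
  by apply/sq0/(sum_sq_bound syd sxd) => //; rewrite addrC.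
have dd0 : d = 0.
  apply/sq0; rewrite -cnorm_starM sd {1}/d mulrBl -!mulrA xd0 yd0 !mulr0 subr0.
  by rewrite cnorm0.
by apply/eqP; rewrite -subr_eq0 -/d dd0.
Qed.

End CStarBasics.

(** * Norms of star-homomorphisms *)

Section StarHomNorm.
Variables (R : realType) (A B : cstarAlgType R) (f : {lrmorphism A -> B}).
Hypothesis fstar : star_preserving f.

(** After scaling to norm 1, the relation [z^2 + b^2 = 1] with a square root [b] of [1 - z^2]
    survives under [f], and [sum_sq_bound] then bounds [f z]. *)
Let contract_sa (x : A) : star x = x -> cnorm (f x) <= cnorm x.
Proof.
move=> sx; have [->|x0] := eqVneq x 0; first by rewrite raddf0 !cnorm0.
have nx : 0 < cnorm x by rewrite cnorm_gt0.
set c := cnorm x in nx *; pose z := (c^-1)%:C *: x.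
have z1 : cnorm z = 1.
  by rewrite cnormZr ger0_norm ?invr_ge0 ?(ltW nx)// mulVf ?gt_eqF.
have sz : star z = z by rewrite starZr sx.
have szz : star (z * z) = z * z by rewrite starM sz.
have zz1 : cnorm (z * z) <= 1.
  by rewrite (le_trans (ler_cnormM _ _))// z1 mulr1.
have [b [sb bb zb _]] := sqrt_1B szz zz1.
have : cnorm (f z) ^+ 2 <= 1.
  apply: (@sum_sq_bound _ _ _ (f b)); rewrite -?fstar ?sz ?sb//.
  - by rewrite -!rmorphM zb// mulrA.
  - by rewrite -!rmorphM -rmorphD bb addrC subrK rmorph1 scale1r.
rewrite /z linearZ cnormZr exprMn ger0_norm ?invr_ge0 ?(ltW nx)//.
rewrite exprVn ler_pdivrMl ?exprn_gt0// mulr1.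
by rewrite ler_pXn2r// nnegrE ?cnorm_ge0// ltW.
Qed.

Lemma starhom_contractive x : cnorm (f x) <= cnorm x.
Proof.
have : cnorm (f x) ^+ 2 <= cnorm x ^+ 2.
  rewrite -!cnorm_starM -fstar -rmorphM contract_sa//.
  by rewrite starM starK.
by rewrite ler_pXn2r// nnegrE cnorm_ge0.
Qed.

Hypothesis finj : injective f.

(* If [|f x|^2 = s < 1 = |x|] with [x] self-adjoint, then [z = x^2 - s] is not
   negative, so its positive part [(|z| + z) / 2] is nonzero, although [f] kills
   it. *)
Let isometric_sa1 (x : A) : star x = x -> cnorm x = 1 -> 1 <= cnorm (f x).
Proof.
move=> sx x1; rewrite leNgt; apply/negP => fx1.
set h := f x; have sh : star h = h by rewrite /h -fstar sx.
have h0 : 0 < cnorm h.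
  rewrite cnorm_gt0; apply/eqP => hx0.
  have x0 : x = 0 by apply: finj; rewrite raddf0.
  by move/eqP: x1; rewrite x0 cnorm0 eq_sym oner_eq0.
have [s [s0 s1 hs]] : exists s : R, [/\ 0 < s, s < 1 & cnorm h ^+ 2 = s].
  by exists (cnorm h ^+ 2); rewrite exprn_gt0// expr_lt1// ltW.
have s10 : 0 < 1 + s by rewrite addr_gt0.
have sc (t : R) : 0 <= t -> (Num.sqrt t)%:C * (Num.sqrt t)%:C = t%:C :> R[i].
  by move=> t0; rewrite -(rmorphM (real_complex R)) /= -expr2 sqr_sqrtr.
have cV (t : R) : 0 < t -> (t^-1)%:C * t%:C = 1 :> R[i].
  by move=> t0; rewrite -(rmorphM (real_complex R)) /= mulVf ?gt_eqF.
pose w := (s^-1)%:C *: (h * h).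
have sw : star w = w by rewrite starZr starM sh.
have w1 : cnorm w <= 1.
  rewrite cnormZr -{1}sh cnorm_starM hs ger0_norm ?invr_ge0 ?(ltW s0)//.
  by rewrite mulVf ?gt_eqF.
have [k [sk kk kw _]] := sqrt_1B sw w1.
(* [p^2 = (s - h^2) / (1 + s) = - f z], which exhibits [f z] as negative. The factor [1 / (1 + s)]
   makes [z] a contraction. *)
pose p := (Num.sqrt ((1 + s)^-1 * s))%:C *: k.
have sp : star p = p by rewrite starZr sk.
pose z := ((1 + s)^-1)%:C *: (x * x - s%:C%:A).
have fz : f z = - (p * p).
  have -> : p * p = ((1 + s)^-1 * s)%:C *: (k * k).
    by rewrite /p -scalerAl -scalerAr scalerA sc// mulr_ge0 ?invr_ge0 ?ltW.
  have -> : f z = ((1 + s)^-1)%:C *: (h * h - s%:C%:A).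
    by rewrite linearZ_LR linearB linearZ_LR rmorph1 rmorphM.
  rewrite kk /w (rmorphM (real_complex R)) -scalerA -[RHS]scalerN.
  congr (_ *: _); rewrite -[RHS]scalerN opprB scalerBr; congr (_ - _).
  by rewrite scalerA mulrC cV// scale1r.
have sz : star z = z by rewrite starZr starB starM sx starZr star1.
have z1 : cnorm z <= 1.
  rewrite cnormZr ger0_norm ?invr_ge0 ?(ltW s10)// ler_pdivrMl// mulr1.
  rewrite (le_trans (ler_cnormB _ _))// cnormA ger0_norm ?(ltW s0)// lerD2r.
  by rewrite (le_trans (ler_cnormM _ _))// x1 mulr1.
have [a [r [sa sr aa ar com]]] := absz_sqrt sz z1.
have xz : x * z = z * x.
  by rewrite -scalerAl -scalerAr mulrBr mulrBl mulrA -scalerAl -scalerAr mulr1 mul1r.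
have [_ xr] := com x xz.
have fr_p : f r * p = p * f r.
  rewrite /p -scalerAl -scalerAr kw// -scalerAl -scalerAr mulrA -rmorphM -xr.
  by rewrite rmorphM -!mulrA -rmorphM -xr rmorphM.
have ffr : f r * f r = f a by rewrite -[LHS]rmorphM -ar.
(* [f r * f r = f |z|] and [p * p = - f z] are positive square roots of the same element, hence
   equal. Injectivity turns this into [|z| = - z], so that [x^2 + (1 + s) r^2 = s]. *)
have frp : f r * f r = p * p.
  apply: sq_inj => //; first by rewrite -fstar sr.
  by rewrite ffr -(mulrNN (p * p)) -fz -[LHS]rmorphM aa rmorphM.
have az : a = - z.
  have fNz : f (- z) = - f z by exact: raddfN.
  by apply: finj; rewrite fNz fz opprK -frp ffr.
have : cnorm x ^+ 2 <= s.
  apply: (@sum_sq_bound _ _ _ ((Num.sqrt (1 + s))%:C *: r)) => //.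
  - by rewrite starZr sr.
  - by rewrite -scalerAl -scalerAr xr.
  - exact: ltW.
  - rewrite -scalerAl -scalerAr scalerA sc ?ltW// -ar az /z -scalerN scalerA.
    by rewrite mulrC cV// scale1r opprB addrC subrK.
by rewrite x1 expr1n leNgt s1.
Qed.

Lemma starhom_isometric x : cnorm (f x) = cnorm x.
Proof.
apply/eqP; rewrite eq_le starhom_contractive /=.
have [->|x0] := eqVneq x 0; first by rewrite cnorm0 cnorm_ge0.
have nx : 0 < cnorm x by rewrite cnorm_gt0.
pose z := ((cnorm x ^+ 2)^-1)%:C *: (star x * x).
have sz : star z = z by rewrite starZr starM starK.
have n2 : 0 < cnorm x ^+ 2 by rewrite exprn_gt0.
have z1 : cnorm z = 1.
  by rewrite cnormZr cnorm_starM ger0_norm ?invr_ge0 ?(ltW n2)// mulVf ?gt_eqF.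
have fz : f z = ((cnorm x ^+ 2)^-1)%:C *: (star (f x) * f x).
  by rewrite -fstar linearZ_LR rmorphM.
have := isometric_sa1 sz z1; rewrite fz cnormZr cnorm_starM.
rewrite ger0_norm ?invr_ge0 ?(ltW n2)// ler_pdivlMl// mulr1.
by rewrite ler_pXn2r// nnegrE cnorm_ge0.
Qed.

End StarHomNorm.

(** * Neumann series and polar decomposition *)

Section Polar.
Variables (R : realType) (A : cstarAlgType R).
Implicit Types (x y u v : A).

Lemma exp_half_lt (e : R) : 0 < e -> exists n, (2^-1 : R) ^+ n < e.
Proof.
move=> e0; have : (2^-1 : R) ^+ n @[n --> \oo] --> (0 : R).
  by apply: cvg_expr; rewrite ger0_norm ?invr_ge0// invf_lt1// ltr1n.
move=> /cvgrPdist_lt /(_ _ e0) [n _ /(_ n (leqnn n))] /=.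
by rewrite sub0r normrN ger0_norm ?exprn_ge0 ?invr_ge0//; exists n.
Qed.

(** The starting index [i] is there because, in a play, the values of a constant are controlled only
    once it has entered the box. *)
Lemma geometric_cvg (u : nat -> A) i :
  (forall n, (i <= n)%N -> cnorm (u n.+1 - u n) <= 2^-1 ^+ n) ->
  exists l, forall n, (i <= n)%N -> cnorm (l - u n) <= 2 * 2^-1 ^+ n.
Proof.
move=> H; have half0 n : 0 <= (2^-1 : R) ^+ n by rewrite exprn_ge0// invr_ge0.
have dist k m : (i <= k)%N -> cnorm (u (k + m)%N - u k) <= 2 * 2^-1 ^+ k.
  move=> ik.
  suff : cnorm (u (k + m)%N - u k) <= 2 * 2^-1 ^+ k - 2 * 2^-1 ^+ (k + m).
    by move=> /le_trans; apply; rewrite gerDl oppr_le0 mulr_ge0.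
  elim: m => [|m IH]; first by rewrite addn0 !subrr cnorm0.
  rewrite addnS (le_trans (cnorm_dist_trans (u (k + m)%N) _ _))//.
  rewrite (le_trans (lerD (H _ (leq_trans ik (leq_addr _ _))) IH))//.
  rewrite exprS mulrA divff ?mul1r//.
  by rewrite le_eqVlt; apply/orP; left; apply/eqP; ring.
have [l Hl] : exists l, forall e : R, 0 < e -> exists N, forall n,
    (N <= n)%N -> cnorm (u n - l) < e.
  apply: cnorm_complete => e e0.
  have [N HN] := @exp_half_lt (e / 4) (divr_gt0 e0 (ltr0n _ 4)).
  have HN2 : 2 * 2^-1 ^+ (N + i) < e / 2.
    have : (2^-1 : R) ^+ (N + i) <= 2^-1 ^+ N.
      by rewrite exprD ler_piMr// exprn_ile1// ?invr_ge0// invf_le1// ler1n.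
    by move: HN; lra.
  exists (N + i)%N => m n Nm Nn.
  rewrite (le_lt_trans (cnorm_dist_trans (u (N + i)%N) _ _))// (splitr e) ltrD//.
    by rewrite -(subnKC Nm) (le_lt_trans (dist _ _ (leq_addl _ _))).
  by rewrite cnorm_distC -(subnKC Nn) (le_lt_trans (dist _ _ (leq_addl _ _))).
exists l => n ni; apply/ler_addgt0Pr => e /Hl[M HM].
rewrite [leRHS]addrC (le_trans (cnorm_dist_trans (u (n + M)%N) _ _))// lerD//.
  by rewrite cnorm_distC ltW// HM// leq_addl.
exact: dist.
Qed.

Lemma neumann y : cnorm y <= 2^-1 -> exists v,
  (1 - y) * v = 1 /\ cnorm (v - 1) <= 2 * cnorm y.
Proof.
move=> y2.
pose u := fix u n := if n is n.+1 then 1 + y * u n else 0.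
have uS n : cnorm (u n.+1 - u n) <= 2^-1 ^+ n.
  elim: n => [|n IH]; first by rewrite /= mulr0 addr0 subr0 cnorm1.
  have h (a b : A) : 1 + y * a - (1 + y * b) = y * (a - b).
    by rewrite opprD addrACA subrr add0r mulrBr.
  have -> : u n.+2 - u n.+1 = y * (u n.+1 - u n) by exact: h.
  by rewrite (le_trans (ler_cnormM _ _))// exprS ler_pM ?cnorm_ge0.
have [v Hv] := @geometric_cvg u 0%N (fun n _ => uS n).
have vE : v = 1 + y * v.
  apply/eqP; rewrite -subr_eq0; apply/eqP/(@cnorm_small_eq0 _ _ _ 4) => e e0.
  have [n ne] := exp_half_lt e0.
  have -> : v - (1 + y * v) = (v - u n.+1) + y * (u n - v).
    by rewrite [u _]/= mulrBr !opprD !addrA subrK.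
  have := ler_cnormMl (u n - v) y2; rewrite [X in _ <= _ * X]cnorm_distC.
  have := Hv n.+1 isT; have := Hv n isT; have := ler_cnormD (v - u n.+1) (y * (u n - v)).
  rewrite exprS; lra.
have v1 : v - 1 = y * v by rewrite {1}vE addrC addKr.
exists v; split; first by rewrite mulrBl mul1r -v1 opprB addrC subrK.
have v2 : cnorm v <= 2.
  have := ler_cnormD 1 (y * v); rewrite -vE cnorm1.
  have := ler_cnormMl v y2; lra.
by rewrite v1 mulrC ler_cnormMr// mulrC.
Qed.

(** [u = w * v] is the isometry of the polar decomposition, where [v] inverts [s = |w|]; finiteness
    makes it unitary. The 4 comes from [cnorm w <= 2] and [cnorm (v - 1) <= 2 * d]. *)
Lemma polar_unitary (w : A) d : (forall u, star u * u = 1 -> u * star u = 1) ->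
  cnorm (star w * w - 1) <= d -> d <= 2^-1 -> exists u,
  [/\ star u * u = 1, u * star u = 1 & cnorm (u - w) <= 4 * d].
Proof.
move=> fin wd d2; have d0 : 0 <= d := le_trans (cnorm_ge0 _) wd.
have sp : star (1 - star w * w) = 1 - star w * w.
  by rewrite starB star1 starM starK.
have pd : cnorm (1 - star w * w) <= d by rewrite cnorm_distC.
have [|s [ss sE _ s1]] := sqrt_1B sp; first by lra.
rewrite opprB addrC subrK in sE.
have sd : cnorm (1 - s) <= d := le_trans s1 pd.
have [v [sv v1]] := neumann (le_trans sd d2).
rewrite opprB addrC subrK in sv.
have vs : star v = v.
  by rewrite -[LHS]mulr1 -sv mulrA -{1}ss -starM sv star1 mul1r.
have uu : star (w * v) * (w * v) = 1.
  by rewrite starM vs -mulrA (mulrA _ w) -sE !mulrA -{1}vs -{1}ss -starM sv star1 mul1r sv.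
exists (w * v); split => //; first exact: fin.
have w2 : cnorm w <= 2.
  have : cnorm w ^+ 2 <= 2 ^+ 2.
    rewrite -cnorm_starM -(subrK 1 (star w * w)).
    have := ler_cnormD (star w * w - 1) 1; rewrite cnorm1; lra.
  by rewrite ler_pXn2r// ?nnegrE ?cnorm_ge0.
rewrite -[X in _ - X]mulr1 -mulrBr (le_trans (ler_cnormMl _ w2))//.
by lra.
Qed.

End Polar.

(** * Norms of complex matrices *)

Section Spectral.
Variables (R : realType) (n : nat).
Implicit Types (X Y H U V : 'M[R[i]]_n.+1) (d : 'I_n.+1 -> R).

Definition rdiag d : 'M[R[i]]_n.+1 := diag_mx (\row_i (d i)%:C).

Lemma star_rdiag d : star (rdiag d) = rdiag d.
Proof.
apply/matrixP => i j; rewrite !mxE eq_sym.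
by case: eqVneq => [->|_]; rewrite /= oppr0 ?mulr1n.
Qed.

Lemma rdiagD d e : rdiag d + rdiag e = rdiag (fun i => d i + e i).
Proof.
apply/matrixP => i j; rewrite !mxE.
by case: eqVneq => //= _; rewrite ?addr0// !mulr1n rmorphD.
Qed.

Lemma rdiagN d : - rdiag d = rdiag (fun i => - d i).
Proof. by apply/matrixP => i j; rewrite !mxE rmorphN mulNrn. Qed.

Lemma rdiagM d e : rdiag d * rdiag e = rdiag (fun i => d i * e i).
Proof.
rewrite -[LHS]/(_ *m _) mulmx_diag; congr diag_mx; apply/matrixP => i j.
by rewrite !mxE rmorphM.
Qed.

Lemma herm_spectral H : star H = H -> exists U d,
  [/\ star U * U = 1, U * star U = 1 & H = star U * rdiag d * U].
Proof.
move=> sH; have tE (X : 'M[R[i]]_n.+1) : map_mx Num.conj X^T = star X.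
  by apply/matrixP => i j; rewrite !mxE.
have /orthomx_spectralP HE : H \is normalmx by apply/normalmxP; rewrite tE sH.
have Uu := spectral_unitarymx H.
move: HE Uu; set U := spectralmx H; set D := spectral_diag H => HE Uu.
have UU : U * star U = 1 by rewrite -tE; apply/unitarymxP.
have sUU : star U * U = 1 by apply/mulmx1C.
rewrite (invmx_unitary Uu) tE in HE.
exists U, (fun i => complex.Re (D 0 i)); split; [exact: sUU|exact: UU|].
rewrite [LHS]HE; congr (star U *m _ *m U).
have DE : U * H * star U = diag_mx D.
  rewrite {1}HE -[_ *m U]/(_ * _) -[star U *m _]/(_ * _).
  by rewrite !mulrA UU mul1r -mulrA UU mulr1.
have sD : star (diag_mx D) = diag_mx D.
  by rewrite -DE !starM starK sH mulrA.
apply/matrixP => i j; rewrite !mxE; case: eqVneq => //= _; rewrite !mulr1n.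
have := congr1 (fun (X : 'M[R[i]]_n.+1) => complex.Im (X i i)) sD.
rewrite !mxE eqxx !mulr1n; case: (D 0 i) => a b /= /eqP.
by rewrite eq_sym -addr_eq0 -mulr2n mulrn_eq0 /= => /eqP ->.
Qed.

Lemma unitary_conjM U X Y : U * star U = 1 ->
  star U * X * U * (star U * Y * U) = star U * (X * Y) * U.
Proof. by move=> UU; rewrite -!mulrA (mulrA U) UU mul1r. Qed.

End Spectral.

Section MatrixNorm.
Variables (R : realType) (n : nat) (A : cstarAlgType R).
(** Matrix algebras are only star algebras here: their norm is read through an embedding into a
    C*-algebra, and [opnormE] shows that it does not depend on the embedding. *)
Variable g : {lrmorphism 'M[R[i]]_n.+1 -> A}.
Hypotheses (gstar : star_preserving g) (ginj : injective g).
Implicit Types (X H U V : 'M[R[i]]_n.+1) (d : 'I_n.+1 -> R).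

Lemma cnorm_isoMl (B : cstarAlgType R) (u x : B) :
  star u * u = 1 -> cnorm (u * x) = cnorm x.
Proof.
move=> uu; apply/eqP; rewrite -(@eqrXn2 _ 2) ?cnorm_ge0//.
by rewrite -!cnorm_starM starM -mulrA (mulrA _ u) uu mul1r.
Qed.

Lemma cnorm_isoMr (B : cstarAlgType R) (u x : B) :
  u * star u = 1 -> cnorm (x * u) = cnorm x.
Proof.
by move=> uu; rewrite -cnorm_star starM cnorm_isoMl ?starK// cnorm_star.
Qed.

Let gM X U : g (X * U) = g X * g U. Proof. exact: rmorphM. Qed.
Let g1 : g 1 = 1. Proof. exact: rmorph1. Qed.

Lemma cnorm_unitary_conj U X : star U * U = 1 -> U * star U = 1 ->
  cnorm (g (star U * X * U)) = cnorm (g X).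
Proof.
move=> UU' UU; rewrite !gM cnorm_isoMr ?cnorm_isoMl//.
- by rewrite -gstar -gM starK UU g1.
- by rewrite -gstar -gM UU g1.
Qed.

Lemma star_delta (i j : 'I_n.+1) :
  star (delta_mx i j : 'M[R[i]]_n.+1) = delta_mx j i.
Proof.
by apply/matrixP => a b; rewrite !mxE andbC; case: (_ && _) => /=;
  rewrite ?oppr0.
Qed.

Lemma mul_delta (i j k l : 'I_n.+1) :
  delta_mx i j * delta_mx k l = (j == k)%:R *: delta_mx i l :> 'M[R[i]]_n.+1.
Proof. by rewrite -[LHS]/(_ *m _) mul_delta_mx_cond scaler_nat. Qed.

Lemma delta_neq0 (i j : 'I_n.+1) : delta_mx i j != 0 :> 'M[R[i]]_n.+1.
Proof.
apply/eqP => /matrixP /(_ i j); rewrite !mxE !eqxx /= => /eqP.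
by rewrite oner_eq0.
Qed.

Lemma morph_eq0 X : (g X == 0) = (X == 0).
Proof.
apply/eqP/eqP => [gX0|->]; last exact: raddf0.
by apply: ginj; rewrite gX0 raddf0.
Qed.

Lemma cnorm_delta i j : cnorm (g (delta_mx i j)) = 1.
Proof.
have dd (k : 'I_n.+1) : cnorm (g (delta_mx k k)) = 1.
  apply: cnorm_proj; last by rewrite morph_eq0 delta_neq0.
  by rewrite -gstar -gM star_delta mul_delta eqxx scale1r.
apply/eqP; rewrite -(@eqrXn2 _ 2) ?cnorm_ge0// expr1n.
by rewrite -cnorm_starM -gstar -gM star_delta mul_delta eqxx scale1r dd.
Qed.

Lemma normc_le_cnorm X i j : Normc.normc (X i j) <= cnorm (g X).
Proof.
have E : delta_mx i i * X * delta_mx j j = X i j *: delta_mx i j.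
  rewrite [in LHS](matrix_sum_delta X) mulr_sumr mulr_suml (bigD1 i)//=.
  rewrite mulr_sumr mulr_suml (bigD1 j)//= -scalerAr -scalerAl.
  rewrite !mul_delta !eqxx !scale1r mul_delta eqxx scale1r.
  rewrite big1 ?addr0 => [|l lj]; last first.
    by rewrite -scalerAr -scalerAl mul_delta -scalerAl mul_delta (negPf lj) scale0r !scaler0.
  rewrite big1 ?addr0// => k ki; rewrite mulr_sumr mulr_suml big1// => l _.
  by rewrite -scalerAr -scalerAl mul_delta eq_sym (negPf ki) scale0r mul0r scaler0.
have : cnorm (g (delta_mx i i * X * delta_mx j j)) <= cnorm (g X).
  rewrite !gM (le_trans (ler_cnormM _ _))// cnorm_delta mulr1.
  by rewrite (le_trans (ler_cnormM _ _))// cnorm_delta mul1r.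
by rewrite E linearZ_LR cnormZ cnorm_delta mulr1.
Qed.

(** With [e i = sqrt (r^2 - (d i)^2)], the commuting self-adjoint matrices [rdiag d] and [rdiag e]
    have squares adding up to the scalar [r^2]. *)
Lemma cnorm_rdiag_le d r : (forall i, `|d i| <= r) -> cnorm (g (rdiag d)) <= r.
Proof.
move=> dr; have r0 : 0 <= r := le_trans (normr_ge0 _) (dr ord0).
pose e i := Num.sqrt (r ^+ 2 - d i ^+ 2).
have d2 i : d i ^+ 2 <= r ^+ 2.
  by rewrite -(real_normK (num_real (d i))) ler_pXn2r ?nnegrE.
rewrite -(@ler_pXn2r _ 2) ?nnegrE ?cnorm_ge0//.
apply: (@sum_sq_bound _ _ _ (g (rdiag e))).
- by rewrite -gstar star_rdiag.
- by rewrite -gstar star_rdiag.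
- rewrite -!gM !rdiagM; congr (g (rdiag _)); apply/funext => i.
  by rewrite mulrC.
- exact: sqr_ge0.
- have -> : g (rdiag d) * g (rdiag d) + g (rdiag e) * g (rdiag e) =
      g (rdiag d * rdiag d + rdiag e * rdiag e).
    by rewrite -!gM; apply/esym/raddfD.
  have -> : rdiag d * rdiag d + rdiag e * rdiag e = (r ^+ 2)%:C%:A.
    rewrite !rdiagM rdiagD; apply/matrixP => i j; rewrite !mxE.
    rewrite -!expr2 sqr_sqrtr ?subr_ge0// addrC subrK.
    by case: (i == j); rewrite ?mulr1 ?mulr0.
  by rewrite linearZ_LR rmorph1.
Qed.

Lemma cnorm_rdiag_ge d i : `|d i| <= cnorm (g (rdiag d)).
Proof.
by have := normc_le_cnorm (rdiag d) i i; rewrite !mxE eqxx mulr1n normcR.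
Qed.


Let conjM_normc (z : R[i]) : z^*%C * z = (Normc.normc z ^+ 2)%:C.
Proof. by rewrite mulrC -sqr_normc rmorphXn. Qed.

Lemma sqr_l2norm (v : 'cV[R[i]]_n.+1) :
  l2norm v ^+ 2 = \sum_i Normc.normc (v i 0) ^+ 2.
Proof. by rewrite sqr_sqrtr// sumr_ge0// => i _; exact: sqr_ge0. Qed.

Lemma sqr_l2normE (v : 'cV[R[i]]_n.+1) :
  (l2norm v ^+ 2)%:C = ((map_mx conjc v)^T *m v) 0 0.
Proof.
rewrite sqr_l2norm !mxE (rmorph_sum (real_complex R)); apply: eq_bigr => i _.
by rewrite !mxE conjM_normc.
Qed.

Let sqr_l2normM X (v : 'cV[R[i]]_n.+1) : (l2norm (X *m v) ^+ 2)%:C =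
  ((map_mx conjc v)^T *m (star X * X) *m v) 0 0.
Proof. by rewrite sqr_l2normE map_mxM trmx_mul !mulmxA. Qed.

Lemma l2norm_unitary U v : star U * U = 1 -> l2norm (U *m v) = l2norm v.
Proof.
move=> UU; apply/eqP; rewrite -(@eqrXn2 _ 2) ?sqrtr_ge0//; apply/eqP.
by apply: complexI; rewrite sqr_l2normM UU mulmx1 -sqr_l2normE.
Qed.

(** Both sides are the square root of the largest eigenvalue [d i0] of [star X * X]: the norm by the
    C*-identity and the bounds for diagonal matrices, [opnorm] because its supremum is attained at a
    corresponding eigenvector. *)
Lemma opnormE X : opnorm X = cnorm (g X).
Proof.
have sXX : star (star X * X) = star X * X by rewrite starM starK.
have [U [d [UU UU' HE]]] := herm_spectral sXX.
pose Y := X * star U.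
have YY : star Y * Y = rdiag d.
  rewrite /Y starM starK mulrA -(mulrA U) HE.
  by rewrite !mulrA UU' mul1r -mulrA UU' mulr1.
have d0 i : 0 <= d i.
  have := congr1 (fun (Z : 'M[R[i]]_n.+1) => Z i i) YY.
  rewrite [RHS]mxE [X in _ = X *+ _]mxE eqxx mulr1n mxE => dE.
  have : d i = \sum_j Normc.normc (Y j i) ^+ 2.
    apply: complexI; rewrite -dE (rmorph_sum (real_complex R)).
    by apply: eq_bigr => j _; rewrite !mxE conjM_normc.
  by move=> ->; apply: sumr_ge0 => j _; exact: sqr_ge0.
pose i0 := [arg max_(i > ord0) d i]%O.
have di0 i : d i <= d i0 by rewrite /i0; case: arg_maxP => // j _; apply.
have gX : cnorm (g X) ^+ 2 = d i0.
  rewrite -cnorm_starM -gstar -gM HE cnorm_unitary_conj//.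
  apply/eqP; rewrite eq_le cnorm_rdiag_le /=.
    by have := cnorm_rdiag_ge d i0; rewrite ger0_norm.
  by move=> i; rewrite ger0_norm.
have Xv v : l2norm (X *m v) ^+ 2 = \sum_i d i * Normc.normc ((U *m v) i 0) ^+ 2.
  apply: complexI; rewrite sqr_l2normM HE -[star U * _ * U]/(star U *m rdiag d *m U).
  rewrite !mulmxA -trmx_mul -map_mxM -[_ *m U *m v]mulmxA.
  rewrite (rmorph_sum (real_complex R)) mxE; apply: eq_bigr => i _.
  rewrite mul_mx_diag; move: (U *m v) => w; rewrite !mxE mulrAC conjM_normc.
  by rewrite mulrC -(rmorphM (real_complex R)).
have bound v : l2norm v <= 1 -> l2norm (X *m v) <= cnorm (g X).
  move=> v1; rewrite -(@ler_pXn2r _ 2) ?nnegrE ?cnorm_ge0 ?sqrtr_ge0//.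
  rewrite Xv gX (@le_trans _ _ (\sum_i d i0 * Normc.normc ((U *m v) i 0) ^+ 2))//.
    by apply: ler_sum => i _; rewrite ler_wpM2r ?sqr_ge0.
  rewrite -mulr_sumr -sqr_l2norm l2norm_unitary// ler_piMr//.
  by rewrite expr_le1// sqrtr_ge0.
apply/eqP; rewrite eq_le; apply/andP; split.
  apply: ge_sup; last by move=> _ [v v1 <-]; exact: bound.
  exists (l2norm (X *m 0)), 0 => //=.
  rewrite /l2norm big1 ?sqrtr0// => i _.
  by rewrite mxE Normc.normc0 expr0n.
pose w : 'cV[R[i]]_n.+1 := delta_mx i0 0.
have wE i : Normc.normc (w i 0) ^+ 2 = (i == i0)%:R.
  rewrite mxE eqxx andbT.
  by case: eqP => _; rewrite ?Normc.normc1 ?Normc.normc0 ?expr1n ?expr0n.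
have Uw : U *m (star U *m w) = w by rewrite mulmxA -[U *m _]/(U * _) UU' mul1mx.
have l2w : l2norm (star U *m w) = 1.
  rewrite l2norm_unitary ?starK// /l2norm (bigD1 i0)//= wE eqxx.
  by rewrite big1 ?addr0 ?sqrtr1// => i ii0; rewrite wE (negPf ii0).
have -> : cnorm (g X) = l2norm (X *m (star U *m w)).
  apply/eqP; rewrite -(@eqrXn2 _ 2) ?cnorm_ge0 ?sqrtr_ge0// gX Xv Uw.
  rewrite (bigD1 i0)//= wE eqxx mulr1 big1 ?addr0// => i ii0.
  by rewrite wE (negPf ii0) mulr0.
apply: ub_le_sup; first by exists (cnorm (g X)) => _ [v v1 <-]; exact: bound.
by exists (star U *m w) => //=; rewrite l2w.
Qed.

(** [P] selects the eigenvalues above 1/2. The bound is the scalar inequality [|[t > 1/2] - t| <= 2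
    |t^2 - t|]: the factor of [t (1 - t)] left over after removing the defect is at least 1/2 in
    absolute value. *)
Lemma near_projection H : star H = H -> exists U (P : pred 'I_n.+1),
  [/\ star U * U = 1, U * star U = 1 &
   cnorm (g (star U * rdiag (fun i => (P i)%:R) * U - H)) <=
     2 * cnorm (g (H * H - H))].
Proof.
move=> sH; have [U [d [UU UU' HE]]] := herm_spectral sH.
exists U, (fun i => 2^-1 < d i); split=> //.
have HH : H * H - H = star U * rdiag (fun i => d i * d i - d i) * U.
  by rewrite HE unitary_conjM// rdiagM -mulrBl -mulrBr rdiagN rdiagD.
rewrite HH HE -mulrBl -mulrBr rdiagN rdiagD !cnorm_unitary_conj//.
apply: cnorm_rdiag_le => i; set p := cnorm _.
have : `|d i * d i - d i| <= p.
  exact: (cnorm_rdiag_ge (fun i => d i * d i - d i) i).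
have -> : d i * d i - d i = - (d i * (1 - d i)) by ring.
rewrite normrN normrM => dp.
case: ltP => di /=.
  rewrite (@le_trans _ _ (2 * (`|d i| * `|1 - d i|)))// ?ler_wpM2l//.
  rewrite mulrA ler_peMl// (@le_trans _ _ (2 * d i))//; first by lra.
  by rewrite ler_wpM2l// ler_norm.
rewrite add0r normrN (@le_trans _ _ (2 * (`|d i| * `|1 - d i|)))// ?ler_wpM2l//.
rewrite mulrCA ler_peMr// (@le_trans _ _ (2 * (1 - d i)))//; first by lra.
by rewrite ler_wpM2l// ler_norm.
Qed.

End MatrixNorm.

(** * Projections and partial isometries in matrix algebras *)

Lemma mxrank_sum_le (F : fieldType) m n I (r : seq I) (P : pred I)
    (f : I -> 'M[F]_(m, n)) :
  (\rank (\sum_(i <- r | P i) f i)%R <= \sum_(i <- r | P i) \rank (f i))%N.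
Proof.
elim/big_ind2: _ => [|x a y b xa yb|//]; first by rewrite mxrank0.
by rewrite (leq_trans (mxrank_add _ _))// leq_add.
Qed.

Section Projections.
Variables (R : realType) (n : nat).
Implicit Types (U V : 'M[R[i]]_n.+1) (P : pred 'I_n.+1).

Definition pdiag P : 'M[R[i]]_n.+1 := rdiag (fun i => (P i)%:R).

Lemma pdiag_spectral H : star H = H -> H * H = H -> exists U P,
  [/\ star U * U = 1, U * star U = 1 & H = star U * pdiag P * U].
Proof.
move=> sH HH; have [U [d [UU UU' HE]]] := herm_spectral sH.
exists U, (fun i => d i != 0); split=> //.
have dd : rdiag d * rdiag d = rdiag d.
  have E : U * H * star U = rdiag d.
    by rewrite HE !mulrA UU' mul1r -mulrA UU' mulr1.
  by rewrite -E -!mulrA (mulrA (star U)) UU mul1r (mulrA H H) HH.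
rewrite {1}HE; congr (_ * rdiag _ * _); apply/funext => i.
have := congr1 (fun (Z : 'M[R[i]]_n.+1) => Z i i) dd.
rewrite rdiagM !mxE eqxx !mulr1n => -[/eqP].
rewrite -subr_eq0 -{3}(mulr1 (d i)) -mulrBr mulf_eq0 subr_eq0.
by case/orP => /eqP ->; rewrite ?eqxx ?oner_eq0.
Qed.

Lemma mxtrace_pdiag U P : U * star U = 1 ->
  \tr (star U * pdiag P * U) = #|P|%:R.
Proof.
move=> UU'; transitivity (\tr (U * star U * pdiag P)).
  by rewrite -(mulrA U); exact: mxtrace_mulC.
rewrite UU' mul1r.
rewrite mxtrace_diag -sum1_card natr_sum [RHS]big_mkcond.
apply: eq_bigr => i _; rewrite mxE.
by rewrite unfold_in; case: (P i).
Qed.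

Lemma mxrank_pdiag U P : (\rank (star U * pdiag P * U)%R <= #|P|)%N.
Proof.
apply: (leq_trans (mxrankM_maxl _ _)); apply: (leq_trans (mxrankM_maxr _ _)).
have -> : pdiag P = \sum_(i | P i) delta_mx i i.
  apply/matrixP => i j; rewrite summxE !mxE.
  have [<-|ij] := eqVneq i j; last first.
    rewrite big1 // => k _; rewrite !mxE; case: (eqVneq i k) => //= <-.
    by rewrite eq_sym (negPf ij).
  rewrite mulr1n big_mkcond (bigD1 i)//= !mxE !eqxx big1 ?addr0.
    by case: (P i).
  by move=> k ki; rewrite !mxE eq_sym (negPf ki) if_same.
rewrite -sum1_card; apply: (leq_trans (mxrank_sum_le _ _ _)).
by apply: leq_sum => i _; rewrite mxrank_delta.
Qed.

(** [S] sends the basis vectors indexed by [P] injectively to basis vectors indexed by [P'],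
    matching the two enumerations; [U] and [V] transport it to the given eigenbases. *)
Lemma partial_isometry U V P P' : U * star U = 1 -> V * star V = 1 ->
  (#|P| <= #|P'|)%N -> exists w,
  star w * w = star V * pdiag P * V /\ star U * pdiag P' * U * w = w.
Proof.
move=> UU' VV' PP'.
pose s j := nth ord0 (enum P') (index j (enum P)).
have sz j : P j -> (index j (enum P) < size (enum P'))%N.
  by move=> Pj; rewrite -cardE (leq_trans _ PP')// cardE index_mem mem_enum.
have Ps j : P j -> P' (s j).
  by move=> Pj; have := mem_nth ord0 (sz _ Pj); rewrite mem_enum.
have sI j k : P j -> P k -> s j = s k -> j = k.
  move=> Pj Pk /eqP; rewrite nth_uniq ?sz ?enum_uniq// => /eqP h.
  rewrite -(@nth_index _ ord0 j (enum P)) ?mem_enum// h.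
  by rewrite nth_index ?mem_enum.
pose S : 'M[R[i]]_n.+1 := \matrix_(i, j) (P j && (i == s j))%:R.
have SS : star S * S = pdiag P.
  apply/matrixP => i j; rewrite !mxE.
  have [Pi|Pi] := boolP (P i); last first.
    rewrite big1 ?mul0rn// => k _; rewrite !mxE (negPf Pi) /= oppr0.
    by rewrite mul0r.
  rewrite (bigD1 (s i))//= !mxE Pi eqxx /= oppr0 mul1r big1 ?addr0.
    have [ij|ij] := eqVneq i j; first by rewrite -ij Pi eqxx.
    rewrite mulr0n; case: andP => // -[Pj /eqP/(sI _ _ Pi Pj)/eqP].
    by rewrite (negPf ij).
  by move=> k ks; rewrite !mxE Pi (negPf ks) /= oppr0 mul0r.
have PS : pdiag P' * S = S.
  apply/matrixP => i j; rewrite -[_ * S]/(_ *m _) mul_diag_mx !mxE.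
  case: andP => [[Pj /eqP ->]|_]; last by rewrite mulr0.
  by rewrite Ps// mulr1.
exists (star U * S * V); split.
  rewrite !starM starK -!mulrA (mulrA U) UU' mul1r.
  by rewrite (mulrA (star S)) SS.
by rewrite -!mulrA (mulrA U) UU' mul1r (mulrA (pdiag _)) PS.
Qed.

End Projections.

(** * Towers of matrix algebras *)

Section Flatten.
Variables (F : nzRingType) (m n : nat).
Implicit Types (X Y : 'M['M[F]_n.+1]_m) (Z : 'M[F]_(m * n.+1)).

(** Reading a matrix of blocks as one scalar matrix makes rank and invertibility over a field
    available for matrices over a matrix algebra. *)
Definition flatten_mx X : 'M[F]_(m * n.+1) := \matrix_(i, j)
  X (mxtens_unindex i).1 (mxtens_unindex j).1
    (mxtens_unindex i).2 (mxtens_unindex j).2.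

Definition unflatten_mx Z : 'M['M[F]_n.+1]_m := \matrix_(a, b) \matrix_(i, j)
  Z (mxtens_index (a, i)) (mxtens_index (b, j)).

Lemma flatten_mxK : cancel flatten_mx unflatten_mx.
Proof.
move=> X; apply/matrixP => a b; apply/matrixP => i j.
by rewrite !mxE !mxtens_indexK.
Qed.

Lemma unflatten_mxK : cancel unflatten_mx flatten_mx.
Proof.
move=> Z; apply/matrixP => i j; rewrite !mxE -!surjective_pairing.
by rewrite !mxtens_unindexK.
Qed.

Lemma flatten_mxM X Y : flatten_mx (X *m Y) = flatten_mx X *m flatten_mx Y.
Proof.
apply/matrixP => i j; rewrite !mxE summxE.
under eq_bigr do rewrite mxE.
rewrite pair_big /= (reindex (@mxtens_unindex m n.+1)) /=; last first.
  by exists (@mxtens_index m n.+1) => ? _; rewrite (mxtens_indexK, mxtens_unindexK).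
by apply: eq_bigr => l _; rewrite !mxE.
Qed.

Lemma flatten_mx1 : flatten_mx 1%:M = 1%:M.
Proof.
apply/matrixP => i j; rewrite !mxE -(can_eq (@mxtens_unindexK m n.+1)).
rewrite -pair_eqE /=; case: eqP => _ /=; last by rewrite mulr0n mxE.
by rewrite mulr1n mxE.
Qed.

Lemma flatten_mx0 : flatten_mx 0 = 0.
Proof. by apply/matrixP => i j; rewrite !mxE. Qed.

End Flatten.

Section SumNorm.
Variables (R : realType) (A : cstarAlgType R).

(** A crude submultiplicative norm standing in for the C*-norm on matrices over [A]: stable
    finiteness only needs to know that some matrices are small. *)
Definition sum_norm m n (V : 'M[A]_(m, n)) : R := \sum_i \sum_j cnorm (V i j).

Lemma sum_norm_ge0 m n (V : 'M[A]_(m, n)) : 0 <= sum_norm V.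
Proof. by apply: sumr_ge0 => i _; apply: sumr_ge0 => j _; exact: cnorm_ge0. Qed.

Lemma cnorm_le_sum_norm m n (V : 'M[A]_(m, n)) i j : cnorm (V i j) <= sum_norm V.
Proof.
rewrite /sum_norm (bigD1 i)//= (bigD1 j)//= -addrA lerDl addr_ge0//.
  by apply: sumr_ge0 => *; exact: cnorm_ge0.
by apply: sumr_ge0 => *; apply: sumr_ge0 => *; exact: cnorm_ge0.
Qed.

Lemma sum_norm_eq0 m n (V : 'M[A]_(m, n)) : sum_norm V <= 0 -> V = 0.
Proof.
move=> V0; apply/matrixP => i j; rewrite mxE; apply/eqP.
by rewrite -cnorm_eq0 eq_le cnorm_ge0 (le_trans (cnorm_le_sum_norm V i j)).
Qed.

Lemma ler_sum_normD m n (V W : 'M[A]_(m, n)) :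
  sum_norm (V + W) <= sum_norm V + sum_norm W.
Proof.
rewrite -big_split; apply: ler_sum => i _; rewrite -big_split.
by apply: ler_sum => j _; rewrite mxE ler_cnormD.
Qed.

Lemma sum_normN m n (V : 'M[A]_(m, n)) : sum_norm (- V) = sum_norm V.
Proof. by apply: eq_bigr => i _; apply: eq_bigr => j _; rewrite mxE cnormN. Qed.

Lemma ler_sum_normM m n p (V : 'M[A]_(m, n)) (W : 'M[A]_(n, p)) :
  sum_norm (V *m W) <= sum_norm V * sum_norm W.
Proof.
rewrite mulr_suml; apply: ler_sum => i _.
rewrite (@le_trans _ _ (\sum_j \sum_l cnorm (V i l) * cnorm (W l j)))//.
  apply: ler_sum => j _; rewrite mxE (le_trans (ler_cnorm_sum _ _ _))//.
  by apply: ler_sum => l _; exact: ler_cnormM.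
rewrite exchange_big mulr_suml; apply: ler_sum => l _ /=.
rewrite -mulr_sumr ler_wpM2l ?cnorm_ge0//.
rewrite [leRHS](bigD1 l)//= lerDl.
by apply: sumr_ge0 => *; apply: sumr_ge0 => *; exact: cnorm_ge0.
Qed.

End SumNorm.

Section Tower.
Variables (R : realType) (A : cstarAlgType R) (k : nat -> nat).
Variable f : forall n, {lrmorphism 'M[R[i]]_((k n).+1) -> A}.
Hypothesis fstar : forall n, star_preserving (f n).
Hypothesis finj : forall n, injective (f n).
Hypothesis fsub : forall n, range (f n) `<=` range (f n.+1).
Hypothesis fdense : forall x (e : R), 0 < e -> exists n X, cnorm (x - f n X) < e.

Lemma tower_mono m n : (m <= n)%N -> range (f m) `<=` range (f n).
Proof.
elim: n => [|n IH]; first by rewrite leqn0 => /eqP ->.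
rewrite leq_eqVlt ltnS => /predU1P[-> //|/IH mn].
by move=> x /mn /fsub.
Qed.

Lemma tower_lift m n (X : 'M[R[i]]_((k m).+1)) : (m <= n)%N ->
  exists Y, f n Y = f m X.
Proof.
move=> /tower_mono mn; have [Y _ YX] : range (f n) (f m X) by apply: mn; exists X.
by exists Y.
Qed.

Lemma tower_approx (I : finType) (x : I -> A) (e : R) m0 : 0 < e ->
  exists2 m, (m0 <= m)%N & exists X, forall i, cnorm (x i - f m (X i)) < e.
Proof.
move=> e0; have [g Hg] := choice (fun i => fdense (x i) e0).
set m := maxn m0 (\max_i g i); exists m; first exact: leq_maxl.
suff H i : exists X, cnorm (x i - f m X) < e by have [X HX] := choice H; exists X.
have [X HX] := Hg i.
have [|Y HY] := @tower_lift (g i) m X.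
  by rewrite leq_max (leq_bigmax i) orbT.
by exists Y; rewrite HY.
Qed.

(* A matrix [V] close to [v] and with entries in one matrix algebra is injective,
   hence has a right inverse [y]; then [v y] is close to 1 and [v] is onto. *)
Lemma tower_stably_finite : stably_finite A.
Proof.
move=> n v vv; set vs := star_mx v in vv *.
pose M := sum_norm vs + 1.
have M0 : 0 < M by rewrite ltr_wpDl// sum_norm_ge0.
have vsM : sum_norm vs <= M by rewrite lerDl.
pose e := (4 * M)^-1; have e0 : 0 < e by rewrite invr_gt0 mulr_gt0.
have Me : M * e = 4^-1 by rewrite /e invfM mulrCA mulfV ?mulr1// gt_eqF.
(* [n] may be 0, hence the successor; the [n * n] entrywise errors still add up to at most [e]. *)
pose d : R := e / (n * n).+1%:R.
have d0 : 0 < d by rewrite divr_gt0.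
have [m _ [x Hx]] := @tower_approx ('I_n * 'I_n)%type (fun p => v p.1 p.2) d 0 d0.
pose X : 'M['M[R[i]]_((k m).+1)]_n := \matrix_(i, j) x (i, j).
pose V : 'M[A]_n := map_mx (f m) X.
have Vv : sum_norm (v - V) <= e.
  rewrite (@le_trans _ _ (\sum_(i < n) \sum_(j < n) d))//.
    apply: ler_sum => i _; apply: ler_sum => j _.
    by rewrite !mxE ltW// (Hx (i, j)).
  rewrite !sumr_const card_ord -mulrnA -mulr_natr /d -mulrA ler_piMr ?(ltW e0)//.
  by rewrite mulrC ler_pdivrMr// mul1r ler_nat.
have small (W : 'M[A]_n) c : 0 <= c -> c < 1 -> sum_norm W <= c * sum_norm W -> W = 0.
  move=> c0 c1 h; apply: sum_norm_eq0; have := sum_norm_ge0 W.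
  have : 0 < 1 - c by rewrite subr_gt0.
  by move: h; nra.
have Xu : flatten_mx X \in unitmx.
  rewrite -row_full_unit -cokermx_eq0; apply/eqP.
  set Z := cokermx _; have XZ : flatten_mx X *m Z = 0 by exact: mulmx_coker.
  suff : unflatten_mx Z = 0.
    by move/(congr1 (@flatten_mx _ _ _)); rewrite unflatten_mxK flatten_mx0.
  have XZ' : X *m unflatten_mx Z = 0.
    by apply: (can_inj (@flatten_mxK _ _ _)); rewrite flatten_mxM unflatten_mxK flatten_mx0.
  have z0 : map_mx (f m) (unflatten_mx Z) = 0.
    set z := map_mx _ _; have Vz : V *m z = 0 by rewrite -map_mxM XZ' map_mx0.
    have zE : z = vs *m ((v - V) *m z) by rewrite mulmxBl Vz subr0 mulmxA vv mul1mx.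
    apply: (@small _ 4^-1) => //; first by lra.
    rewrite {1}zE (le_trans (ler_sum_normM _ _))//.
    rewrite (@le_trans _ _ (M * (e * sum_norm z)))//; last by rewrite mulrA Me.
    rewrite ler_pM ?sum_norm_ge0// (le_trans (ler_sum_normM _ _))//.
    by rewrite ler_wpM2r// sum_norm_ge0.
  apply/matrixP => i j; have := congr1 (fun (W : 'M[A]_n) => W i j) z0.
  by rewrite !mxE -(raddf0 (f m)) => /finj.
pose Y := unflatten_mx (invmx (flatten_mx X)).
have XY : X *m Y = 1%:M.
  apply: (can_inj (@flatten_mxK _ _ _)).
  by rewrite flatten_mxM unflatten_mxK flatten_mx1 mulmxV.
pose y := map_mx (f m) Y.
have Vy : V *m y = 1%:M by rewrite -map_mxM XY map_mx1.
pose D := (V - v) *m y.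
have vy : v *m y = 1%:M - D by rewrite /D mulmxBl Vy opprB addrC subrK.
have yE : y = vs - vs *m D by rewrite -{1}(mulmx1 vs) -mulmxBr -vy mulmxA vv mul1mx.
have Ve : sum_norm (V - v) <= e by rewrite -opprB sum_normN.
have De : sum_norm D <= e * sum_norm y.
  by rewrite (le_trans (ler_sum_normM _ _))// ler_wpM2r// sum_norm_ge0.
have yM : sum_norm y <= 2 * M.
  have h1 := ler_sum_normD vs (- (vs *m D)).
  rewrite -yE sum_normN in h1.
  have h2 := ler_sum_normM vs D.
  have h3 : sum_norm vs * sum_norm D <= M * (e * sum_norm y).
    by rewrite ler_pM// sum_norm_ge0.
  rewrite mulrA Me in h3; have := sum_norm_ge0 y; lra.
have D2 : sum_norm D <= 2^-1.
  rewrite (le_trans De)// (@le_trans _ _ (e * (2 * M)))//.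
    by rewrite ler_wpM2l// ltW.
  by rewrite mulrCA (mulrC e) Me; lra.
apply/eqP; rewrite eq_sym -subr_eq0; apply/eqP.
apply: (@small _ 2^-1) => //; first by lra.
(* [1 - v *m vs] annihilates [v], hence also [v *m y = 1 - D]; since [D] has norm at most 1/2, it
   must vanish. *)
have WE : 1%:M - v *m vs = (1%:M - v *m vs) *m D.
  have : (1%:M - v *m vs) *m (1%:M - D) = 0.
    rewrite -vy mulmxBl mul1mx -mulmxA (mulmxA vs) vv mul1mx subrr //.
  by rewrite mulmxBr mulmx1 => /eqP; rewrite subr_eq0 => /eqP.
rewrite {1}WE (le_trans (ler_sum_normM _ _))// mulrC.
by rewrite ler_wpM2r ?sum_norm_ge0.
Qed.

End Tower.

(** * The trace of a tower *)

Section MatrixUnits.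
Variables (R : realType) (K : nat).

Definition matrix_units (B : starAlgType R) (F : 'I_K.+1 -> 'I_K.+1 -> B) :=
  [/\ forall a b c d, F a b * F c d = (b == c)%:R *: F a d,
      forall a b, star (F a b) = F b a
    & \sum_a F a a = 1].

Lemma matrix_units_delta :
  @matrix_units 'M[R[i]]_K.+1 (fun a b => delta_mx a b).
Proof.
split=> [a b c d|a b|]; [exact: mul_delta|exact: star_delta|].
by rewrite -[RHS]/(1%:M) mx1_sum_delta.
Qed.

Lemma matrix_units_morph (B C : starAlgType R) (f : {lrmorphism B -> C}) F :
  star_preserving f -> matrix_units F -> matrix_units (fun a b => f (F a b)).
Proof.
move=> fs [FM Fs F1]; split=> [a b c d|a b|].
- by rewrite -linearZ_LR -FM rmorphM.
- by rewrite -fs Fs.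
- by rewrite -(rmorph1 f) -F1 rmorph_sum.
Qed.

Lemma matrix_units_inj (B C : starAlgType R) (f : {lrmorphism B -> C}) F :
  star_preserving f -> injective f -> matrix_units (fun a b => f (F a b)) ->
  matrix_units F.
Proof.
move=> fs fi [FM Fs F1]; split=> [a b c d|a b|]; apply: fi.
- by rewrite rmorphM linearZ_LR; exact: FM.
- by rewrite fs Fs.
- by rewrite rmorph_sum rmorph1; exact: F1.
Qed.

(** The relations alone fix the trace: the [F c c] have a common trace, because [F c a * F a c] and
    [F a c * F c a] do, and they add up to 1. This makes normalized traces agree along a tower, and
    later gives the rank of a minimal projection. *)
Lemma mxtrace_units L (F : 'I_K.+1 -> 'I_K.+1 -> 'M[R[i]]_L.+1) a b :
  matrix_units F -> \tr (F a b) = (a == b)%:R * (L.+1%:R / K.+1%:R).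
Proof.
move=> [FM _ F1]; have trC (X Y : 'M[R[i]]_L.+1) : \tr (X * Y) = \tr (Y * X).
  exact: mxtrace_mulC.
have FK (c d e : 'I_K.+1) : F c d * F d e = F c e by rewrite FM eqxx scale1r.
have [<-|ab] := eqVneq a b; last first.
  by rewrite -(FK a a b) trC FM eq_sym (negPf ab) scale0r mxtrace0 mul0r.
have trE c : \tr (F c c) = \tr (F a a) by rewrite -(FK c a c) trC FK.
have : \sum_c \tr (F c c) = L.+1%:R.
  by rewrite -raddf_sum /= F1 -[1]/(1%:M) mxtrace_scalar.
rewrite (eq_bigr _ (fun c _ => trE c)) sumr_const card_ord => <-.
by rewrite mul1r -[X in X / _]mulr_natr mulfK ?pnatr_eq0.
Qed.

End MatrixUnits.

Lemma linear_sum2 (R : nzRingType) (U V : lmodType R) (g : {linear U -> V})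
    (I J : finType) (c : I -> J -> R) (u : I -> J -> U) :
  g (\sum_i \sum_j c i j *: u i j) = \sum_i \sum_j c i j *: g (u i j).
Proof.
rewrite raddf_sum; apply: eq_bigr => i _.
by rewrite raddf_sum; apply: eq_bigr => j _; exact: linearZ_LR.
Qed.

(** The McShane extension [inf_t (g t + cnorm (x - p t))] of a function that is 1-Lipschitz along
    [p]. It extends the trace from the dense union without sequences of approximants. *)
Lemma mcshane (R : realType) (A : cstarAlgType R) (T : Type) (t0 : T)
    (p : T -> A) (g : T -> R) :
  (forall s t, `|g s - g t| <= cnorm (p s - p t)) ->
  exists G : A -> R, forall x t, `|G x - g t| <= cnorm (x - p t).
Proof.
move=> gp; pose S x := [set g t + cnorm (x - p t) | t in [set: T]].
exists (fun x => inf (S x)) => x t.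
have S0 : S x !=set0 by exists (g t + cnorm (x - p t)), t.
have lb : lbound (S x) (g t - cnorm (x - p t)).
  move=> _ [s _ <-]; have := gp t s; rewrite ler_norml => /andP[_].
  have := cnorm_dist_trans x (p t) (p s).
  rewrite (cnorm_distC (p t) x); lra.
rewrite ler_norml; apply/andP; split.
  by rewrite lerBrDl; apply: lb_le_inf.
rewrite lerBlDl; apply: ge_inf; first by exists (g t - cnorm (x - p t)).
by exists t.
Qed.

Section NormC.
Variable R : realType.
Implicit Types z w : R[i].

Lemma normcD z w : Normc.normc (z + w) <= Normc.normc z + Normc.normc w.
Proof. exact: (le_normcD (z : Rcomplex R)). Qed.

Lemma normcNe z : Normc.normc (- z) = Normc.normc z.
Proof. exact: (normcN (z : Rcomplex R)). Qed.

Lemma normc_Re z : `|complex.Re z| <= Normc.normc z.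
Proof.
by case: z => a b /=; rewrite -sqrtr_sqr ler_wsqrtr// lerDl sqr_ge0.
Qed.

Lemma normc_Im z : `|complex.Im z| <= Normc.normc z.
Proof.
by case: z => a b /=; rewrite -sqrtr_sqr ler_wsqrtr// lerDr sqr_ge0.
Qed.

Lemma normc_ReIm z : Normc.normc z <= `|complex.Re z| + `|complex.Im z|.
Proof.
case: z => a b /=; rewrite -[leRHS]ger0_norm ?addr_ge0// -sqrtr_sqr.
rewrite ler_wsqrtr// sqrrD !real_normK ?num_real// lerD2r lerDl mulrn_wge0//.
Qed.

Lemma normc_small_eq0 z c :
  (forall e, 0 < e -> Normc.normc z <= c * e) -> z = 0.
Proof.
move=> h; apply: Normc.eq0_normc; apply/eqP; rewrite eq_le normc_ge0 andbT.
apply/ler_addgt0Pr => e e0; rewrite add0r.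
have c0 : 0 < `|c| + 1 by rewrite ltr_wpDl.
apply: le_trans (h (e / (`|c| + 1)) _) _; first by rewrite divr_gt0.
rewrite mulrCA ger_pMr// ler_pdivrMr// mul1r.
by rewrite (le_trans (ler_norm _))// lerDl.
Qed.

Lemma normc_nat n : Normc.normc (n%:R : R[i]) = n%:R.
Proof. by rewrite -(rmorph_nat (real_complex R)) normcR ger0_norm. Qed.

End NormC.

Section Trace.
Variables (R : realType) (A : cstarAlgType R) (k : nat -> nat).
Variable f : forall n, {lrmorphism 'M[R[i]]_((k n).+1) -> A}.
Hypothesis fstar : forall n, star_preserving (f n).
Hypothesis finj : forall n, injective (f n).
Hypothesis fsub : forall n, range (f n) `<=` range (f n.+1).
Hypothesis fdense : forall x (e : R), 0 < e -> exists n X, cnorm (x - f n X) < e.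

Let ntr n (X : 'M[R[i]]_((k n).+1)) : R[i] := \tr X / (k n).+1%:R.

Lemma tower_units m n : (m <= n)%N -> exists2 F, matrix_units F &
  forall a b, f n (F a b) = f m (delta_mx a b).
Proof.
move=> mn; have H a b := tower_lift fsub (delta_mx a b) mn.
have H' a : exists g, forall b, f n (g b) = f m (delta_mx a b).
  by have [g Hg] := choice (H a); exists g.
have [F1 HF1] := choice H'.
exists F1 => //; apply: (matrix_units_inj (@fstar n) (@finj n)).
rewrite (_ : (fun a b => _) = fun a b => f m (delta_mx a b)).
  exact: (matrix_units_morph (@fstar m) (matrix_units_delta R (k m))).
by apply/funext => a; apply/funext => b; exact: HF1.
Qed.

Let ntr_lift m n X Y : (m <= n)%N -> f m X = f n Y -> ntr X = ntr Y.
Proof.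
move=> mn XY; have [F FU FE] := tower_units mn.
have -> : Y = \sum_i \sum_j X i j *: F i j.
  apply: finj; rewrite -XY {1}(matrix_sum_delta X) !linear_sum2.
  apply: eq_bigr => i _; apply: eq_bigr => j _; congr (_ *: _).
  exact/esym/FE.
rewrite /ntr raddf_sum /=.
under eq_bigr => i _.
  rewrite raddf_sum /= (bigD1 i)//= linearZ /= mxtrace_units// eqxx mul1r.
  rewrite big1 ?addr0 => [|j ji]; last first.
    by rewrite linearZ /= mxtrace_units// eq_sym (negPf ji) mul0r mulr0.
  over.
rewrite -mulr_suml -mulrA mulrAC divff ?pnatr_eq0// mul1r //.
Qed.

Let ntr_bound n X : Normc.normc (@ntr n X) <= cnorm (f n X).
Proof.
rewrite /ntr Normc.normcM Normc.normcV normc_nat ler_pdivrMr ?ltr0n//.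
have nsum (I : finType) (g : I -> R[i]) :
    Normc.normc (\sum_i g i) <= \sum_i Normc.normc (g i).
  elim/big_ind2: _ => [|x a y b xa yb|//]; first by rewrite Normc.normc0.
  by rewrite (le_trans (normcD _ _))// lerD.
rewrite (le_trans (nsum _ _))// (@le_trans _ _ (\sum_(i < (k n).+1) cnorm (f n X)))//.
  by apply: ler_sum => i _; exact: normc_le_cnorm.
by rewrite sumr_const card_ord mulr_natr.
Qed.

Let ntr_lip m n X Y : Normc.normc (@ntr m X - @ntr n Y) <= cnorm (f m X - f n Y).
Proof.
have [X' HX] := tower_lift fsub X (leq_maxl m n).
have [Y' HY] := tower_lift fsub Y (leq_maxr m n).
rewrite (ntr_lift (leq_maxl m n) (esym HX)) (ntr_lift (leq_maxr m n) (esym HY)).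
have -> : ntr X' - ntr Y' = ntr (X' - Y') by rewrite /ntr raddfB /= mulrBl.
by rewrite (le_trans (ntr_bound _))// raddfB /= HX HY.
Qed.

(** The factor 2 is the price of extending the real and the imaginary part separately. *)
Let tau_ex : exists tau : A -> R[i], forall x n X,
  Normc.normc (tau x - @ntr n X) <= 2 * cnorm (x - f n X).
Proof.
pose T := {n & 'M[R[i]]_((k n).+1)}.
pose p (t : T) : A := f _ (tagged t); pose g (t : T) := ntr (tagged t).
have pg (s t : T) : Normc.normc (g s - g t) <= cnorm (p s - p t) by exact: ntr_lip.
pose t0 : T := existT _ 0%N (0 : 'M[R[i]]_((k 0%N).+1)).
have [G1 HG1] : exists G : A -> R, forall x t, `|G x - complex.Re (g t)| <= cnorm (x - p t).
  apply: (@mcshane _ _ T t0) => s t; apply: le_trans (pg s t).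
  by rewrite -raddfB; exact: normc_Re.
have [G2 HG2] : exists G : A -> R, forall x t, `|G x - complex.Im (g t)| <= cnorm (x - p t).
  apply: (@mcshane _ _ T t0) => s t; apply: le_trans (pg s t).
  by rewrite -raddfB; exact: normc_Im.
exists (fun x => G1 x +i* G2 x) => x n X.
pose t : T := existT _ n X.
rewrite (le_trans (normc_ReIm _))// mulr_natl mulr2n lerD//.
  by have := HG1 x t; rewrite /g /=; case: (ntr X).
by have := HG2 x t; rewrite /g /=; case: (ntr X).
Qed.

Lemma cnorm_mulB (x y x' y' : A) e : cnorm (x - x') <= e -> cnorm (y - y') <= e ->
  e <= 1 -> cnorm (x * y - x' * y') <= (cnorm x + cnorm y + 1) * e.
Proof.
move=> xe ye e1; have e0 : 0 <= e := le_trans (cnorm_ge0 _) xe.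
have -> : x * y - x' * y' = x * (y - y') + (x - x') * y'.
  by rewrite mulrBr mulrBl addrA subrK.
have y'1 : cnorm y' <= cnorm y + 1.
  have := ler_cnorm_dist y y'; rewrite ler_norml => /andP[]; lra.
have := ler_cnormMr x ye; have := ler_cnormMl y' xe.
have := ler_cnormD (x * (y - y')) ((x - x') * y').
have : e * cnorm y' <= e * (cnorm y + 1) by rewrite ler_wpM2l.
lra.
Qed.

(** Each property holds for normalized traces of matrices, and [tau_ex] transfers it to [tau] up to
    an error proportional to [e]. *)
Lemma tower_trace : exists tau : A -> R[i],
  [/\ forall z x y, tau (z *: x + y) = z * tau x + tau y,
      forall x y, tau (x * y) = tau (y * x),
      forall x, tau (star x) = (tau x)^*%C,
      forall x, 0 <= tau (star x * x)
    & forall n X, tau (f n X) = \tr X / (k n).+1%:R].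
Proof.
have [tau tauP] := tau_ex; exists tau.
have app (x y : A) e : 0 < e -> exists n X Y, [/\ cnorm (x - f n X) <= e,
    cnorm (y - f n Y) <= e, cnorm (x - f n X) <= 1 & cnorm (y - f n Y) <= 1].
  move=> e0; have m0 : 0 < Num.min e 1 by rewrite lt_min e0 ltr01.
  have [n _ [X HX]] := @tower_approx _ _ _ _ fsub fdense bool
    (fun b => if b then x else y) _ 0%N m0.
  exists n, (X true), (X false).
  have /= := HX true; have /= := HX false; rewrite !lt_min.
  by move=> /andP[/ltW -> /ltW ->] /andP[/ltW -> /ltW ->].
split.
- move=> z x y; apply/eqP; rewrite -subr_eq0; apply/eqP.
  apply: (@normc_small_eq0 _ _ (4 * (Normc.normc z + 1))) => e e0.
  have [n [X [Y [Xe Ye _ _]]]] := app x y _ e0.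
  have ntrE : ntr (z *: X + Y) = z * ntr X + ntr Y.
    by rewrite /ntr raddfD /= linearZ /= mulrDl mulrA.
  have -> : tau (z *: x + y) - (z * tau x + tau y) =
      (tau (z *: x + y) - ntr (z *: X + Y)) +
      (- (z * (tau x - ntr X)) + - (tau y - ntr Y)).
    by rewrite ntrE; ring.
  rewrite (le_trans (normcD _ _))// (@le_trans _ _ (2 * (Normc.normc z + 1) * e +
    (Normc.normc z * (2 * e) + 2 * e)))//; last by lra.
  rewrite lerD//.
    rewrite (le_trans (tauP _ _ _))// -mulrA ler_wpM2l// mulrDl mul1r.
    have -> : f n (z *: X + Y) = z *: f n X + f n Y by exact: linearP.
    rewrite opprD addrACA -scalerBr (le_trans (ler_cnormD _ _))// cnormZ.
    by rewrite lerD// ler_wpM2l ?normc_ge0.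
  rewrite (le_trans (normcD _ _))// !normcNe lerD//.
    rewrite Normc.normcM ler_wpM2l ?normc_ge0// (le_trans (tauP _ _ _))//.
    by rewrite ler_wpM2l.
  by rewrite (le_trans (tauP _ _ _))// ler_wpM2l.
- move=> x y; apply/eqP; rewrite -subr_eq0; apply/eqP.
  apply: (@normc_small_eq0 _ _ (4 * (cnorm x + cnorm y + 1))) => e e0.
  have e1 : 0 < Num.min e 1 by rewrite lt_min e0 ltr01.
  have [n [X [Y [Xe Ye _ _]]]] := app x y _ e1.
  have m1 : Num.min e 1 <= 1 by rewrite ge_min lexx orbT.
  have ntrE : ntr (X * Y) = ntr (Y * X).
    by rewrite /ntr -[X * Y]/(X *m Y) mxtrace_mulC.
  have -> : tau (x * y) - tau (y * x) =
      (tau (x * y) - ntr (X * Y)) + - (tau (y * x) - ntr (Y * X)).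
    by rewrite ntrE; ring.
  have h (a b : A) (P Q : 'M[R[i]]_((k n).+1)) :
      cnorm (a - f n P) <= Num.min e 1 -> cnorm (b - f n Q) <= Num.min e 1 ->
      Normc.normc (tau (a * b) - ntr (P * Q)) <= 2 * ((cnorm a + cnorm b + 1) * e).
    move=> aP bQ; rewrite (le_trans (tauP _ _ _))// ler_wpM2l// rmorphM.
    rewrite (le_trans (cnorm_mulB aP bQ m1))// ler_wpM2l ?ge_min ?lexx//.
    by rewrite !addr_ge0 ?cnorm_ge0.
  rewrite (le_trans (normcD _ _))// normcNe.
  have := h _ _ _ _ Xe Ye; have := h _ _ _ _ Ye Xe; lra.
- move=> x; apply/eqP; rewrite -subr_eq0; apply/eqP.
  apply: (@normc_small_eq0 _ _ 4) => e e0.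
  have [n [X [_ [Xe _ _ _]]]] := app x x _ e0.
  have ntrE : ntr (star X) = (ntr X)^*%C.
    rewrite /ntr rmorphM fmorphV rmorph_nat; congr (_ * _).
    by rewrite /mxtrace rmorph_sum; apply: eq_bigr => i _; rewrite !mxE.
  have -> : tau (star x) - (tau x)^*%C =
      (tau (star x) - ntr (star X)) + - (tau x - ntr X)^*%C.
    by rewrite ntrE rmorphB; ring.
  have nconj (z : R[i]) : Normc.normc z^*%C = Normc.normc z.
    by case: z => a b /=; rewrite sqrrN.
  rewrite (le_trans (normcD _ _))// normcNe nconj.
  have := tauP (star x) n (star X); rewrite fstar -starB cnorm_star.
  have := tauP x n X; lra.
- move=> x; set t := tau _.
  have H e : 0 < e -> exists2 r : R, 0 <= r &
      Normc.normc (t - r%:C) <= 2 * (cnorm x + cnorm x + 1) * e.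
    move=> e0; have e1 : 0 < Num.min e 1 by rewrite lt_min e0 ltr01.
    have [n [X [_ [Xe _ _ _]]]] := app x x _ e1.
    have m1 : Num.min e 1 <= 1 by rewrite ge_min lexx orbT.
    (* The normalized squared Hilbert-Schmidt norm of [X]: [t] is a limit of such nonnegative
       reals. *)
    pose r : R := (\sum_i \sum_j Normc.normc (X j i) ^+ 2) / (k n).+1%:R.
    have rE : r%:C = ntr (star X * X).
      rewrite /r /ntr (rmorphM (real_complex R)) /= -(rmorph_nat (real_complex R)).
      rewrite -(fmorphV (real_complex R)) /=; congr (_ * _).
      rewrite (rmorph_sum (real_complex R)); apply: eq_bigr => i _.
      rewrite mxE (rmorph_sum (real_complex R)); apply: eq_bigr => j _.
      by rewrite !mxE mulrC -sqr_normc (rmorphXn (real_complex R)).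
    exists r.
      rewrite divr_ge0 ?ler0n// sumr_ge0// => i _; rewrite sumr_ge0// => j _.
      exact: sqr_ge0.
    rewrite rE (le_trans (tauP _ _ _))// -mulrA ler_wpM2l//.
    have -> : f n (star X * X) = star (f n X) * f n X.
      by rewrite -fstar; exact: rmorphM.
    have sXe : cnorm (star x - star (f n X)) <= Num.min e 1.
      by rewrite -starB cnorm_star.
    rewrite (le_trans (cnorm_mulB sXe Xe m1))// cnorm_star ler_wpM2l ?ge_min ?lexx//.
    by rewrite !addr_ge0 ?cnorm_ge0.
  set C := 2 * _ in H; have C0 : 0 <= C by rewrite mulr_ge0// !addr_ge0 ?cnorm_ge0.
  case: t H => a b H; rewrite lecE /=; apply/andP; split.
    apply/eqP; have : b%:C = 0 :> R[i].
      apply: (@normc_small_eq0 _ _ C) => e /H[r _ le]; rewrite normcR.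
      by rewrite (le_trans _ le)// (le_trans _ (normc_Im _))//= oppr0 addr0.
    by case.
  apply/ler_addgt0Pr => e e0; have C1 : 0 < C + 1 by rewrite ltr_wpDl.
  have [|r r0 le] := H (e / (C + 1)); first by rewrite divr_gt0.
  have := le_trans (normc_Re _) le; rewrite /= ler_norml => /andP[].
  have : C * (e / (C + 1)) <= e.
    by rewrite mulrCA ger_pMr// ler_pdivrMr// mul1r lerDl.
  lra.
- move=> n X; apply/eqP; rewrite -subr_eq0; apply/eqP.
  apply: (@normc_small_eq0 _ _ 0) => e _; have := tauP (f n X) n X.
  by rewrite subrr cnorm0 mulr0 mul0r.
Qed.

End Trace.

(** * UHF algebras are quasidiagonal *)

Lemma sum_mxtens (V : nmodType) m n (g : 'I_(m * n) -> V) :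
  \sum_u g u = \sum_a \sum_i g (mxtens_index (a, i)).
Proof.
rewrite pair_big /= (reindex (@mxtens_index m n)) /=; last first.
  exists (@mxtens_unindex m n) => ? _.
    exact: mxtens_indexK.
  exact: mxtens_unindexK.
by apply: eq_bigr => -[a i].
Qed.

Section PositiveBlocks.
Variables (R : realType).

Definition cadj m n (X : 'M[R[i]]_(m, n)) : 'M[R[i]]_(n, m) := (map_mx conjc X)^T.

Lemma cadjM m n p (X : 'M[R[i]]_(m, n)) (Y : 'M[R[i]]_(n, p)) :
  cadj (X *m Y) = cadj Y *m cadj X.
Proof. by rewrite /cadj map_mxM trmx_mul. Qed.

Lemma psd_factor N (G : 'M[R[i]]_N.+1) : star G = G ->
  (forall xi : 'cV_N.+1, 0 <= (cadj xi *m G *m xi) 0 0) ->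
  exists S : 'M[R[i]]_N.+1, G = star S * S.
Proof.
move=> sG pos; have [U [d [UU UU' GE]]] := herm_spectral sG.
have d0 i : 0 <= d i.
  pose w : 'cV[R[i]]_N.+1 := delta_mx i 0.
  rewrite -ler0c; have := pos (star U *m w).
  rewrite cadjM -[cadj (star U)]/(star (star U)) starK.
  have -> : cadj w *m U *m G *m (star U *m w) = cadj w *m (U * G * star U) *m w.
    by rewrite -[U * G * star U]/(U *m G *m star U) !mulmxA.
  rewrite GE !mulrA UU' mul1r -mulrA UU' mulr1.
  have -> : cadj w = delta_mx 0 i.
    apply/matrixP => a b; rewrite !mxE andbC.
    by case: (_ && _); rewrite /= oppr0.
  by rewrite -rowE -colE !mxE eqxx mulr1n.
exists (rdiag (fun i => Num.sqrt (d i)) * U).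
rewrite starM star_rdiag -mulrA (mulrA (rdiag _)) rdiagM mulrA GE.
congr (_ * rdiag _ * _); apply/funext => i.
by rewrite -expr2 sqr_sqrtr.
Qed.

(** Flattened, [G] is a positive semidefinite scalar matrix; a factor of it is cut back into blocks.
    The case [m = 0] is separate because spectral decompositions are stated for nonempty
    matrices. *)
Lemma positive_mx_blocks n m (G : 'M['M[R[i]]_n.+1]_m) :
  (forall a b, star (G a b) = G b a) ->
  (forall xi : 'I_m -> 'cV_n.+1,
    0 <= \sum_a \sum_b (cadj (xi a) *m G a b *m xi b) 0 0) ->
  positive_mx G.
Proof.
case: m G => [|m] G sG pos; first by exists 0; apply/matrixP => -[].
have star_flat (X : 'M['M[R[i]]_n.+1]_m.+1) :
    flatten_mx (star_mx X) = cadj (flatten_mx X).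
  by apply/matrixP => i j; rewrite !mxE.
have sF : cadj (flatten_mx G) = flatten_mx G.
  by rewrite -star_flat; congr flatten_mx; apply/matrixP => a b; rewrite !mxE.
have [||S FS] := @psd_factor (n + m * n.+1)%N (@flatten_mx R[i] m.+1 n G).
- exact: sF.
- move=> xi0; pose xi : 'cV[R[i]]_(m.+1 * n.+1) := xi0; rewrite -[xi0]/xi.
  have := pos (fun a => \col_i xi (mxtens_index (a, i)) 0).
  congr (_ <= _); transitivity ((cadj xi *m flatten_mx G *m xi) 0 0) => //.
  rewrite [RHS]mxE sum_mxtens exchange_big.
  apply: eq_bigr => b _ /=.
  under eq_bigr do rewrite mxE.
  rewrite exchange_big; apply: eq_bigr => j _ /=.
  rewrite [in RHS]mxE sum_mxtens mulr_suml; apply: eq_bigr => a _.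
  rewrite !mxE; congr (_ * _); apply: eq_bigr => i _.
  by rewrite !mxE !mxtens_indexK.
exists (unflatten_mx (S : 'M[R[i]]_(m.+1 * n.+1))).
apply: (can_inj (@flatten_mxK _ _ _)).
by rewrite flatten_mxM star_flat unflatten_mxK FS.
Qed.

End PositiveBlocks.

(** * Trace-preserving conditional expectations onto matrix subalgebras *)

Section Expectation.
Variables (R : realType) (A : cstarAlgType R) (K : nat).
Variables (f : {lrmorphism 'M[R[i]]_K.+1 -> A}) (tau : A -> R[i]).
Hypotheses (fstar : star_preserving f) (finj : injective f).
Hypothesis tau_lin : forall z x y, tau (z *: x + y) = z * tau x + tau y.
Hypothesis tauC : forall x y, tau (x * y) = tau (y * x).
Hypothesis tau_star : forall x, tau (star x) = (tau x)^*%C.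
Hypothesis tau_ge0 : forall x, 0 <= tau (star x * x).
Hypothesis tau_f : forall X, tau (f X) = \tr X / K.+1%:R.

Let tauD x y : tau (x + y) = tau x + tau y.
Proof. by rewrite -{1}(scale1r x) tau_lin mul1r. Qed.

Let tau0 : tau 0 = 0.
Proof. by apply: (addrI (tau 0)); rewrite -tauD !addr0. Qed.

Let tauZ z x : tau (z *: x) = z * tau x.
Proof. by rewrite -(addr0 (z *: x)) tau_lin tau0 addr0. Qed.

Let tauN x : tau (- x) = - tau x.
Proof. by rewrite -scaleN1r tauZ mulN1r. Qed.

Let tau_sum (I : finType) (x : I -> A) : tau (\sum_i x i) = \sum_i tau (x i).
Proof. exact: (big_morph tau tauD tau0). Qed.

Let tau_sum2 (I : finType) (x y : I -> A) :
  tau (star (\sum_i x i) * \sum_j y j) = \sum_i \sum_j tau (star (x i) * y j).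
Proof.
rewrite star_sum mulr_suml tau_sum; apply: eq_bigr => i _.
by rewrite mulr_sumr tau_sum.
Qed.

Let e a b := f (delta_mx a b).

Let eU : matrix_units e.
Proof. exact: (matrix_units_morph fstar (matrix_units_delta R K)). Qed.

(* The coordinates of the trace-preserving conditional expectation onto [range f]. *)
Let phi x : 'M[R[i]]_K.+1 := \matrix_(i, j) (K.+1%:R * tau (e j i * x)).


Let phi_lin : linear phi.
Proof.
move=> z x y; apply/matrixP => i j; rewrite !mxE mulrDr -scalerAr tau_lin.
by rewrite mulrDr mulrCA.
Qed.

Let phi_f X : phi (f X) = X.
Proof.
apply/matrixP => i j; rewrite mxE /e.
have <- : f (delta_mx j i * X) = f (delta_mx j i) * f X by exact: rmorphM.
rewrite tau_f mulrCA divff// mulr1 -[_ * X]/(_ *m _) mxtrace_mulC.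
rewrite /mxtrace (bigD1 i)//= mxE (bigD1 j)//= mxE !eqxx mulr1.
rewrite [X in _ + X + _]big1 ?addr0 => [|l lj]; last first.
  by rewrite mxE (negPf lj) mulr0.
rewrite big1 ?addr0 // => l li; rewrite mxE big1// => p _.
by rewrite mxE (negPf li) andbF mulr0.
Qed.

(** The vector [xi] placed in the first column. By [tau_v], the matrix coefficients of [phi x] are
    values of [tau] up to the factor [K + 1], so that positivity of [tau] yields both complete
    positivity and the norm bound. *)
Let v (xi : 'cV[R[i]]_K.+1) : A := \sum_j xi j 0 *: e j ord0.

Let star_v xi : star (v xi) = \sum_i (xi i 0)^*%C *: e ord0 i.
Proof.
have [_ es _] := eU.
by rewrite star_sum; apply: eq_bigr => i _; rewrite starZ es.
Qed.

Let tau_v (xi eta : 'cV[R[i]]_K.+1) x :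
  K.+1%:R * tau (star (v eta) * x * v xi) = (cadj eta *m phi x *m xi) 0 0.
Proof.
have [eM _ _] := eU.
rewrite star_v mulr_suml mulr_suml tau_sum mulr_sumr mxE.
under [RHS]eq_bigr do rewrite mxE mulr_suml.
rewrite exchange_big; apply: eq_bigr => i _ /=.
rewrite mulr_sumr tau_sum mulr_sumr; apply: eq_bigr => j _.
have -> : tau ((eta i 0)^*%C *: e ord0 i * x * (xi j 0 *: e j ord0)) =
    (eta i 0)^*%C * (xi j 0 * tau (e j i * x)).
  rewrite -!scalerAl -scalerAr !tauZ (tauC _ (e j ord0)) (mulrA (e j ord0)) eM eqxx.
  by rewrite scale1r.
by rewrite !mxE; ring.
Qed.

Let tau_vv xi : K.+1%:R * tau (star (v xi) * v xi) = (cadj xi *m xi) 0 0.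
Proof.
rewrite -(mulr1 (star _)) tau_v -(rmorph1 f).
by rewrite [phi _]phi_f mulmx1.
Qed.

Let phi_star x : phi (star x) = star (phi x).
Proof.
have [_ es _] := eU.
have cM (z w : R[i]) : (z * w)^*%C = z^*%C * w^*%C by exact: rmorphM.
apply/matrixP => i j; rewrite !mxE cM conjc_nat -tau_star starM es.
by rewrite tauC.
Qed.

Let phi_cp : completely_positive phi.
Proof.
move=> m X [Y XE]; apply: positive_mx_blocks => [a b|xi].
  rewrite !mxE -phi_star; congr phi.
  rewrite XE !mxE star_sum; apply: eq_bigr => c _.
  by rewrite !mxE starM starK.
pose w c := \sum_b Y c b * v (xi b).
suff -> : \sum_a \sum_b (cadj (xi a) *m map_mx phi X a b *m xi b) 0 0 =
    K.+1%:R * \sum_c tau (star (w c) * w c).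
  by rewrite mulr_ge0 ?ler0n// sumr_ge0// => c _; exact: tau_ge0.
transitivity (\sum_a \sum_b \sum_c
    K.+1%:R * tau (star (Y c a * v (xi a)) * (Y c b * v (xi b)))).
  apply: eq_bigr => a _; apply: eq_bigr => b _.
  have -> : map_mx phi X a b = phi (X a b) by rewrite mxE.
  rewrite -tau_v XE mxE mulr_sumr mulr_suml tau_sum mulr_sumr.
  by apply: eq_bigr => c _; rewrite !mxE starM !mulrA.
rewrite mulr_sumr; under [LHS]eq_bigr do rewrite exchange_big.
rewrite exchange_big; apply: eq_bigr => c _ /=.
rewrite tau_sum2 [RHS]mulr_sumr; apply: eq_bigr => a _.
by rewrite [RHS]mulr_sumr.
Qed.

(** For the form [tau (star a * b)], the element [v eta] is the orthogonal projection of [x * v xi]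
    to the first column, so it is no longer than [x * v xi] ([h1]). The latter is bounded through
    [star x * x <= c^2], witnessed by a square root of the difference ([h2]). *)
Let phi_contractive x : cnorm (f (phi x)) <= cnorm x.
Proof.
rewrite -(opnormE fstar finj); apply: ge_sup.
  by exists (l2norm (phi x *m 0)), 0 => //=; rewrite /l2norm big1 ?sqrtr0// => i _;
    rewrite mxE Normc.normc0 expr0n.
move=> _ [xi /= xi1 <-].
set eta := phi x *m xi; set c := cnorm x.
have c0 : 0 <= c := cnorm_ge0 x.
rewrite -(@ler_pXn2r _ 2) ?nnegrE ?sqrtr_ge0//.
have KR0 : 0 <= (K.+1%:R : R[i]) by rewrite ler0n.
have etaE : (l2norm eta ^+ 2)%:C = (cadj eta *m eta) 0 0 := sqr_l2normE eta.
have xiE : (l2norm xi ^+ 2)%:C = (cadj xi *m xi) 0 0 := sqr_l2normE xi.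
have t1 : K.+1%:R * tau (star (v eta) * (x * v xi)) = (l2norm eta ^+ 2)%:C.
  by rewrite mulrA tau_v -mulmxA etaE.
have t2 : K.+1%:R * tau (star (x * v xi) * v eta) = (l2norm eta ^+ 2)%:C.
  have -> : star (x * v xi) * v eta = star (star (v eta) * (x * v xi)).
    by rewrite [in RHS]starM starK.
  rewrite tau_star -(conjc_real (l2norm eta ^+ 2)) -t1 rmorphM.
  by rewrite rmorph_nat.
have t3 : K.+1%:R * tau (star (v eta) * v eta) = (l2norm eta ^+ 2)%:C.
  by rewrite tau_vv etaE.
have h1 : (l2norm eta ^+ 2)%:C <=
    K.+1%:R * tau (star (x * v xi) * (x * v xi)).
  have := mulr_ge0 KR0 (tau_ge0 (x * v xi - v eta)).
  rewrite starB mulrBl !(mulrBr (star _)) !(tauD, tauN) !(mulrBr K.+1%:R).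
  by rewrite t1 t2 t3 subrr subr0 subr_ge0.
have h2 : K.+1%:R * tau (star (x * v xi) * (x * v xi)) <=
    (c ^+ 2)%:C * (K.+1%:R * tau (star (v xi) * v xi)).
  have [s [ss sE]] : exists s : A, star s = s /\
      s * s = (c ^+ 2)%:C%:A - star x * x.
    have [x0|x0] := eqVneq c 0.
      have xE : x = 0 by apply: cnorm0_eq0.
      by exists 0; rewrite x0 xE star0 !mul0r expr0n scale0r subrr.
    have cp : 0 < c ^+ 2 by rewrite exprn_gt0// lt_neqAle eq_sym x0.
    pose w := ((c ^+ 2)^-1)%:C *: (star x * x).
    have sw : star w = w by rewrite starZr starM starK.
    have w1 : cnorm w <= 1.
      rewrite cnormZr cnorm_starM ger0_norm ?invr_ge0 ?(ltW cp)//.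
      by rewrite mulVf ?gt_eqF.
    have [s [ss sE _ _]] := sqrt_1B sw w1.
    exists (c%:C *: s); split; first by rewrite starZr ss.
    rewrite -scalerAl -scalerAr scalerA -(rmorphM (real_complex R)) /= -expr2 sE.
    rewrite scalerBr /w scalerA -(rmorphM (real_complex R)) /= mulfV ?gt_eqF//.
    by rewrite scale1r.
  have := mulr_ge0 KR0 (tau_ge0 (s * v xi)).
  have -> : star (s * v xi) * (s * v xi) = (c ^+ 2)%:C *: (star (v xi) * v xi) -
      star (x * v xi) * (x * v xi).
    rewrite starM ss -mulrA (mulrA s) sE mulrBl mulrBr -scalerAl mul1r -scalerAr.
    by rewrite starM !mulrA.
  by rewrite tauD tauZ tauN mulrDr mulrN mulrCA subr_ge0.
rewrite tau_vv -xiE -(rmorphM (real_complex R)) /= in h2.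
have := le_trans h1 h2; rewrite lecR => /le_trans; apply.
by rewrite ler_piMr ?sqr_ge0// expr_le1// sqrtr_ge0.
Qed.

Lemma expectation : exists F : {linear A -> 'M[R[i]]_K.+1},
  [/\ completely_positive F, forall X, F (f X) = X
    & forall x, cnorm (f (F x)) <= cnorm x].
Proof.
pose F : {linear A -> 'M[R[i]]_K.+1} :=
  HB.pack phi (GRing.isLinear.Build _ _ _ _ phi phi_lin).
by exists F; split; [exact: phi_cp|exact: phi_f|exact: phi_contractive].
Qed.

End Expectation.

Section UHFQuasidiagonal.
Variables (R : realType) (A : cstarAlgType R).

(** The expectation onto a level is contractive and fixes that level, so it moves an element within
    [d] of the level by at most [2 * d]. *)
Lemma UHF_quasidiagonal : UHF A -> quasidiagonal A.
Proof.
move=> [k [f [fsi fsub fdense]]] F e e0.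
have fstar n : star_preserving (f n) by case: (fsi n).
have finj n : injective (f n) by case: (fsi n).
have [tau [tau_lin tauC tau_star tau_ge0 tau_f]] := tower_trace fstar finj fsub fdense.
pose M := \sum_(a <- F) cnorm a + 1.
have FM a : a \in F -> cnorm a <= M.
  move=> aF; rewrite /M (big_rem a aF) /= -addrA lerDl addr_ge0//.
  by apply: sumr_ge0 => *; exact: cnorm_ge0.
have M1 : 1 <= M by rewrite lerDr sumr_ge0// => *; exact: cnorm_ge0.
(* The defect of multiplicativity is at most [2 * d + 4 * d * M], which is below [10 * d * M]
   because [M >= 1]. *)
pose d := e / (10 * M).
have M0 : 0 < M by lra.
have d0 : 0 < d by rewrite divr_gt0// mulr_gt0.
have dM : 10 * (d * M) = e by rewrite /d; field; rewrite gt_eqF.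
have de : 10 * d <= e by rewrite -dM ler_wpM2l// ler_peMr// ltW.
pose s := F ++ [seq a * b | a <- F, b <- F].
have [n _ [X HX]] := tower_approx fsub fdense (fun i : 'I_(size s) => s`_i) 0%N d0.
have [G [Gcp Gf Gc]] := expectation (fstar n) (finj n) tau_lin tauC tau_star tau_ge0 (tau_f n).
have near a : a \in s -> cnorm (f n (G a) - a) <= 2 * d.
  move=> /(nthP 0)[i si <-]; have := HX (Ordinal si); set Y := X _ => /= h.
  rewrite (le_trans (cnorm_dist_trans (f n Y) _ _))// mulr_natl mulr2n lerD//.
    have -> : f n (G s`_i) - f n Y = f n (G (s`_i - f n Y)).
      have -> : G (s`_i - f n Y) = G s`_i - G (f n Y) by exact: linearB.
      by rewrite Gf; apply/esym/raddfB.
    by rewrite (le_trans (Gc _))// ltW.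
  by rewrite cnorm_distC ltW.
exists (k n), G; split.
- by rewrite -(rmorph1 (f n)) Gf.
- exact: Gcp.
- move=> a b aF bF; rewrite (opnormE (fstar n) (finj n)).
  have -> : f n (G (a * b) - G a * G b) = f n (G (a * b)) - f n (G a) * f n (G b).
    by rewrite -rmorphM; exact: raddfB.
  have na := near a; have nb := near b.
  rewrite !mem_cat aF bF in na nb; have {}na := na isT; have {}nb := nb isT.
  have nab : cnorm (f n (G (a * b)) - a * b) <= 2 * d.
    by apply: near; rewrite mem_cat; apply/orP; right; apply/allpairsP; exists (a, b).
  have h1 : cnorm (a * (b - f n (G b))) <= M * (2 * d).
    by rewrite (le_trans (ler_cnormM _ _))// ler_pM ?cnorm_ge0 ?FM// cnorm_distC.
  have h2 : cnorm ((a - f n (G a)) * f n (G b)) <= 2 * d * M.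
    rewrite (le_trans (ler_cnormM _ _))// ler_pM ?cnorm_ge0//.
      by rewrite cnorm_distC.
    by rewrite (le_trans (Gc _))// FM.
  have -> : f n (G (a * b)) - f n (G a) * f n (G b) =
      (f n (G (a * b)) - a * b) + (a * (b - f n (G b)) + (a - f n (G a)) * f n (G b)).
    by rewrite mulrBr mulrBl !addrA !subrK.
  have := ler_cnormD (f n (G (a * b)) - a * b)
    (a * (b - f n (G b)) + (a - f n (G a)) * f n (G b)).
  have := ler_cnormD (a * (b - f n (G b))) ((a - f n (G a)) * f n (G b)).
  lra.
- move=> a aF; rewrite (opnormE (fstar n) (finj n)).
  have := near a; rewrite mem_cat aF => /(_ isT) na.
  by have := ler_cnorm_dist (f n (G a)) a; lra.
Qed.

End UHFQuasidiagonal.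

(** * Local embeddings and ultrapowers *)

Lemma lrmorphism_of (R : realType) (A B : starAlgType R) (f : A -> B) :
  (forall x y, f (x + y) = f x + f y) -> (forall z x, f (z *: x) = z *: f x) ->
  f 1 = 1 -> (forall x y, f (x * y) = f x * f y) ->
  exists F : {lrmorphism A -> B}, forall x, F x = f x.
Proof.
move=> fD fZ f1 fM.
have lin : linear f by move=> z x y; rewrite fD fZ.
have mul : monoid_morphism f by split=> [|x y]; [exact: f1|exact: fM].
pose F : {lrmorphism A -> B} := HB.pack f
  (GRing.isLinear.Build _ _ _ _ f lin) (GRing.isMonoidMorphism.Build _ _ f mul).
by exists F.
Qed.

Lemma mx_embed (R : realType) k l : (k.+1 %| l.+1)%N ->
  exists h : {lrmorphism 'M[R[i]]_k.+1 -> 'M[R[i]]_l.+1},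
    star_preserving h /\ injective h.
Proof.
move=> /dvdnP[[|m] //]; rewrite mulSn addSn => -[->] {l}.
pose h (X : 'M[R[i]]_k.+1) : 'M[R[i]]_((k + m * k.+1).+1) :=
  @flatten_mx R[i] m.+1 k (X%:M).
have [||||F FE] := @lrmorphism_of R 'M[R[i]]_k.+1 'M[R[i]]_((k + m * k.+1).+1) h.
- by move=> X Y; apply/matrixP => i j; rewrite !mxE; case: (_ == _); rewrite !mxE// addr0.
- by move=> z X; apply/matrixP => i j; rewrite !mxE; case: (_ == _); rewrite !mxE// mulr0.
- exact: (@flatten_mx1 R[i] m.+1 k).
- by move=> X Y; rewrite /h scalar_mxM; exact: (@flatten_mxM R[i] m.+1 k).
exists F; split=> [X|X Y].
  rewrite !FE; apply/matrixP => i j; rewrite !mxE eq_sym.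
  by case: (_ == _); rewrite /= ?mxE//= oppr0.
rewrite !FE => /(can_inj (@flatten_mxK R[i] m.+1 k)) /matrixP /(_ ord0 ord0).
by rewrite !mxE eqxx.
Qed.

Section LocalEmbedding.
Variables (R : realType) (A Q : cstarAlgType R).

Definition ultra_embeds (A : cstarAlgType R) := exists (I : Type)
  (U : set_system I) (FU : UltraFilter U), embeds A (ultrapower Q FU).

(** [phi] is an arbitrary map tested at finitely many elements, so that finitely many conditions can
    express it. The two-sided control of norms makes the limit injective. *)
Definition approx_hom (F : seq A) (Z : seq R[i]) (e : R) (phi : A -> Q) :=
  [/\ cnorm (phi 1 - 1) < e,
      forall a b, a \in F -> b \in F ->
        cnorm (phi (a + b) - (phi a + phi b)) < e /\
        cnorm (phi (a * b) - phi a * phi b) < e,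
      forall a, a \in F -> cnorm (phi (star a) - star (phi a)) < e,
      forall z a, z \in Z -> a \in F -> cnorm (phi (z *: a) - z *: phi a) < e
    & forall a, a \in F -> `|cnorm (phi a) - cnorm a| < e].

Definition locally_embeds :=
  forall F Z (e : R), 0 < e -> exists phi, approx_hom F Z e phi.

(** The indices are the finite test data themselves, and the ultrafilter contains, for each of them,
    the set of all finer ones. The index set thus grows with [A], which may be nonseparable. *)
Lemma locally_embeds_ultra : locally_embeds -> ultra_embeds A.
Proof.
move=> lA; pose I := (seq A * seq R[i] * R)%type.
pose B (i : I) : set I :=
  [set j : I | [/\ {subset i.1.1 <= j.1.1}, {subset i.1.2 <= j.1.2} & 0 < j.2 <= i.2]].
have FF : ProperFilter (filter_from [set i : I | 0 < i.2] B).
  apply: filter_from_proper => [|i i0]; last by exists i; split=> //; rewrite i0 lexx.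
  apply: filter_from_filter; first by exists ([::], [::], 1) => /=.
  move=> [[F1 Z1] e1] [[F2 Z2] e2] /= e10 e20.
  exists (F1 ++ F2, Z1 ++ Z2, Num.min e1 e2); first by rewrite /= lt_min e10.
  move=> [[F Z] e] [/= sF sZ /andP[e0]]; rewrite le_min => /andP[ee1 ee2].
  split; split=> /=.
  - by move=> x xF; apply: sF; rewrite mem_cat xF.
  - by move=> x xF; apply: sZ; rewrite mem_cat xF.
  - by rewrite e0.
  - by move=> x xF; apply: sF; rewrite mem_cat xF orbT.
  - by move=> x xF; apply: sZ; rewrite mem_cat xF orbT.
  - by rewrite e0.
have [U [FU sU]] := ultraFilterLemma FF.
have [phi Hphi] : exists phi : I -> A -> Q, forall i, 0 < i.2 ->
    approx_hom i.1.1 i.1.2 i.2 (phi i).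
  suff H (i : I) : exists p : A -> Q, 0 < i.2 -> approx_hom i.1.1 i.1.2 i.2 p.
    by have [phi Hphi] := choice H; exists phi.
  have [i0|i0] := boolP (0 < i.2); last by exists (fun=> 0).
  by have [p Hp] := lA i.1.1 i.1.2 _ i0; exists p.
(* Truncation makes the family bounded. It changes nothing at indices that test [a] with tolerance
   at most 1, whence the minimum with 1 in [ev]. *)
pose psi i a := if cnorm (phi i a) <= cnorm a + 1 then phi i a else 0.
have bnd a : exists M : R, forall i, cnorm (psi i a) <= M.
  exists (cnorm a + 1) => i; rewrite /psi; case: ifP => // _.
  by rewrite cnorm0 addr_ge0 ?cnorm_ge0.
pose f a : ultrapower Q FU := ucls FU (Linfty (bnd a)).
have ev (F : seq A) (Z : seq R[i]) (e : R) : 0 < e -> U [set i : I | exists F' Z' e',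
    [/\ {subset F <= F'}, {subset Z <= Z'}, e' <= e & approx_hom F' Z' e' (phi i)] /\
    forall a, a \in F -> psi i a = phi i a].
  move=> e0; apply: sU; exists (F, Z, Num.min e 1); first by rewrite /= lt_min e0 ltr01.
  move=> [[F' Z'] e'] [/= sF sZ /andP[e'0]]; rewrite le_min => /andP[ee' e'1].
  have H := Hphi (F', Z', e') e'0.
  exists F', Z', e'; split; first by split.
  move=> a /sF aF; have [_ _ _ _ HN] := H.
  have := HN a aF; rewrite ltr_norml /= => /andP[_ h].
  by rewrite /psi ifT//; lra.
have fD a b : f (a + b) = f a + f b.
  rewrite -[RHS]/(uadd _ _) uaddE; apply/ucls_eqP => e e0.
  apply: filterS (ev [:: a; b; a + b] [::] e e0) => i [F [Z [e' [[sF _ ee [_ H _ _ _]] E]]]].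
  rewrite /= !E ?inE ?eqxx ?orbT//.
  have [||h _] := H a b; [by apply: sF; rewrite !inE eqxx ?orbT..|].
  exact: lt_le_trans h ee.
have fM a b : f (a * b) = f a * f b.
  rewrite -[RHS]/(umul _ _) umulE; apply/ucls_eqP => e e0.
  apply: filterS (ev [:: a; b; a * b] [::] e e0) => i [F [Z [e' [[sF _ ee [_ H _ _ _]] E]]]].
  rewrite /= !E ?inE ?eqxx ?orbT//.
  have [||_ h] := H a b; [by apply: sF; rewrite !inE eqxx ?orbT..|].
  exact: lt_le_trans h ee.
have fS a : f (star a) = star (f a).
  rewrite -[RHS]/(ustar _) ustarE; apply/ucls_eqP => e e0.
  apply: filterS (ev [:: a; star a] [::] e e0) => i [F [Z [e' [[sF _ ee [_ _ H _ _]] E]]]].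
  rewrite /= !E ?inE ?eqxx ?orbT//.
  by apply: lt_le_trans (H a _) ee; apply: sF; rewrite !inE eqxx.
have fZ z a : f (z *: a) = z *: f a.
  rewrite -[RHS]/(uscale _ _) uscaleE; apply/ucls_eqP => e e0.
  apply: filterS (ev [:: a; z *: a] [:: z] e e0) => i [F [Z [e' [[sF sZ ee [_ _ _ H _]] E]]]].
  rewrite /= !E ?inE ?eqxx ?orbT//.
  by apply: lt_le_trans (H z a _ _) ee; [apply: sZ|apply: sF]; rewrite !inE eqxx.
have f1 : f 1 = 1.
  apply/ucls_eqP => e e0.
  apply: filterS (ev [:: 1] [::] e e0) => i [F [Z [e' [[sF _ ee [H _ _ _ _]] E]]]].
  by rewrite /= !E ?inE ?eqxx//; exact: lt_le_trans H ee.
have [G GE] := lrmorphism_of fD fZ f1 fM.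
exists I, U, FU, G; split=> [a|a b]; rewrite !GE//.
move=> fab; have fab0 : f (a - b) = 0.
  by rewrite -GE [LHS]raddfB /= !GE fab subrr.
apply/eqP; rewrite -subr_eq0; apply/eqP; move: fab0; set x := a - b => fx.
apply: (@cnorm_small_eq0 _ _ _ 2) => e e0.
move: fx => /ucls_eqP/(_ e e0) fx.
have [i [/= h [F [Z [e' [[sF _ ee [_ _ _ _ H]] E]]]]]] :=
  filter_ex (filterI fx (ev [:: x] [::] e e0)).
have := H x (sF _ (mem_head _ _)); rewrite ltr_norml => /andP[+ _].
by move: h; rewrite subr0 E ?mem_head//; lra.
Qed.

(** The completely positive maps of quasidiagonality, followed by embeddings of matrix algebras, are
    the local embeddings. Their exact compatibility with adjoints comes from positivity. *)
Lemma quasidiagonal_locally_embeds :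
  (forall n, exists g : {lrmorphism 'M[R[i]]_n.+1 -> Q},
    star_preserving g /\ injective g) ->
  quasidiagonal A -> locally_embeds.
Proof.
move=> mxQ qd F Z e e0; have [n [f [f1 fcp fM fN]]] := qd F e e0.
have [g [gs gi]] := mxQ n.
(* [f] preserves adjoints: [2 h] is a combination of elements [star b * b]
   whenever [h] is self-adjoint. *)
have fpos a : star (f (star a * a)) = f (star a * a).
  have [|Y YE] := fcp 1%N (\matrix_(i, j) (star a * a)).
    exists (\matrix_(i, j) a); apply/matrixP => i j.
    by rewrite !mxE big_ord1 !mxE.
  have := congr1 (fun (X : 'M['M[R[i]]_n.+1]_1) => X 0 0) YE.
  rewrite !mxE big_ord1 !mxE => ->.
  by rewrite starM starK.
have dbl (V : lmodType R[i]) (x y : V) : x + x = y + y -> x = y.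
  rewrite -(mulr2n x) -(mulr2n y) -(scaler_nat 2 x) -(scaler_nat 2 y).
  move=> /scalerI; apply.
  by rewrite pnatr_eq0.
have fsa h : star h = h -> star (f h) = f h.
  move=> sh; apply: dbl.
  have fhh : f h + f h = f (h + h) by apply/esym/raddfD.
  rewrite -starD fhh.
  have -> : h + h = star (h + 1) * (h + 1) - star h * h - star 1 * 1.
    have -> : star (h + 1) * (h + 1) = h * h + (h + h) + 1.
      by rewrite starD star1 sh mulrDl mul1r mulrDr mulr1 !addrA.
    by rewrite star1 sh mulr1 addrAC addrK addrC addKr.
  have fB a b : f (a - b) = f a - f b by exact: raddfB.
  by rewrite !fB !starB !fpos.
have fs a : f (star a) = star (f a).
  pose x := a + star a; pose y := 'i%C *: (a - star a).
  have sx : star x = x by rewrite starD starK addrC.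
  have ci : ('i%C : R[i])^*%C = - 'i%C by simpc.
  have sy : star y = y.
    by rewrite starZ starB starK conjE ci scaleNr -scalerN opprB.
  have iy : 'i%C *: y = - (a - star a).
    have ii : 'i%C * 'i%C = -1 :> R[i] by rewrite -expr2 sqr_i.
    by rewrite scalerA ii scaleN1r.
  have aE : a + a = x - 'i%C *: y by rewrite iy opprK addrACA subrr addr0.
  have saE : star a + star a = x + 'i%C *: y.
    by rewrite iy opprB /x [RHS]addrC addrA subrK.
  have fD b c : f (b + c) = f b + f c by exact: raddfD.
  have fiy : f ('i%C *: y) = 'i%C *: f y by exact: linearZ_LR.
  have fB b c : f (b - c) = f b - f c by exact: raddfB.
  apply: dbl; rewrite -starD -!fD saE aE fD fB fiy starB starZ conjE ci.
  by rewrite scaleNr opprK !fsa.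
exists (fun a => g (f a)); split.
- by rewrite f1 (rmorph1 g) subrr cnorm0.
- move=> a b aF bF; split.
    have -> : g (f (a + b)) = g (f a) + g (f b).
      have -> : f (a + b) = f a + f b by exact: raddfD.
      exact: raddfD.
    by rewrite subrr cnorm0.
  have -> : g (f (a * b)) - g (f a) * g (f b) = g (f (a * b) - f a * f b).
    by rewrite -rmorphM; apply/esym/raddfB.
  by rewrite -(opnormE gs gi) fM.
- by move=> a _; rewrite fs gs subrr cnorm0.
- move=> z a _ _; have -> : g (f (z *: a)) = z *: g (f a).
    have -> : f (z *: a) = z *: f a by exact: linearZ_LR.
    exact: linearZ_LR.
  by rewrite subrr cnorm0.
- by move=> a aF; rewrite -(opnormE gs gi) fN.
Qed.

End LocalEmbedding.

(** * Evaluation of terms and formulas *)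

(** Hands a proof of [b] to a continuation: decoding must rebuild the side conditions stored in
    [TScale] and [TIncl]. *)
Definition guarded (b : bool) T : (b -> option T) -> option T :=
  if b is true as b' return (b' -> option T) -> option T
  then fun f => f isT else fun=> None.

Lemma guardedE (b : bool) T (f : b -> option T) (h : b) : guarded f = f h.
Proof. by case: b f h => // f h; rewrite /= (bool_irrelevance h isT). Qed.

Section Terms.
Variable R : realType.

Definition any_term : Type := {k & cterm cst_sort k}.

(** Codes in a countable type make the terms of all sorts enumerable at once. Only the target radius
    of [TScale] and [TIncl] is recorded, since decoding recovers the other radii. *)
Fixpoint term_code k (t : cterm cst_sort k) : GenTree.tree (nat + rat) :=
  match t with
  | TGen g => GenTree.Node 0 [:: GenTree.Leaf (inl g.1); GenTree.Leaf (inl g.2)]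
  | TZero => GenTree.Node 1 [::]
  | TOne => GenTree.Node 2 [::]
  | TAdd _ _ s t => GenTree.Node 3 [:: term_code s; term_code t]
  | TMul _ _ s t => GenTree.Node 4 [:: term_code s; term_code t]
  | TStar _ t => GenTree.Node 5 [:: term_code t]
  | TScale a b _ k _ _ t => GenTree.Node 6
      [:: GenTree.Leaf (inr a); GenTree.Leaf (inr b); GenTree.Leaf (inl k); term_code t]
  | TIncl _ k _ t => GenTree.Node 7 [:: GenTree.Leaf (inl k); term_code t]
  end.

Fixpoint term_decode (c : GenTree.tree (nat + rat)) : option any_term :=
  match c with
  | GenTree.Node 0 [:: GenTree.Leaf (inl a); GenTree.Leaf (inl b)] =>
      Some (existT _ _ (TGen cst_sort (a, b)))
  | GenTree.Node 1 [::] => Some (existT _ _ (TZero cst_sort))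
  | GenTree.Node 2 [::] => Some (existT _ _ (TOne cst_sort))
  | GenTree.Node 3 [:: c; d] =>
      if (term_decode c, term_decode d) is (Some s, Some t) then
        Some (existT _ _ (TAdd (projT2 s) (projT2 t))) else None
  | GenTree.Node 4 [:: c; d] =>
      if (term_decode c, term_decode d) is (Some s, Some t) then
        Some (existT _ _ (TMul (projT2 s) (projT2 t))) else None
  | GenTree.Node 5 [:: c] =>
      if term_decode c is Some t then Some (existT _ _ (TStar (projT2 t))) else None
  | GenTree.Node 6 [:: GenTree.Leaf (inr a); GenTree.Leaf (inr b); GenTree.Leaf (inl k); c] =>
      if term_decode c is Some t then
        guarded (fun h : (a ^+ 2 + b ^+ 2) * (projT1 t)%:R ^+ 2 <= k%:R ^+ 2 =>
        guarded (fun h' : (0 < k)%N => Some (existT _ _ (TScale h h' (projT2 t)))))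
      else None
  | GenTree.Node 7 [:: GenTree.Leaf (inl k); c] =>
      if term_decode c is Some t then
        guarded (fun h : (projT1 t <= k)%N => Some (existT _ _ (TIncl h (projT2 t))))
      else None
  | _ => None
  end.

Lemma term_codeK k (t : cterm cst_sort k) :
  term_decode (term_code t) = Some (existT _ k t).
Proof.
elim: t.
- by case.
- by [].
- by [].
- by move=> j l s /= -> t ->.
- by move=> j l s /= -> t ->.
- by move=> j s /= ->.
- by move=> a b j l h h' s /= ->; rewrite (guardedE _ h) (guardedE _ h').
- by move=> j l h s /= ->; rewrite (guardedE _ h).
Qed.

Lemma enum_terms : exists e : nat -> any_term, forall t, exists n, e n = t.
Proof.
exists (fun n => odflt (existT _ _ (TZero cst_sort)) (obind term_decode (unpickle n))).
move=> [k t]; exists (pickle (term_code t)).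
by rewrite pickleK /= term_codeK.
Qed.

Section Eval.
Variables (A : cstarAlgType R) (c : Defs.cst -> A).

Lemma teval_bound k (t : cterm cst_sort k) : in_balls cst_sort c ->
  cnorm (teval c t) <= k%:R.
Proof.
move=> cb; elim: t => /=.
- by move=> g; exact: cb.
- by rewrite cnorm0.
- by rewrite cnorm1.
- by move=> j l s sj t tl; rewrite natrD (le_trans (ler_cnormD _ _))// lerD.
- move=> j l s sj t tl; rewrite natrM (le_trans (ler_cnormM _ _))//.
  by rewrite ler_pM ?cnorm_ge0.
- by move=> j s sj; rewrite cnorm_star.
- move=> a b j l h _ s sj; rewrite cnormZ /=.
  rewrite (@le_trans _ _ (Num.sqrt (ratr a ^+ 2 + ratr b ^+ 2) * j%:R))//.
    by rewrite ler_wpM2l ?sqrtr_ge0.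
  rewrite -(@ler_pXn2r _ 2) ?nnegrE ?mulr_ge0 ?sqrtr_ge0//.
  rewrite exprMn sqr_sqrtr ?addr_ge0 ?sqr_ge0//.
  by move: h; rewrite -(ler_rat R) rmorphM rmorphD !rmorphXn /= !ratr_nat.
- by move=> j l jl s sj; rewrite (le_trans sj)// ler_nat.
Qed.

Lemma teval_hom (B : cstarAlgType R) (f : {lrmorphism A -> B}) k
    (t : cterm cst_sort k) : star_preserving f ->
  teval (fun x => f (c x)) t = f (teval c t).
Proof.
move=> fs; elim: t => /=.
- by [].
- by rewrite raddf0.
- by rewrite rmorph1.
- by move=> j l s -> t ->; apply/esym/raddfD.
- by move=> j l s -> t ->; apply/esym/rmorphM.
- by move=> j s ->; rewrite fs.
- by move=> a b j l _ _ s ->; apply/esym/linearZ_LR.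
- by [].
Qed.

Lemma qeval_isometry (B : cstarAlgType R) (d : Defs.cst -> B) (phi : qf R cst_sort) :
  (forall k (s t : cterm cst_sort k),
    cnorm (teval d s - teval d t) = cnorm (teval c s - teval c t)) ->
  qeval d phi = qeval c phi.
Proof.
move=> dc; elim: phi => /= [k s t|n f cf a IH]; first exact: dc.
by congr f; apply/matrixP => i j; rewrite !mxE.
Qed.

End Eval.

Lemma qeval_cvg (I : Type) (U : set_system I) (FU : Filter U)
    (A B : cstarAlgType R) (c : I -> Defs.cst -> A) (d : Defs.cst -> B)
    (phi : qf R cst_sort) :
  (forall k (s t : cterm cst_sort k) (e : R), 0 < e -> U [set i |
    `|cnorm (teval (c i) s - teval (c i) t) - cnorm (teval d s - teval d t)| < e]) ->
  forall e, 0 < e -> U [set i | `|qeval (c i) phi - qeval d phi| < e].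
Proof.
move=> H; elim: phi => [k s t|n f cf a IH] e e0; first exact: H.
have /(_ _) := cf (\row_i qeval d (a i)).
move=> /cvgrPdist_lt /(_ e e0) /nbhs_ballP[r r0 Hr].
apply: filterS (@filter_forall _ _ _ _ FU (fun i => IH i r r0)) => j /= Hj.
rewrite distrC; apply: Hr; split=> // i l; rewrite !mxE /ball /= distrC.
exact: Hj.
Qed.

End Terms.

Section Satisfaction.
Variable R : realType.

Definition sat (A : cstarAlgType R) (c : Defs.cst -> A) (p : set (expr R)) :=
  forall e, p e -> qeval c e.1 < e.2.

Lemma filter_finite I T (U : set_system I) (FU : Filter U) (p : set T)
    (P : T -> I -> Prop) :
  finite_set p -> (forall e, p e -> U (P e)) -> U [set i | forall e, p e -> P e i].
Proof.
move=> /(@finite_fsetP {classic T})[X pX] H.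
apply: filterS (@filter_bigI I {classic T} X P U FU _).
  by move=> i Hi e; rewrite pX => /Hi.
by move=> e eX; apply: H; rewrite pX.
Qed.

Lemma sat_near I (U : set_system I) (FU : ProperFilter U)
    (A B : cstarAlgType R) (c : I -> Defs.cst -> A) (d : Defs.cst -> B) p :
  finite_set p -> sat d p ->
  (forall k (s t : cterm cst_sort k) (e : R), 0 < e -> U [set i |
    `|cnorm (teval (c i) s - teval (c i) t) - cnorm (teval d s - teval d t)| < e]) ->
  exists i, sat (c i) p.
Proof.
move=> fp dp H; apply: (@filter_ex _ _ FU).
apply: (@filter_finite _ _ _ _ p (fun e i => qeval (c i) e.1 < e.2)) => // e pe.
have e0 : 0 < e.2 - qeval d e.1 by rewrite subr_gt0 dp.
apply: filterS (@qeval_cvg R I U _ A B c d e.1 H _ e0) => i /=.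
by rewrite ltr_norml => /andP[_]; rewrite ltrD2r.
Qed.

Section Los.
Variables (Q : cstarAlgType R) (I : Type) (U : set_system I) (FU : UltraFilter U).

Let UF : Filter U := @ultra_proper _ _ FU.

Lemma linf_norm_near (f : linfty Q I) e : 0 < e ->
  U [set i | `|cnorm (f i) - linf_norm U f| < e].
Proof.
move=> e0; have h1 : linf_norm U f < linf_norm U f + e by rewrite ltrDl.
have h2 : U [set i | linf_norm U f - e < cnorm (f i)].
  have [//|n2] := in_ultra_setVsetC [set i | linf_norm U f - e < cnorm (f i)] FU.
  have [le0|gt0] := ltP (linf_norm U f - e) 0.
    by apply: filterS n2 => i _ /=; rewrite (lt_le_trans le0)// cnorm_ge0.
  have : linf_norm U f <= linf_norm U f - e.
    apply: linf_norm_le => //; apply: filterS n2 => i /= /negP.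
    by rewrite -leNgt.
  by move=> h; exfalso; lra.
apply: filterS (filterI h2 (linf_norm_lt FU h1)) => i [/= a b].
by rewrite ltr_norml; apply/andP; split; lra.
Qed.

(** An element of norm at most [r] in the ultrapower may have coordinates slightly longer than [r];
    clipping them gives admissible values for constants. *)
Definition clip (r : R) (x : Q) : Q :=
  if cnorm x <= r then x else (r / cnorm x)%:C *: x.

Lemma clip_le r x : 0 <= r -> cnorm (clip r x) <= r.
Proof.
rewrite /clip; case: (leP (cnorm x)) => // rx r0; have x0 := le_lt_trans r0 rx.
rewrite cnormZr ger0_norm ?divr_ge0 ?(ltW x0)//.
by rewrite mulfVK ?gt_eqF.
Qed.

Lemma clip_dist r x e : 0 <= r -> 0 < e -> cnorm x < r + e ->
  cnorm (clip r x - x) < e.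
Proof.
rewrite /clip; case: (leP (cnorm x)) => [_|rx] r0 e0 xe; first by rewrite subrr cnorm0.
have x0 := le_lt_trans r0 rx.
rewrite -{3}(scale1r x) -scalerBl -(rmorph1 (real_complex R)) -(rmorphB (real_complex R)).
rewrite cnormZr ler0_norm; last by rewrite subr_le0 ler_pdivrMr// mul1r ltW.
by rewrite opprB mulrBl mul1r mulfVK ?gt_eqF// ltrBlDl.
Qed.

(** Los's theorem for finitely many strict inequalities: quantifier-free values in the ultrapower
    are limits along [U] of the coordinate values. The embedding preserves the values in [A] because
    it is isometric. *)
Lemma los_realize (A : cstarAlgType R) (c : Defs.cst -> A) p :
  embeds A (ultrapower Q FU) -> in_balls cst_sort c -> finite_set p -> sat c p ->
  exists d : Defs.cst -> Q, in_balls cst_sort d /\ sat d p.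
Proof.
move=> [v [vs vi]] cb fp cp.
pose k (x : Defs.cst) : R := (cst_sort x).+1%:R.
pose d i x : Q := clip (k x) (repr (v (c x)) i).
have db i : in_balls cst_sort (d i) by move=> x; exact: clip_le.
have bnd l (t : cterm cst_sort l) : exists M : R, forall i, cnorm (teval (d i) t) <= M.
  by exists l%:R => i; exact: teval_bound.
pose T l (t : cterm cst_sort l) := ucls FU (Linfty (bnd l t)).
have TE l (t : cterm cst_sort l) : v (teval c t) = T l t.
  rewrite -(teval_hom c t vs); elim: t => /=.
  - move=> g; rewrite -[LHS]reprK; apply/ucls_eqP => e e0 /=.
    have : linf_norm U (repr (v (c g))) < k g + e.
      rewrite -[linf_norm _ _]/(cnorm (v (c g))) (starhom_isometric vs vi).
      by rewrite (le_lt_trans (cb g))// ltrDl.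
    move=> /(linf_norm_lt FU); apply: filterS => i /= h.
    by rewrite cnorm_distC clip_dist ?ler0n.
  - by apply: ucls_ext.
  - by apply: ucls_ext.
  - move=> j l' s -> t ->; rewrite -[LHS]/(uadd _ _) uaddE.
    exact: ucls_ext.
  - move=> j l' s -> t ->; rewrite -[LHS]/(umul _ _) umulE.
    exact: ucls_ext.
  - move=> j s ->; rewrite -[LHS]/(ustar _) ustarE.
    exact: ucls_ext.
  - move=> a b j l' h h' s ->; rewrite -[LHS]/(uscale _ _) uscaleE.
    exact: ucls_ext.
  - by move=> j l' h s ->; exact: ucls_ext.
have [|i Hi] := @sat_near I U _ Q A d c p fp cp; last by exists (d i).
move=> l s t e e0.
have -> : cnorm (teval c s - teval c t) =
    linf_norm U (linf_add (Linfty (bnd l s)) (linf_opp (Linfty (bnd l t)))).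
  rewrite -(starhom_isometric vs vi).
  have -> : v (teval c s - teval c t) = v (teval c s) - v (teval c t) by exact: raddfB.
  rewrite !TE -[LHS]/(unorm _) -[_ - _]/(uadd _ (uopp _)) uoppE uaddE.
  exact: unormE.
exact: (linf_norm_near (linf_add (Linfty (bnd l s)) (linf_opp (Linfty (bnd l t)))) e0).
Qed.

End Los.
End Satisfaction.

(** * Imposing properties by conditions *)

Lemma rat_approx (R : realType) (x e : R) : 0 < e -> exists q : rat, `|x - ratr q| < e.
Proof.
move=> e0; have xe : x < x + e by rewrite ltrDl.
have [q] := rat_in_itvoo xe; rewrite in_itv /= => /andP[h1 h2].
by exists q; rewrite distrC ger0_norm ?subr_ge0 ?(ltW h1)// ltrBlDl.
Qed.

Section Impose.
Variables (R : realType) (F : connectives R).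
Hypothesis hF : admissible F.

Lemma generated_formula n (g : 'rV[R]_n -> R) (a : 'I_n -> qf R cst_sort) :
  generated F g -> (forall i, restricted F (a i)) ->
  exists2 psi : qf R cst_sort, restricted F psi &
    forall (A : cstarAlgType R) (c : Defs.cst -> A),
      qeval c psi = g (\row_i qeval c (a i)).
Proof.
move=> gg ra; elim: gg => [i|m f h Fmf _ IH].
  by exists (a i) => // A c; rewrite mxE.
have H i : exists psi : qf R cst_sort, restricted F psi /\
    forall (A : cstarAlgType R) (c : Defs.cst -> A),
      qeval c psi = h i (\row_i qeval c (a i)).
  by have [psi rpsi psiE] := IH i; exists psi.
have [psi Hpsi] := choice H.
have [_ /(_ m f Fmf) cf _] := hF.
exists (Conn cf psi) => [|A c] /=; first by split=> // i; case: (Hpsi i).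
by congr f; apply/matrixP => i j; rewrite !mxE; case: (Hpsi j) => _ ->.
Qed.

(** Leaves the sort existential, since every algebraic operation changes it. *)
Definition representable (T : forall M : cstarAlgType R, (Defs.cst -> M) -> M) :=
  exists k (t : cterm cst_sort k), forall M c, teval c t = T M c.

Lemma representable_gen x : representable (fun M c => c x).
Proof. by exists _, (TGen cst_sort x). Qed.

Lemma representable0 : representable (fun M c => 0).
Proof. by exists _, (TZero cst_sort). Qed.

Lemma representable1 : representable (fun M c => 1).
Proof. by exists _, (TOne cst_sort). Qed.

Lemma representableD S T : representable S -> representable T ->
  representable (fun M c => S M c + T M c).
Proof.
move=> [j [s sS]] [k [t tT]]; exists _, (TAdd s t) => M c.
by rewrite /= sS tT.
Qed.

Lemma representableM S T : representable S -> representable T ->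
  representable (fun M c => S M c * T M c).
Proof.
move=> [j [s sS]] [k [t tT]]; exists _, (TMul s t) => M c.
by rewrite /= sS tT.
Qed.

Lemma representable_star T : representable T ->
  representable (fun M c => star (T M c)).
Proof. by move=> [k [t tT]]; exists _, (TStar t) => M c; rewrite /= tT. Qed.

Lemma representable_scale (a b : rat) T : representable T ->
  representable (fun M c => (ratr a +i* ratr b) *: T M c).
Proof.
move=> [j [t tT]]; set x : rat := (a ^+ 2 + b ^+ 2) * j%:R ^+ 2.
have x0 : 0 <= x by rewrite mulr_ge0 ?sqr_ge0// addr_ge0 ?sqr_ge0.
pose k := (Num.bound x).+1.
have kx : x <= k%:R ^+ 2.
  have := archi_boundP x0 => /ltW /le_trans; apply.
  rewrite -natrX ler_nat /k (leq_trans (leqnSn _))// expnS expn1.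
  by rewrite leq_pmulr.
exists k, (TScale kx (ltn0Sn _) t) => M c.
by rewrite /= tT.
Qed.

Lemma representable_sum I (s : seq I) T : (forall i, representable (T i)) ->
  representable (fun M c => \sum_(i <- s) T i M c).
Proof.
move=> rT; elim: s => [|i s [k [t IH]]].
  by have [k [t tE]] := representable0; exists k, t => M c; rewrite tE big_nil.
have [l [u uE]] := representableD (rT i) (ex_intro _ k (ex_intro _ t (fun M c => erefl))).
by exists l, u => M c; rewrite uE big_cons -IH.
Qed.

Lemma representable_dist S T : representable S -> representable T ->
  exists (psi : qf R cst_sort) (B : R), restricted F psi /\
    forall (M : cstarAlgType R) (c : Defs.cst -> M), in_balls cst_sort c ->
    qeval c psi = cnorm (S M c - T M c) /\ cnorm (S M c - T M c) <= B.
Proof.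
move=> [j [s sS]] [k [t tT]].
exists (Dist R (TIncl (leq_maxl j k) s) (TIncl (leq_maxr j k) t)), (j%:R + k%:R).
split=> // M c cb /=; rewrite sS tT; split=> //.
rewrite (le_trans (ler_cnormB _ _))// -sS -tT lerD//; exact: teval_bound.
Qed.

(* Some finite set of restricted conditions, true under [c], entails [C]. *)
Definition imposable (A : cstarAlgType R) (c : Defs.cst -> A)
    (C : forall M : cstarAlgType R, (Defs.cst -> M) -> Prop) :=
  exists p : set (expr R), [/\ finite_set p, forall e, p e -> restricted F e.1,
    sat c p & forall (M : cstarAlgType R) (d : Defs.cst -> M),
      in_balls cst_sort d -> sat d p -> C M d].

Section ImposableAt.
Variables (A : cstarAlgType R) (c : Defs.cst -> A).
Hypothesis cb : in_balls cst_sort c.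

Lemma imposable_mono (C D : forall M : cstarAlgType R, (Defs.cst -> M) -> Prop) :
  (forall M d, in_balls cst_sort d -> C M d -> D M d) ->
  imposable c C -> imposable c D.
Proof.
move=> CD [p [fp rp cp pC]]; exists p; split=> // M d db dp.
by apply: CD => //; exact: pC.
Qed.

Lemma imposableT (C : forall M : cstarAlgType R, (Defs.cst -> M) -> Prop) :
  (forall M d, in_balls cst_sort d -> C M d) -> imposable c C.
Proof.
move=> CT; exists set0; split=> [|e []|e []|M d db _]; last exact: CT.
exact: finite_set0.
Qed.

Lemma imposableI (C D : forall M : cstarAlgType R, (Defs.cst -> M) -> Prop) :
  imposable c C -> imposable c D -> imposable c (fun M d => C M d /\ D M d).
Proof.
move=> [p [fp rp cp pC]] [q [fq rq cq qD]]; exists (p `|` q); split.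
- by rewrite finite_setU.
- by move=> e [/rp|/rq].
- by move=> e [/cp|/cq].
- move=> M d db dpq; split; [apply: pC|apply: qD] => // e pe.
    by apply: dpq; left.
  by apply: dpq; right.
Qed.

Lemma imposable_seq (T : eqType) (s : seq T)
    (C : T -> forall M : cstarAlgType R, (Defs.cst -> M) -> Prop) :
  (forall x, x \in s -> imposable c (C x)) ->
  imposable c (fun M d => forall x, x \in s -> C x M d).
Proof.
elim: s => [|x s IH] H; first by apply: imposableT.
have H1 := H x (mem_head _ _).
have H2 : imposable c (fun M d => forall x, x \in s -> C x M d).
  by apply: IH => y ys; apply: H; rewrite inE ys orbT.
apply: imposable_mono (imposableI H1 H2) => M d _ [Cx Cs] y.
by rewrite inE => /predU1P[->|/Cs].
Qed.

Lemma imposable_fin (I : finType)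
    (C : I -> forall M : cstarAlgType R, (Defs.cst -> M) -> Prop) :
  (forall i, imposable c (C i)) -> imposable c (fun M d => forall i, C i M d).
Proof.
move=> H; apply: imposable_mono (@imposable_seq _ (enum I) C _) => // M d _ Ci i.
by apply: Ci; rewrite mem_enum.
Qed.

Lemma imposable_dist_lt S T r : representable S -> representable T ->
  cnorm (S A c - T A c) < r -> imposable c (fun M d => cnorm (S M d - T M d) < r).
Proof.
move=> rS rT lt; have [psi [B [rpsi psiE]]] := representable_dist rS rT.
exists [set (psi, r)]; split.
- exact: finite_set1.
- by move=> _ ->.
- by move=> _ -> /=; rewrite (psiE A c cb).1.
- by move=> M d db /(_ _ erefl) /=; rewrite (psiE M d db).1.
Qed.

(* Conditions only bound formulas from above, so a restricted approximation of the
   connective [- x] is needed. *)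
Lemma imposable_dist_gt S T r : representable S -> representable T ->
  r < cnorm (S A c - T A c) -> imposable c (fun M d => r < cnorm (S M d - T M d)).
Proof.
move=> rS rT lt; have [psi [B [rpsi psiE]]] := representable_dist rS rT.
pose f (x : 'rV[R]_1) : R := - x 0 0.
have cf : continuous f.
  by move=> x; apply: continuousN; exact: coord_continuous.
(* The gap is [3 * e] and [chi] is within [e] of minus the distance. So [chi < - r - e] holds at
   [c], and it forces the distance above [r] wherever it holds. *)
pose e := (cnorm (S A c - T A c) - r) / 3.
have e0 : 0 < e by rewrite divr_gt0 ?subr_gt0.
have [_ _ /(_ 0%N f cf B e e0)[g [gg gf]]] := hF.
have [chi rchi chiE] := @generated_formula _ _ (fun=> psi) gg (fun=> rpsi).
have chiB (M : cstarAlgType R) (d : Defs.cst -> M) : in_balls cst_sort d ->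
    `|- cnorm (S M d - T M d) - qeval d chi| < e.
  move=> db; have [E le] := psiE M d db; rewrite chiE.
  have := gf (\row_i qeval d psi); rewrite /f mxE E; apply => i.
  by rewrite mxE ger0_norm ?cnorm_ge0.
exists [set (chi, - r - e)]; split.
- exact: finite_set1.
- by move=> _ ->.
- move=> _ -> /=; have := chiB A c cb; rewrite ltr_norml => /andP[h1 h2].
  rewrite /e in h1 h2 *; lra.
- move=> M d db /(_ _ erefl) /= h; have := chiB M d db.
  rewrite ltr_norml => /andP[h1 h2]; lra.
Qed.

Lemma imposable_dist S T e : representable S -> representable T -> 0 < e ->
  imposable c (fun M d =>
    `|cnorm (S M d - T M d) - cnorm (S A c - T A c)| < e).
Proof.
move=> rS rT e0; set r := cnorm (S A c - T A c).
have h1 := @imposable_dist_lt _ _ (r + e) rS rT.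
have h2 := @imposable_dist_gt _ _ (r - e) rS rT.
rewrite -/r ltrDl in h1; rewrite -/r gtrBl in h2.
apply: imposable_mono (imposableI (h1 e0) (h2 e0)) => M d _ [lt gt].
by rewrite ltr_norml; apply/andP; split; lra.
Qed.

End ImposableAt.

End Impose.

(** * From enforceability to embeddability *)

Section Realization.
Variables (R : realType) (F : connectives R) (Q : cstarAlgType R).

Lemma compiled_separable p (A : cstarAlgType R) (c : Defs.cst -> A) :
  compiled p c -> separable A.
Proof.
move=> [_ _ cd]; have [t Ht] := enum_terms.
exists (fun n => teval c (projT2 (t n))) => x e e0.
have [k [s xs]] := cd x e e0.
by have [n tn] := Ht (existT _ k s); exists n; rewrite tn.
Qed.

(** Without a model every real would be entailed vacuously, against uniqueness. *)
Lemma definitive_model p : definitive p ->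
  exists (M : cstarAlgType R) (c : Defs.cst -> M), models c p.
Proof.
move=> dp; have [r [rE runiq]] := dp _ (TZero cst_sort) (TZero cst_sort).
have [//|nM] := pselect (exists (M : cstarAlgType R) (c : Defs.cst -> M), models c p).
have : r = r + 1.
  by apply: (runiq (r + 1)) => M c cM; case: nM; exists M, c.
by move/eqP; rewrite eq_sym -subr_eq0 addrAC subrr add0r oner_eq0.
Qed.

(** Quantifier-free values depend only on distances of terms, and these agree in the compiled
    structure and in any model of [p]. *)
Lemma compiled_sat p (A : cstarAlgType R) (c : Defs.cst -> A) :
  definitive p -> compiled p c -> sat c p.
Proof.
move=> dp [_ cE _] e pe; have [M [d [sM db dM]]] := definitive_model dp.
rewrite -(@qeval_isometry _ _ c _ d); first exact: dM.
by move=> k s t; apply: (cE k s t M d).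
Qed.

Lemma play_from S p : legal_strategy F S -> condition F p ->
  exists2 q, play F S q & q 0%N = p.
Proof.
move=> lS cp.
pose h := fix h n := if n is n.+1 then
  rcons (h n) (if odd n.+1 then S (h n) else last set0 (h n)) else [:: p].
pose q n := last set0 (h n).
have hE n : h n = mkseq q n.+1.
  elim: n => // n IH.
  have -> : mkseq q n.+2 = rcons (mkseq q n.+1) (q n.+1).
    by rewrite /mkseq -[n.+2]addn1 iotaD map_cat cats1.
  by rewrite -IH /q [h n.+1]/= last_rcons.
have hr n : h n = rcons (mkseq q n) (q n).
  by rewrite hE /mkseq -[n.+1]addn1 iotaD map_cat cats1.
have qS n : q n.+1 = if odd n.+1 then S (h n) else q n.
  by rewrite {1}/q [h n.+1]/= last_rcons.
have cq n : condition F (q n).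
  elim: n => // n IH; rewrite qS; case: ifP => // _.
  by rewrite hr; case: (lS (mkseq q n) (q n) IH).
exists q => //; split=> [//|i|i].
- rewrite qS; case: ifP => _; last by move=> e.
  by rewrite hr; case: (lS (mkseq q i) (q i) (cq i)).
- by rewrite qS /= odd_double /= hE.
Qed.

Lemma enforceable_realized (P : cstarAlgType R -> Prop) :
  (forall A, separable A -> P A -> ultra_embeds Q A) -> enforceable F P ->
  forall p, condition F p ->
    exists d : Defs.cst -> Q, in_balls cst_sort d /\ sat d p.
Proof.
move=> PQ [S lS HS] p cp; have [q qS q0] := play_from lS cp.
have [dq [A [c [cA PA]]]] := HS q qS.
have [I [U [FU AQ]]] := PQ A (compiled_separable cA) PA.
have cb : in_balls cst_sort c by case: cA.
apply: (los_realize AQ cb); first by case: cp.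
by move=> e pe; apply: (compiled_sat dq cA); exists 0%N => //; rewrite q0.
Qed.

Hypothesis hF : admissible F.

Lemma complex_rat_approx (z : R[i]) (e : R) : 0 < e -> exists a b : rat,
  Normc.normc (z - (ratr a +i* ratr b)) < e.
Proof.
move=> e0; have e2 : 0 < e / 2 by rewrite divr_gt0.
have [a Ha] := rat_approx (complex.Re z) e2.
have [b Hb] := rat_approx (complex.Im z) e2.
exists a, b; rewrite (le_lt_trans (normc_ReIm _))//.
by case: z Ha Hb => x y /= Ha Hb; rewrite (splitr e) ltrD.
Qed.

Lemma realized_MF :
  (forall p, condition F p ->
    exists d : Defs.cst -> Q, in_balls cst_sort d /\ sat d p) ->
  MF_problem_positive Q.
Proof.
move=> realized A sA; apply: locally_embeds_ultra => L Z e e0.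
have e2 : 0 < e / 2 by rewrite divr_gt0.
pose s : seq A := 1 :: L ++ [seq a + b | a <- L, b <- L] ++
  [seq a * b | a <- L, b <- L] ++ [seq star a | a <- L] ++
  [seq z *: a | z <- Z, a <- L].
(* The constant naming [a]: the first index makes its ball large enough, the second is the position
   of [a] in [s]. Constants that cannot hold their entry of [s] are sent to 0 by [c]. *)
pose x (a : A) : Defs.cst := (Num.bound (cnorm a), index a s).
pose c (y : Defs.cst) : A :=
  if cnorm s`_y.2 <= (cst_sort y).+1%:R then s`_y.2 else 0.
have cb : in_balls cst_sort c.
  by move=> y; rewrite /c; case: ifP => // _; rewrite cnorm0.
have cx a : a \in s -> c (x a) = a.
  move=> sa; rewrite /c /x /= nth_index// ifT//.
  have := archi_boundP (cnorm_ge0 a) => /ltW /le_trans; apply.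
  by rewrite ler_nat leqnSn.
have rx a : representable (fun (M : cstarAlgType R) d => d (x a)).
  exact: representable_gen.
have Ls a : a \in L -> a \in s by move=> aL; rewrite inE mem_cat aL !orbT.
have Ds a b : a \in L -> b \in L -> a + b \in s.
  move=> aL bL; rewrite inE !mem_cat; apply/orP; right; apply/orP; right.
  by apply/orP; left; apply/allpairsP; exists (a, b).
have Ms a b : a \in L -> b \in L -> a * b \in s.
  move=> aL bL; rewrite inE !mem_cat; apply/orP; right; apply/orP; right.
  by apply/orP; right; apply/orP; left; apply/allpairsP; exists (a, b).
have Ss a : a \in L -> star a \in s.
  by move=> aL; rewrite inE !mem_cat (map_f star aL) !orbT.
have Zs z a : z \in Z -> a \in L -> z *: a \in s.
  move=> zZ aL; rewrite inE !mem_cat; do 5 (apply/orP; right).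
  by apply/allpairsP; exists (z, a).
have i1 : imposable F c (fun M d => cnorm (d (x 1) - 1) < e).
  apply: (imposable_dist_lt F cb (rx 1) (representable1 R)).
  by rewrite cx ?mem_head// subrr cnorm0.
have i2 : imposable F c (fun M d => forall a, a \in L -> forall b, b \in L ->
    cnorm (d (x (a + b)) - (d (x a) + d (x b))) < e /\
    cnorm (d (x (a * b)) - d (x a) * d (x b)) < e).
  apply: imposable_seq => a aL; apply: imposable_seq => b bL.
  apply: imposableI.
    apply: (imposable_dist_lt F cb (rx _) (representableD (rx a) (rx b))).
    by rewrite !cx ?Ds ?Ls// subrr cnorm0.
  apply: (imposable_dist_lt F cb (rx _) (representableM (rx a) (rx b))).
  by rewrite !cx ?Ms ?Ls// subrr cnorm0.
have i3 : imposable F c (fun M d => forall a, a \in L ->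
    cnorm (d (x (star a)) - star (d (x a))) < e).
  apply: imposable_seq => a aL.
  apply: (imposable_dist_lt F cb (rx _) (representable_star (rx a))).
  by rewrite !cx ?Ss ?Ls// subrr cnorm0.
have i4 : imposable F c (fun M d => forall z, z \in Z -> forall a, a \in L ->
    cnorm (d (x (z *: a)) - z *: d (x a)) < e).
  apply: imposable_seq => z zZ; apply: imposable_seq => a aL.
  pose B : R := (cst_sort (x a)).+1%:R; have B0 : 0 < B by rewrite ltr0n.
  (* Terms only have scalars with rational parts; on the ball of radius [B] the replacement of [z]
     costs at most [e / 2], in [A] and in any other model. *)
  have [p [q pq]] := complex_rat_approx z (divr_gt0 e2 B0).
  have zB (M : cstarAlgType R) (d : Defs.cst -> M) : in_balls cst_sort d ->
      cnorm (z *: d (x a) - (ratr p +i* ratr q) *: d (x a)) < e / 2.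
    move=> db; rewrite -scalerBl cnormZ.
    rewrite (@le_lt_trans _ _ (Normc.normc (z - (ratr p +i* ratr q)) * B))//.
      by rewrite ler_wpM2l ?normc_ge0//; exact: db.
    by rewrite -ltr_pdivlMr.
  have : imposable F c (fun M d =>
      cnorm (d (x (z *: a)) - (ratr p +i* ratr q) *: d (x a)) < e / 2).
    apply: (imposable_dist_lt F cb (rx _) (representable_scale p q (rx a))).
    by have := zB A c cb; rewrite !cx ?Zs ?Ls.
  apply: imposable_mono => M d db h.
  rewrite (le_lt_trans (cnorm_dist_trans ((ratr p +i* ratr q) *: d (x a)) _ _))//.
  by rewrite (splitr e) ltrD// cnorm_distC zB.
have i5 : imposable F c (fun M d => forall a, a \in L ->
    `|cnorm (d (x a) - 0) - cnorm (a - 0)| < e).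
  apply: imposable_seq => a aL.
  have := imposable_dist hF cb (rx a) (representable0 R) e0.
  by rewrite cx ?Ls.
have [p [fp rp cp pC]] := imposableI i1 (imposableI i2 (imposableI i3 (imposableI i4 i5))).
have [|d [db dp]] := realized p.
  by split=> //; exists A, c; split.
have [h1 [h2 [h3 [h4 h5]]]] := pC Q d db dp.
exists (fun a => d (x a)); split => //.
- by move=> a b aL bL; exact: h2.
- by move=> z a zZ aL; exact: h4.
- by move=> a aL; have := h5 a aL; rewrite !subr0.
Qed.

End Realization.

(** * Approximate matrix units are conjugate to exact ones *)

Section UltraClass.
Variables (R : realType) (Q : cstarAlgType R) (I : Type) (U : set_system I).
Variable FU : UltraFilter U.
Implicit Types s t : I -> Q.

Definition bounded s := exists M : R, forall i, cnorm (s i) <= M.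

(** A total version of the class map, 0 on unbounded sequences, so that expressions need not carry
    boundedness proofs. *)
Definition ucl s : ultrapower Q FU :=
  if pselect (bounded s) is left b then ucls FU (Linfty b) else 0.

Lemma uclE s (b : bounded s) : ucl s = ucls FU (Linfty b).
Proof. by rewrite /ucl; case: pselect => // b'; exact: ucls_ext. Qed.

Lemma bounded_cst x : bounded (fun=> x).
Proof. by exists (cnorm x). Qed.

Lemma boundedD s t : bounded s -> bounded t -> bounded (fun i => s i + t i).
Proof.
move=> [M HM] [N HN]; exists (M + N) => i.
by rewrite (le_trans (ler_cnormD _ _))// lerD.
Qed.

Lemma boundedM s t : bounded s -> bounded t -> bounded (fun i => s i * t i).
Proof.
move=> [M HM] [N HN]; exists (M * N) => i.
by rewrite (le_trans (ler_cnormM _ _))// ler_pM ?cnorm_ge0.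
Qed.

Lemma boundedZ z s : bounded s -> bounded (fun i => z *: s i).
Proof.
move=> [M HM]; exists (Normc.normc z * M) => i.
by rewrite cnormZ ler_wpM2l ?normc_ge0.
Qed.

Lemma bounded_star s : bounded s -> bounded (fun i => star (s i)).
Proof. by move=> [M HM]; exists M => i; rewrite cnorm_star. Qed.

Lemma ucl_eqP s t : bounded s -> bounded t -> ucl s = ucl t <->
  forall e : R, 0 < e -> U [set i | cnorm (s i - t i) < e].
Proof. by move=> bs bt; rewrite (uclE bs) (uclE bt) ucls_eqP. Qed.

Lemma ucl_cst x : ucl (fun=> x) = ucls FU (linf_cst I x).
Proof. by rewrite (uclE (bounded_cst x)); exact: ucls_ext. Qed.

Lemma ucl1 : ucl (fun=> 1) = 1.
Proof. exact: ucl_cst. Qed.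

Lemma uclD s t : bounded s -> bounded t -> ucl (fun i => s i + t i) = ucl s + ucl t.
Proof.
move=> bs bt; rewrite (uclE bs) (uclE bt) (uclE (boundedD bs bt)).
by rewrite -[RHS]/(uadd _ _) uaddE; exact: ucls_ext.
Qed.

Lemma uclM s t : bounded s -> bounded t -> ucl (fun i => s i * t i) = ucl s * ucl t.
Proof.
move=> bs bt; rewrite (uclE bs) (uclE bt) (uclE (boundedM bs bt)).
by rewrite -[RHS]/(umul _ _) umulE; exact: ucls_ext.
Qed.

Lemma uclZ z s : bounded s -> ucl (fun i => z *: s i) = z *: ucl s.
Proof.
move=> bs; rewrite (uclE bs) (uclE (boundedZ z bs)).
by rewrite -[RHS]/(uscale _ _) uscaleE; exact: ucls_ext.
Qed.

Lemma ucl_star s : bounded s -> ucl (fun i => star (s i)) = star (ucl s).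
Proof.
move=> bs; rewrite (uclE bs) (uclE (bounded_star bs)).
by rewrite -[RHS]/(ustar _) ustarE; exact: ucls_ext.
Qed.

Lemma ucl_sum (J : Type) (r : seq J) (s : J -> I -> Q) :
  (forall j, bounded (s j)) -> bounded (fun i => \sum_(j <- r) s j i) /\
  ucl (fun i => \sum_(j <- r) s j i) = \sum_(j <- r) ucl (s j).
Proof.
move=> bs; elim: r => [|j r [IHb IH]].
  have -> : (fun i => \sum_(j <- [::]) s j i) = fun=> 0.
    by apply/funext => i; rewrite big_nil.
  by rewrite big_nil; split; [exact: bounded_cst|exact: ucl_cst].
have -> : (fun i => \sum_(j <- j :: r) s j i) =
    fun i => s j i + \sum_(j <- r) s j i.
  by apply/funext => i; rewrite big_cons.
by rewrite big_cons -IH -uclD//; split=> //; exact: boundedD.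
Qed.

End UltraClass.

Section Homogeneity.
Variables (R : realType) (Q : cstarAlgType R) (k : nat -> nat).
Variable f : forall n, {lrmorphism 'M[R[i]]_((k n).+1) -> Q}.
Hypothesis fstar : forall n, star_preserving (f n).
Hypothesis finj : forall n, injective (f n).
Hypothesis fsub : forall n, range (f n) `<=` range (f n.+1).
Hypothesis fdense : forall x (e : R), 0 < e -> exists n X, cnorm (x - f n X) < e.
Variable n : nat.

Let K := k n.
Let e (a b : 'I_K.+1) : Q := f n (delta_mx a b).

Let eU : matrix_units e.
Proof. exact: (matrix_units_morph (@fstar n) (matrix_units_delta R K)). Qed.

Let half (x : Q) : Q := (2^-1)%:C *: (x + star x).

(* [q] is a projection near [x_00], and the rank of [q] is at least that of [e_00]
   because [\sum_a x_a0 q x_a0^*] is invertible. *)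
Lemma approx_partial_isometry (D : 'I_K.+1 -> 'I_K.+1 -> Q) d : 0 < d ->
  exists x q w, [/\ forall a b, cnorm (D a b - x a b) < d,
    star q * q = q,
    cnorm (q - half (x ord0 ord0)) <=
      2 * cnorm (half (x ord0 ord0) * half (x ord0 ord0) - half (x ord0 ord0)),
    cnorm w <= 1
  & cnorm (\sum_a x a ord0 * q * star (x a ord0) - 1) < 1 ->
    star w * w = e ord0 ord0 /\ q * w = w].
Proof.
move=> d0.
have [m nm [X0 HX]] := tower_approx fsub fdense
  (fun p : 'I_K.+1 * 'I_K.+1 => D p.1 p.2) n d0.
pose X a b := X0 (a, b); pose L := k m.
pose h : 'M[R[i]]_L.+1 := (2^-1)%:C *: (X ord0 ord0 + star (X ord0 ord0)).
have fh : f m h = half (f m (X ord0 ord0)).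
  rewrite /half -fstar; have -> : f m (X ord0 ord0) + f m (star (X ord0 ord0)) =
    f m (X ord0 ord0 + star (X ord0 ord0)) by apply/esym/raddfD.
  exact: linearZ_LR.
have sh : star h = h.
  by rewrite starZ starD starK conjE conjc_real addrC.
have [V [P [VV VV' hP]]] := near_projection (@fstar m) (@finj m) sh.
set q := _ * V in hP; have qE : q = star V * pdiag R P * V by [].
have sq : star q = q by rewrite /q !starM starK star_rdiag mulrA.
have qq : q * q = q.
  rewrite /q unitary_conjM// rdiagM; congr (_ * rdiag _ * _); apply/funext => i.
  by case: (P i); rewrite ?mulr1 ?mulr0.
have [G [GM Gs G1] GE] := tower_units fstar finj fsub nm.
have GU : matrix_units G by split.
have fM Y Z : f m (Y * Z) = f m Y * f m Z by exact: rmorphM.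
have [W [P' [WW WW' G0E]]] : exists W P', [/\ star W * W = 1, W * star W = 1 &
    G ord0 ord0 = star W * pdiag R P' * W].
  by apply: pdiag_spectral; rewrite ?Gs// GM eqxx scale1r.
have cardP' : (K.+1 * #|P'| = L.+1)%N.
  have := mxtrace_units ord0 ord0 GU; rewrite G0E mxtrace_pdiag// eqxx mul1r.
  move=> /(congr1 (fun z => K.+1%:R * z)); rewrite mulrCA divff ?pnatr_eq0// mulr1.
  by rewrite -natrM => /eqP; rewrite eqr_nat => /eqP.
have e0 : e ord0 ord0 = f m (G ord0 ord0) by rewrite GE.
have [PP|PP] := leqP #|P'| #|P|.
  have [w [ww qw]] := @partial_isometry R L V W P' P VV' WW' PP.
  exists (fun a b => f m (X a b)), (f m q), (f m w); split.
  - by move=> a b; exact: (HX (a, b)).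
  - by rewrite -fstar -fM sq qq.
  - rewrite -fh; have -> : f m h * f m h - f m h = f m (h * h - h).
      by rewrite -fM; apply/esym/raddfB.
    have -> : f m q - f m h = f m (q - h) by apply/esym/raddfB.
    exact: hP.
  - have w1 : cnorm (f m w) ^+ 2 = 1.
      rewrite -cnorm_starM -fstar -fM ww -G0E -e0 cnorm_proj//.
        have [eM es _] := eU; by rewrite es eM eqxx scale1r.
      by rewrite (morph_eq0 (@finj n)) delta_neq0.
    by rewrite -(@ler_pXn2r _ 2) ?nnegrE ?cnorm_ge0// w1 expr1n.
  - by move=> _; rewrite -fstar -!fM ww -G0E e0 qw.
(* Here [q] has too small a rank, [w = 0] is a dummy, and the premise of the last clause fails: it
   would make [S] invertible, whereas its rank is at most [K.+1 * #|P| < K.+1 * #|P'| = L.+1]. *)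
exists (fun a b => f m (X a b)), (f m q), 0; split.
- by move=> a b; exact: (HX (a, b)).
- by rewrite -fstar -fM sq qq.
- rewrite -fh; have -> : f m h * f m h - f m h = f m (h * h - h).
    by rewrite -fM; apply/esym/raddfB.
  have -> : f m q - f m h = f m (q - h) by apply/esym/raddfB.
  exact: hP.
- by rewrite cnorm0.
- pose S := \sum_a X a ord0 * q * star (X a ord0).
  have -> : \sum_a f m (X a ord0) * f m q * star (f m (X a ord0)) - 1 = f m (S - 1).
    have -> : f m (S - 1) = f m S - 1 by rewrite -(rmorph1 (f m)); exact: raddfB.
    congr (_ - _); rewrite /S [RHS]raddf_sum; apply: eq_bigr => a _.
    by rewrite -fstar -!fM.
  move=> S1; exfalso.
  have Su : S \in unitmx.
    rewrite -row_free_unit -kermx_eq0; apply/eqP.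
    set Z := kermx S; have ZS : Z * S = 0 by exact: mulmx_ker.
    have fZ : f m Z = - (f m Z * f m (S - 1)).
      by rewrite -fM mulrBr ZS mulr1 sub0r -[RHS]raddfN opprK.
    apply/eqP; rewrite -(morph_eq0 (@finj m)) -cnorm_eq0 -[_ == 0]negbK.
    apply/negP => Z0.
    have := ler_cnormM (f m Z) (f m (S - 1)); rewrite -cnormN -fZ.
    have : 0 < cnorm (f m Z) by rewrite lt_neqAle cnorm_ge0 eq_sym Z0.
    by nra.
  have : (\rank S <= K.+1 * #|P|)%N.
    rewrite /S (leq_trans (mxrank_sum_le _ _ _))//.
    rewrite -[K.+1 in leqRHS]card_ord -sum_nat_const leq_sum// => a _.
    rewrite (leq_trans (mxrankM_maxl _ _))// (leq_trans (mxrankM_maxr _ _))//.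
    exact: mxrank_pdiag.
  rewrite (mxrank_unit Su) => /(leq_trans (eq_leq cardP')).
  by rewrite leq_pmul2l// leqNgt PP.
Qed.

Definition approx_units d (D : 'I_K.+1 -> 'I_K.+1 -> Q) :=
  [/\ forall a b, cnorm (D a b) <= 1,
      forall a b b' c, cnorm (D a b * D b' c - (b == b')%:R *: D a c) < d,
      forall a b, cnorm (star (D a b) - D b a) < d
    & cnorm (\sum_a D a a - 1) < d].

Variables (U : set_system nat) (FU : UltraFilter U).
Hypothesis Unp : forall j, ~ U [set j].

Let UF : Filter U := @ultra_proper _ _ FU.

Lemma nonprincipal_tail N : U [set j | (N <= j)%N].
Proof.
elim: N => [|N IH]; first by apply: filterS filterT.
have [/Unp //|UN] := in_ultra_setVsetC [set N] FU.
apply: filterS (filterI IH UN) => j [/= Nj jN].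
by rewrite ltn_neqAle Nj andbT; apply/eqP => jE; exact: jN.
Qed.

Lemma nonprincipal_small (r : R) : 0 < r -> U [set j | (j.+1%:R^-1 : R) < r].
Proof.
move=> r0; have N0 : 0 <= r^-1 by rewrite invr_ge0 ltW.
apply: filterS (nonprincipal_tail (Num.bound r^-1)) => j /= Nj.
rewrite -(invrK r) ltf_pV2 ?posrE ?invr_gt0 ?ltr0n//.
by rewrite (lt_le_trans (archi_boundP N0))// ler_nat (leq_trans Nj).
Qed.

Lemma stably_finite_finite (B : cstarAlgType R) (u : B) : stably_finite B ->
  star u * u = 1 -> u * star u = 1.
Proof.
move=> sB uu; pose v : 'M[B]_1 := \matrix_(i, j) u.
have /sB : star_mx v *m v = 1%:M.
  by apply/matrixP => i j; rewrite !mxE big_ord1 !mxE uu !ord1.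
by move=> /matrixP /(_ ord0 ord0); rewrite !mxE big_ord1 !mxE.
Qed.

(* If no [d] worked for [eta], counterexamples with [d = 1 / (j + 1)] would define
   exact matrix units in the ultrapower, and [W] below would be unitary there. *)
Lemma approx_units_conj eta : 0 < eta -> exists2 d, 0 < d &
  forall D, approx_units d D -> exists u, [/\ star u * u = 1, u * star u = 1 &
    forall a b, cnorm (star u * D a b * u - e a b) < eta].
Proof.
move=> eta0; apply: contrapT => H.
have bad j : exists D, approx_units j.+1%:R^-1 D /\ forall u,
    star u * u = 1 -> u * star u = 1 ->
    exists a b, eta <= cnorm (star u * D a b * u - e a b).
  apply: contrapT => nj; apply: H; exists j.+1%:R^-1; first by rewrite invr_gt0.
  move=> D DU; apply: contrapT => nu; apply: nj; exists D; split=> // u uu uu'.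
  apply: contrapT => nab; apply: nu; exists u; split=> // a b.
  by rewrite ltNge; apply/negP => le; apply: nab; exists a, b.
have [D HD] := choice bad.
have pw j : exists t : ('I_K.+1 -> 'I_K.+1 -> Q) * Q * Q,
    [/\ forall a b, cnorm (D j a b - t.1.1 a b) < j.+1%:R^-1,
      star t.1.2 * t.1.2 = t.1.2,
      cnorm (t.1.2 - half (t.1.1 ord0 ord0)) <= 2 *
        cnorm (half (t.1.1 ord0 ord0) * half (t.1.1 ord0 ord0) - half (t.1.1 ord0 ord0)),
      cnorm t.2 <= 1
    & cnorm (\sum_a t.1.1 a ord0 * t.1.2 * star (t.1.1 a ord0) - 1) < 1 ->
      star t.2 * t.2 = e ord0 ord0 /\ t.1.2 * t.2 = t.2].
  have [|x [q [w Hw]]] := @approx_partial_isometry (D j) j.+1%:R^-1.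
    by rewrite invr_gt0.
  by exists (x, q, w).
have {pw}[t Ht] := choice pw.
pose x j := (t j).1.1; pose q j := (t j).1.2; pose w j := (t j).2.
have bD a b : bounded (fun j => D j a b).
  by exists 1 => j; case: (HD j) => -[].
have bx a b : bounded (fun j => x j a b).
  exists 2 => j; have [xD _ _ _ _] := Ht j; have [[D1 _ _ _] _] := HD j.
  have j1 : (j.+1%:R^-1 : R) <= 1 by rewrite invf_le1// ler1n.
  have xab : cnorm (D j a b - x j a b) < 1 := lt_le_trans (xD a b) j1.
  have := ler_cnorm_dist (D j a b) (x j a b); rewrite ler_norml => /andP[+ _].
  move: xab (D1 a b) => {j1}; lra.
have bq : bounded q.
  exists 1 => j; have [_ qq _ _ _] := Ht j.
  have [q0|/(cnorm_proj qq) -> //] := eqVneq (q j) 0.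
  by rewrite q0 cnorm0.
have bw : bounded w by exists 1 => j; have [] := Ht j.
have small (s s' : nat -> Q) : bounded s -> bounded s' ->
    (forall j, cnorm (s j - s' j) < j.+1%:R^-1) -> ucl FU s = ucl FU s'.
  move=> bs bs' h; apply/ucl_eqP => // r r0.
  by apply: filterS (nonprincipal_small r0) => j /=; apply: lt_trans.
pose d a b := ucl FU (fun j => D j a b).
have dM a b b' c : d a b * d b' c = (b == b')%:R *: d a c.
  rewrite -uclM// -uclZ//; apply: small; [exact: boundedM|exact: boundedZ|].
  by move=> j; case: (HD j) => -[].
have ds a b : star (d a b) = d b a.
  rewrite -ucl_star//; apply: small => //; first exact: bounded_star.
  by move=> j; case: (HD j) => -[].
have d1 : \sum_a d a a = 1.
  have [bs <-] := ucl_sum FU (index_enum 'I_K.+1) (fun a => bD a a).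
  rewrite -(ucl1 _ FU); apply: small => //; first exact: bounded_cst.
  by move=> j; case: (HD j) => -[].
have dx a b : ucl FU (fun j => x j a b) = d a b.
  apply: small => // j; rewrite cnorm_distC.
  by case: (Ht j).
pose h j := half (x j ord0 ord0).
have bh : bounded h by apply/boundedZ/boundedD => //; exact: bounded_star.
have hd : ucl FU h = d ord0 ord0.
  rewrite uclZ; last by apply: boundedD => //; exact: bounded_star.
  rewrite uclD//; last exact: bounded_star.
  by rewrite ucl_star// !dx ds scale_half.
have qd : ucl FU q = d ord0 ord0.
  rewrite -hd; apply/ucl_eqP => // r r0.
  have : ucl FU (fun j => h j * h j) = ucl FU h.
    by rewrite uclM// hd dM eqxx scale1r.
  move=> /ucl_eqP - /(_ (boundedM bh bh) bh (r / 2)).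
  rewrite divr_gt0// => /(_ isT); apply: filterS => j /= hj.
  have [_ _ qh _ _] := Ht j; rewrite (le_lt_trans qh)//.
  by rewrite -ltr_pdivlMl// mulrC.
(* In the ultrapower the sum is [\sum_a d a 0 * d 0 0 * d 0 a = \sum_a d a a = 1], so the premise
   about [w j] holds for [U]-many [j]. *)
have near_w : U [set j | star (w j) * w j = e ord0 ord0 /\ q j * w j = w j].
  have bterm a : bounded (fun j => x j a ord0 * q j * star (x j a ord0)).
    by apply: boundedM; [exact: boundedM|exact: bounded_star].
  have [bs E] := ucl_sum FU (index_enum 'I_K.+1) bterm.
  have E' : ucl FU (fun j => \sum_a x j a ord0 * q j * star (x j a ord0)) =
      ucl FU (fun=> 1).
    rewrite E ucl1 -d1; apply: eq_bigr => a _.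
    rewrite uclM//; [|exact: boundedM|exact: bounded_star].
    by rewrite uclM// ucl_star// dx qd ds !dM !eqxx !scale1r dM eqxx scale1r.
  have := (ucl_eqP FU bs (@bounded_cst _ _ nat 1)).1 E' 1 ltr01.
  by apply: filterS => j /=; have [_ _ _ _ h1] := Ht j.
pose E a b := ucl FU (fun=> e a b).
have bE a b : bounded (fun _ : nat => e a b) by exact: bounded_cst.
have [eM es e1] := eU.
have EM a b b' c : E a b * E b' c = (b == b')%:R *: E a c.
  by rewrite -uclM// -uclZ//; congr ucl; apply/funext => j; rewrite eM.
have Es a b : star (E a b) = E b a.
  by rewrite -ucl_star//; congr ucl; apply/funext => j; rewrite es.
have E1 : \sum_a E a a = 1.
  have [_ <-] := ucl_sum FU (index_enum 'I_K.+1) (fun a => bE a a).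
  by rewrite -(ucl1 _ FU); congr ucl; apply/funext => j; rewrite e1.
pose v := ucl FU w.
have vv : star v * v = E ord0 ord0.
  rewrite -ucl_star// -uclM//; last exact: bounded_star.
  apply/ucl_eqP; [by apply: boundedM => //; exact: bounded_star|exact: bE|].
  by move=> r r0; apply: filterS near_w => j /= [-> _]; rewrite subrr cnorm0.
have dv : d ord0 ord0 * v = v.
  rewrite -qd -uclM//; apply/ucl_eqP => //; first exact: boundedM.
  by move=> r r0; apply: filterS near_w => j /= [_ ->]; rewrite subrr cnorm0.
(* The usual intertwiner. As [v] has initial projection [E 0 0] and its range lies under [d 0 0],
   the class of [W] is an isometry with [d a b * W = W * E a b]. *)
pose W j := \sum_a D j a ord0 * w j * e ord0 a.
have bterm a : bounded (fun j => D j a ord0 * w j * e ord0 a).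
  by apply: boundedM; [exact: boundedM|exact: bE].
have [bW WE] := ucl_sum FU (index_enum 'I_K.+1) bterm.
have {}WE : ucl FU W = \sum_a d a ord0 * v * E ord0 a.
  rewrite WE; apply: eq_bigr => a _.
  by rewrite uclM//; [rewrite uclM|exact: boundedM].
have dW a b : d a b * ucl FU W = d a ord0 * v * E ord0 b.
  rewrite WE mulr_sumr (bigD1 b)//= !mulrA dM eqxx scale1r big1 ?addr0//.
  by move=> c cb; rewrite !mulrA dM eq_sym (negPf cb) scale0r !mul0r.
have WEab a b : ucl FU W * E a b = d a ord0 * v * E ord0 b.
  rewrite WE mulr_suml (bigD1 a)//= -mulrA EM eqxx scale1r big1 ?addr0//.
  by move=> c ca; rewrite -mulrA EM (negPf ca) scale0r mulr0.
have WW : star (ucl FU W) * ucl FU W = 1.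
  rewrite {1}WE star_sum mulr_suml -E1; apply: eq_bigr => a _.
  rewrite !starM ds Es -!mulrA dW dv (mulrA (star v)) vv.
  by rewrite !(EM, eqxx, scale1r).
(* [polar_unitary] multiplies [eta / 16] by 4, so the final estimate consists of three terms bounded
   by [eta / 4]; the minimum with 1/2 meets its hypothesis. *)
have eta9 : 0 < eta / 16 by rewrite divr_gt0.
have r0 : 0 < Num.min (eta / 16) 2^-1 by rewrite lt_min eta9 invr_gt0 ltr0n.
have n1 : U [set j | cnorm (star (W j) * W j - 1) < Num.min (eta / 16) 2^-1].
  have bs := boundedM (bounded_star bW) bW.
  apply: ((ucl_eqP FU bs (@bounded_cst _ _ nat 1)).1 _ _ r0).
  by rewrite uclM ?ucl_star ?ucl1//; exact: bounded_star.
have n2 : U [set j | forall p : 'I_K.+1 * 'I_K.+1,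
    cnorm (D j p.1 p.2 * W j - W j * e p.1 p.2) < eta / 4].
  have : U [set j | forall p : 'I_K.+1 * 'I_K.+1,
     [set j | cnorm (D j p.1 p.2 * W j - W j * e p.1 p.2) < eta / 4] j].
    apply: (@filter_forall _ _ _ _ UF) => p.
    have b1 := boundedM (bD p.1 p.2) bW; have b2 := boundedM bW (bE p.1 p.2).
    apply: ((ucl_eqP FU b1 b2).1 _ (eta / 4)); last by rewrite divr_gt0.
    by rewrite !uclM// dW WEab.
  by [].
have [j [n1j n2j]] := @filter_ex _ _ (@ultra_proper _ _ FU) _ (filterI n1 n2).
have fin (u : Q) : star u * u = 1 -> u * star u = 1.
  apply: stably_finite_finite.
  exact: (tower_stably_finite finj fsub fdense).
have [|u [uu uu' uW]] := polar_unitary fin (ltW n1j).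
  by rewrite ge_min lexx orbT.
have [[D1 _ _ _] /(_ u uu uu')[a [b]]] := HD j.
rewrite leNgt; apply/negP; rewrite negbK.
have {}uW : cnorm (u - W j) <= eta / 4.
  have : Num.min (eta / 16) 2^-1 <= eta / 16 by rewrite ge_min lexx.
  move: uW; lra.
have -> : star u * D j a b * u - e a b = star u * (D j a b * u - u * e a b).
  by rewrite mulrBr !mulrA uu mul1r.
rewrite cnorm_isoMl ?starK//.
have -> : D j a b * u - u * e a b =
    D j a b * (u - W j) + ((D j a b * W j - W j * e a b) + (W j - u) * e a b).
  by rewrite mulrBr mulrBl !addrA !subrK.
have h1 := ler_cnormMl (u - W j) (D1 a b); rewrite mul1r in h1.
have h2 := ler_cnormM (W j - u) (e a b).
rewrite (cnorm_delta (@fstar n) (@finj n)) mulr1 (cnorm_distC (W j)) in h2.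
have h3 : cnorm (D j a b * W j - W j * e a b) < eta / 4 := n2j (a, b).
have := ler_cnormD (D j a b * (u - W j)) (D j a b * W j - W j * e a b + (W j - u) * e a b).
have := ler_cnormD (D j a b * W j - W j * e a b) ((W j - u) * e a b).
lra.
Qed.

End Homogeneity.

(** * Finite support and separability *)

Section Support.
Variable R : realType.

(** Support is measured by the second index alone, so that every sort keeps infinitely many fresh
    constants. *)
Lemma teval_support k (t : cterm cst_sort k) : exists N,
  forall (A : cstarAlgType R) (c d : Defs.cst -> A),
  (forall x, (x.2 < N)%N -> c x = d x) -> teval c t = teval d t.
Proof.
have two j l (s : cterm cst_sort j) (t' : cterm cst_sort l) :
    (exists N, forall (A : cstarAlgType R) (c d : Defs.cst -> A),
      (forall x, (x.2 < N)%N -> c x = d x) -> teval c s = teval d s) ->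
    (exists N, forall (A : cstarAlgType R) (c d : Defs.cst -> A),
      (forall x, (x.2 < N)%N -> c x = d x) -> teval c t' = teval d t') ->
    exists N, forall (A : cstarAlgType R) (c d : Defs.cst -> A),
      (forall x, (x.2 < N)%N -> c x = d x) ->
      teval c s = teval d s /\ teval c t' = teval d t'.
  move=> [M HM] [N HN]; exists (maxn M N) => A c d cd; split.
    by apply: HM => x xM; apply: cd; rewrite leq_max xM.
  by apply: HN => x xN; apply: cd; rewrite leq_max xN orbT.
elim: t => [g|||j l s IHs t IHt|j l s IHs t IHt|j s [N IH]|
  a b j l h h' s [N IH]|j l h s [N IH]].
- by exists g.2.+1 => A c d cd; apply: cd.
- by exists 0%N.
- by exists 0%N.
- have [N HN] := two _ _ s t IHs IHt.
  by exists N => A c d /HN[/= -> ->].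
- have [N HN] := two _ _ s t IHs IHt.
  by exists N => A c d /HN[/= -> ->].
- by exists N => A c d /IH /= ->.
- by exists N => A c d /IH /= ->.
- by exists N => A c d /IH /= ->.
Qed.

Lemma qeval_support (phi : qf R cst_sort) : exists N,
  forall (A : cstarAlgType R) (c d : Defs.cst -> A),
  (forall x, (x.2 < N)%N -> c x = d x) -> qeval c phi = qeval d phi.
Proof.
elim: phi => [k s t|n f cf a IH].
  have [M HM] := teval_support s; have [N HN] := teval_support t.
  exists (maxn M N) => A c d cd /=; rewrite (HM _ c d) ?(HN _ c d)//.
    by move=> x xN; apply: cd; rewrite leq_max xN orbT.
  by move=> x xM; apply: cd; rewrite leq_max xM.
have [N HN] := choice IH.
exists (\max_i N i) => A c d cd /=; congr f; apply/matrixP => i j; rewrite !mxE.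
apply: HN => x xN; apply: cd; rewrite (leq_trans xN)//.
exact: leq_bigmax.
Qed.

Lemma sat_support (p : set (expr R)) : finite_set p -> exists N,
  forall (A : cstarAlgType R) (c d : Defs.cst -> A),
  (forall x, (x.2 < N)%N -> c x = d x) -> sat c p -> sat d p.
Proof.
move=> fp; have [N HN] := choice (fun e : expr R => qeval_support e.1).
have [M HM] : exists M, forall e, p e -> (N e <= M)%N.
  have NF : \oo [set M | forall e, p e -> (N e <= M)%N].
    by apply: filter_finite => // e _; exact: nbhs_infty_ge.
  by have [M HM] := filter_ex NF; exists M.
exists M => A c d cd cp e pe; rewrite -(HN e A c d); first exact: cp.
by move=> x xN; apply: cd; rewrite (leq_trans xN)// HM.
Qed.

End Support.

Section DenseSequence.
Variables (R : realType) (Q : cstarAlgType R) (k : nat -> nat).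
Variable f : forall n, {lrmorphism 'M[R[i]]_((k n).+1) -> Q}.
Hypothesis fstar : forall n, star_preserving (f n).
Hypothesis finj : forall n, injective (f n).
Hypothesis fdense : forall x (e : R), 0 < e -> exists n X, cnorm (x - f n X) < e.

Definition rat_mx K (Y : 'M[rat]_K * 'M[rat]_K) : 'M[R[i]]_K :=
  \matrix_(a, b) (ratr (Y.1 a b) +i* ratr (Y.2 a b)).

Lemma rat_mx_approx K (X : 'M[R[i]]_K) (e : R) : 0 < e -> exists Y,
  \sum_a \sum_b Normc.normc (X a b - rat_mx Y a b) < e.
Proof.
move=> e0; pose d : R := e / (K * K).+1%:R.
have d0 : 0 < d by rewrite divr_gt0.
have H a b := complex_rat_approx (X a b) d0.
have H' a : exists g : 'I_K -> rat * rat, forall b,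
    Normc.normc (X a b - (ratr (g b).1 +i* ratr (g b).2)) < d.
  suff H1 b : exists y : rat * rat, Normc.normc (X a b - (ratr y.1 +i* ratr y.2)) < d.
    by have [g Hg] := choice H1; exists g.
  by have [p [q pq]] := H a b; exists (p, q).
have [g Hg] := choice H'.
exists (\matrix_(a, b) (g a b).1, \matrix_(a, b) (g a b).2).
rewrite (@le_lt_trans _ _ (\sum_(a < K) \sum_(b < K) d))//.
  apply: ler_sum => a _; apply: ler_sum => b _.
  by rewrite !mxE ltW.
rewrite !sumr_const card_ord -mulrnA -mulr_natr /d -mulrA gtr_pMr//.
by rewrite mulrC ltr_pdivrMr// mul1r ltr_nat.
Qed.

Lemma cnorm_mx_le n (X : 'M[R[i]]_((k n).+1)) :
  cnorm (f n X) <= \sum_a \sum_b Normc.normc (X a b).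
Proof.
rewrite {1}(matrix_sum_delta X) linear_sum2 (le_trans (ler_cnorm_sum _ _ _))//.
apply: ler_sum => a _; rewrite (le_trans (ler_cnorm_sum _ _ _))//.
apply: ler_sum => b _; rewrite cnormZ.
by rewrite (cnorm_delta (@fstar n) (@finj n)) mulr1.
Qed.

Lemma tower_separable : separable Q.
Proof.
pose T := {n & 'M[rat]_((k n).+1) * 'M[rat]_((k n).+1)}%type.
exists (fun i => if unpickle i is Some t then f (tag (t : T)) (rat_mx (tagged t)) else 0).
move=> x e e0; have e2 : 0 < e / 2 by rewrite divr_gt0.
have [n [X xX]] := fdense x e2; have [Y XY] := rat_mx_approx X e2.
exists (pickle (existT _ n Y : T)); rewrite pickleK /=.
rewrite (le_lt_trans (cnorm_dist_trans (f n X) _ _))// (splitr e) ltrD//.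
have -> : f n X - f n (rat_mx Y) = f n (X - rat_mx Y) by apply/esym/raddfB.
rewrite (le_lt_trans (cnorm_mx_le _))// (le_lt_trans _ XY)//.
apply: ler_sum => a _; apply: ler_sum => b _.
by rewrite !mxE.
Qed.

(** The exponent of 2 in [i] takes every value infinitely often, so each member of a dense sequence
    recurs beyond any [N]. The play needs a late recurrence, because a value set at round [i] may
    still drift by about [2^-i]. *)
Lemma dense_sequence : exists q : nat -> Q,
  forall x (e : R) N, 0 < e -> exists2 i, (N <= i)%N & cnorm (x - q i) < e.
Proof.
have [d dd] := tower_separable.
exists (fun i => d (logn 2 i)) => x e N /(dd x)[n xn].
exists (2 ^ n * (N.*2.+1))%N.
  rewrite (leq_trans _ (leq_pmull _ _)) ?expn_gt0//.
  by rewrite -addnn -addSn leq_addl.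
rewrite lognM ?expn_gt0// pfactorK// (_ : logn 2 _ = 0%N) ?addn0//.
by apply: logn_coprime; rewrite coprime2n /= odd_double.
Qed.

End DenseSequence.

(** * The answers of the second player *)

Section Answer.
Variables (R : realType) (F : connectives R).
Hypothesis hF : admissible F.
Variables (Q : cstarAlgType R) (k : nat -> nat).
Variable f : forall n, {lrmorphism 'M[R[i]]_((k n).+1) -> Q}.
Hypothesis fstar : forall n, star_preserving (f n).
Hypothesis finj : forall n, injective (f n).
Hypothesis fsub : forall n, range (f n) `<=` range (f n.+1).
Hypothesis fdense : forall x (e : R), 0 < e -> exists n X, cnorm (x - f n X) < e.
Variables (U : set_system nat) (FU : UltraFilter U).
Hypothesis Unp : forall j, ~ U [set j].
Variable t : nat -> any_term.

Lemma representable_cond (b : bool) (T : forall M : cstarAlgType R, (Defs.cst -> M) -> M) :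
  representable T -> representable (fun M c => b%:R *: T M c).
Proof.
case: b => [[j [s sT]]|_].
  by exists j, s => M c; rewrite sT scale1r.
by have [j [s s0]] := representable0 R; exists j, s => M c; rewrite s0 scale0r.
Qed.

Definition term_value (A : cstarAlgType R) (c : Defs.cst -> A) j := teval c (projT2 (t j)).

(* The answer [p'] to [p]: strict inequalities gain some room, so that they
   survive in the limit; [c] is pinned down on the constants with both indices
   below [N], up to conjugation; and finitely many distances are decided. *)
Definition answer_spec i (c : Defs.cst -> Q) N (p p' : set (expr R)) :=
  [/\ p `<=` p', condition F p',
      forall phi r, p (phi, r) -> exists2 r', r' < r & p' (phi, r'),
      forall d : Defs.cst -> Q, in_balls cst_sort d -> sat d p' -> exists u,
        [/\ star u * u = 1, u * star u = 1 & forall x : Defs.cst,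
          (x.1 < N)%N -> (x.2 < N)%N ->
          cnorm (star u * d x * u - c x) <= 2^-1 ^+ i.+1]
    & forall (M : cstarAlgType R) (d : Defs.cst -> M) j l,
        in_balls cst_sort d -> sat d p' -> (j < i)%N -> (l < i)%N ->
        `|cnorm (term_value d j - term_value d l) -
          cnorm (term_value c j - term_value c l)| < 2^-1 ^+ i].

(** Altering [c] outside the support of the inequalities already imposed, by exact matrix units of a
    level close to its values, keeps them true: the answer is a condition. Any realization of it
    contains approximate units, and conjugating these to the exact ones brings its values on the box
    near those of [c]. *)
Lemma answer_exists i c N p : in_balls cst_sort c -> condition F p -> sat c p ->
  exists p', answer_spec i c N p p'.
Proof.
move=> cb [fp rp _] cp.
have half0 n : 0 < (2^-1 : R) ^+ n by rewrite exprn_gt0// invr_gt0.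
pose pa := [set (e.1, (qeval c e.1 + e.2) / 2) | e in p] : set (expr R).
have fpa : finite_set pa by exact: finite_image.
have rpa e : pa e -> restricted F e.1 by move=> [e' /rp re' <-].
have cpa : sat c pa.
  by move=> _ [e pe <-] /=; have := cp e pe; lra.
have [pc [fpc rpc cpc pcP]] : imposable F c (fun M d => forall (j l : 'I_i),
    `|cnorm (term_value d j - term_value d l) -
      cnorm (term_value c j - term_value c l)| < 2^-1 ^+ i).
  apply: imposable_fin => j; apply: imposable_fin => l.
  have rt m : representable (fun (M : cstarAlgType R) d => term_value d m).
    by exists _, (projT2 (t m)).
  exact: (imposable_dist hF cb (rt j) (rt l)).
pose p1 := p `|` pa `|` pc.
have fp1 : finite_set p1 by rewrite !finite_setU.
have cp1 : sat c p1 by move=> e [[/cp|/cpa]|/cpc].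
have rp1 e : p1 e -> restricted F e.1 by move=> [[/rp|/rpa]|/rpc].
have [N1 HN1] := sat_support fp1.
pose N' := maxn N N1.
(* The final estimate has errors [2 * e1], [e1] and [2 * e1], less than [8 * e1] in total. *)
pose e1 : R := 2^-1 ^+ i.+1 / 8.
have e10 : 0 < e1 by rewrite divr_gt0.
have [n _ [X0 HX]] := tower_approx fsub fdense
  (fun x : 'I_N * 'I_N => c (x.1 : nat, x.2 : nat)) 0%N e10.
(* Rational coefficients make the combinations of units in [i4] values of terms. *)
have [Y HY] := choice (fun x => rat_mx_approx (X0 x) e10).
pose X (x : 'I_N * 'I_N) := rat_mx R (Y x).
have cX (x : 'I_N * 'I_N) : cnorm (c (x.1 : nat, x.2 : nat) - f n (X x)) < 2 * e1.
  rewrite (le_lt_trans (cnorm_dist_trans (f n (X0 x)) _ _))// mulr_natl mulr2n ltrD//.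
  have -> : f n (X0 x) - f n (X x) = f n (X0 x - X x) by apply/esym/raddfB.
  rewrite (le_lt_trans (cnorm_mx_le fstar finj _))// (le_lt_trans _ (HY x))//.
  by apply: ler_sum => a _; apply: ler_sum => b _; rewrite !mxE.
pose K := k n.
pose S := \sum_x \sum_a \sum_b Normc.normc (X x a b) + 1.
have S1 : 0 < S.
  rewrite ltr_wpDl//; do 3 (apply: sumr_ge0 => ? _); exact: normc_ge0.
have [dl dl0 dlP] :=
  @approx_units_conj R Q k f fstar finj fsub fdense n U FU Unp _ (divr_gt0 e10 S1).
(* Fresh constants, required to be approximate matrix units which nearly generate
   the values of [c]. *)
pose y (a b : 'I_K.+1) : Defs.cst := (0, N' + (a * K.+1 + b))%N.
(* Division by [K.+1] recovers [(a, b)] from the second index of [y a b]. Later constants of this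
   sort receive some unit as well, through the default of [inord]; they lie outside the support. *)
pose c' (x : Defs.cst) : Q :=
  if (x.1 == 0)%N && (N' <= x.2)%N then
    f n (delta_mx (inord ((x.2 - N') %/ K.+1)) (inord ((x.2 - N') %% K.+1)))
  else c x.
have c'y a b : c' (y a b) = f n (delta_mx a b).
  rewrite /c' /y /= leq_addr addKn divnMDl// (divn_small (ltn_ord b)) addn0.
  by rewrite modnMDl (modn_small (ltn_ord b)) !inord_val.
have c'c x : (x.2 < N')%N -> c' x = c x.
  by move=> xN; rewrite /c' leqNgt xN andbF.
have c'b : in_balls cst_sort c'.
  move=> x; rewrite /c'; case: ifP => // _.
  by rewrite (cnorm_delta (@fstar n) (@finj n)) ler1n.
have c'p1 : sat c' p1.
  apply: (HN1 Q c) => // x xN1; rewrite c'c//.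
  by rewrite leq_max xN1 orbT.
have ry a b : representable (fun (M : cstarAlgType R) d => d (y a b)).
  exact: representable_gen.
have [eM es eS] : matrix_units (fun a b : 'I_K.+1 => f n (delta_mx a b)).
  exact: (matrix_units_morph (@fstar n) (matrix_units_delta R K)).
have i1 : imposable F c' (fun M d => forall a b b' a' : 'I_K.+1,
    cnorm (d (y a b) * d (y b' a') - (b == b')%:R *: d (y a a')) < dl).
  do 4 (apply: imposable_fin => ?).
  apply: (imposable_dist_lt F c'b (representableM (ry _ _) (ry _ _))
    (representable_cond _ (ry _ _))).
  by rewrite !c'y eM subrr cnorm0.
have i2 : imposable F c' (fun M d => forall a b : 'I_K.+1,
    cnorm (star (d (y a b)) - d (y b a)) < dl).
  do 2 (apply: imposable_fin => ?).
  apply: (imposable_dist_lt F c'b (representable_star (ry _ _)) (ry _ _)).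
  by rewrite !c'y es subrr cnorm0.
have i3 : imposable F c' (fun M d => cnorm (\sum_(a : 'I_K.+1) d (y a a) - 1) < dl).
  apply: (imposable_dist_lt F c'b (representable_sum _ (fun a => ry a a)) (representable1 R)).
  rewrite (eq_bigr (fun a => f n (delta_mx a a))) => [|a _]; last exact: c'y.
  by rewrite eS subrr cnorm0.
have i4 : imposable F c' (fun M d => forall x : 'I_N * 'I_N,
    cnorm (d (x.1 : nat, x.2 : nat) -
      \sum_(a : 'I_K.+1) \sum_(b : 'I_K.+1) X x a b *: d (y a b)) < 2 * e1).
  apply: imposable_fin => x.
  have rX a b : representable (fun (M : cstarAlgType R) d => X x a b *: d (y a b)).
    rewrite (_ : X x a b = ratr ((Y x).1 a b) +i* ratr ((Y x).2 a b)); last by rewrite mxE.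
    exact: representable_scale.
  apply: (imposable_dist_lt F c'b (representable_gen _ _)
    (representable_sum _ (fun a => representable_sum _ (fun b => rX a b)))).
  rewrite c'c; last by rewrite leq_max (ltn_ord x.2).
  rewrite (eq_bigr (fun a => \sum_b X x a b *: f n (delta_mx a b))) => [|a _]; last first.
    by apply: eq_bigr => b _; rewrite c'y.
  by rewrite -(linear_sum2 (f n)) -matrix_sum_delta; exact: cX.
have [p2 [fp2 rp2 cp2 p2P]] := imposableI i1 (imposableI i2 (imposableI i3 i4)).
exists (p1 `|` p2); split.
- by move=> e pe; left; left; left.
- split=> [|e [/rp1|/rp2]//|]; first by rewrite finite_setU.
  exists Q, c'; split=> //; first exact: (tower_stably_finite finj fsub fdense).
  by move=> e [/c'p1|/cp2].
- move=> phi r pr; exists ((qeval c phi + r) / 2); first by have := cp _ pr => /=; lra.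
  by left; left; right; exists (phi, r).
- move=> d db dp; have [|h1 [h2 [h3 h4]]] := p2P Q d db.
    by move=> e pe; apply: dp; right.
  have [|u [uu uu' uP]] := dlP (fun a b => d (y a b)).
    by split=> // a b; exact: db.
  exists u; split=> // x x1 x2; have := h4 (Ordinal x1, Ordinal x2).
  have := cX (Ordinal x1, Ordinal x2); set z := (Ordinal x1, Ordinal x2).
  rewrite /= -surjective_pairing => hc hd.
  set sm := \sum_a \sum_b _ in hd.
  have -> : star u * d x * u - c x = star u * (d x - sm) * u +
      (\sum_a \sum_b X z a b *: (star u * d (y a b) * u - f n (delta_mx a b)) +
      (f n (X z) - c x)).
    rewrite mulrBr mulrBl -addrA; congr (_ + _).
    have -> : \sum_a \sum_b X z a b *: (star u * d (y a b) * u - f n (delta_mx a b)) =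
        star u * sm * u - f n (X z).
      rewrite {2}(matrix_sum_delta (X z)) linear_sum2 /sm mulr_sumr mulr_suml -sumrB.
      apply: eq_bigr => a _; rewrite mulr_sumr mulr_suml -sumrB.
      by apply: eq_bigr => b _; rewrite scalerBr -scalerAr -scalerAl.
    by rewrite !addrA addNr sub0r addNr add0r.
  rewrite (le_trans (ler_cnormD _ _))//.
  have k1 : cnorm (star u * (d x - sm) * u) < 2 * e1.
    by rewrite cnorm_isoMr// cnorm_isoMl ?starK.
  have k2 : cnorm (\sum_a \sum_b
      X z a b *: (star u * d (y a b) * u - f n (delta_mx a b))) <= e1.
    rewrite (@le_trans _ _ (S * (e1 / S)))//; last by rewrite mulrCA mulfV ?mulr1// gt_eqF.
    rewrite (@le_trans _ _ ((\sum_a \sum_b Normc.normc (X z a b)) * (e1 / S)))//.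
      rewrite mulr_suml (le_trans (ler_cnorm_sum _ _ _))//; apply: ler_sum => a _.
      rewrite mulr_suml (le_trans (ler_cnorm_sum _ _ _))//; apply: ler_sum => b _.
      by rewrite cnormZ ler_wpM2l ?normc_ge0// ltW.
    rewrite ler_wpM2r//; first by rewrite divr_ge0 ?ltW.
    rewrite /S (bigD1 z)// -addrA lerDl addr_ge0//.
    by do 3 (apply: sumr_ge0 => ? _); exact: normc_ge0.
  have k3 : cnorm (f n (X z) - c x) < 2 * e1 by rewrite cnorm_distC.
  have := ler_cnormD (\sum_a \sum_b
    X z a b *: (star u * d (y a b) * u - f n (delta_mx a b))) (f n (X z) - c x).
  have : 8 * e1 = 2^-1 ^+ i.+1 by rewrite /e1; field.
  lra.
- move=> M d j l db dp ji li; apply: (pcP M d db _ (Ordinal ji) (Ordinal li)).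
  by move=> e pe; apply: dp; left; right.
Qed.

End Answer.

(** * Building the universal UHF algebra in a play *)

Section Conjugation.
Variables (R : realType) (Q : cstarAlgType R) (u : Q).
Hypotheses (uu : star u * u = 1) (uu' : u * star u = 1).

Lemma inner_automorphism : exists f : {lrmorphism Q -> Q},
  star_preserving f /\ forall x, f x = star u * x * u.
Proof.
have [||||f fE] := @lrmorphism_of R Q Q (fun x => star u * x * u).
- by move=> x y; rewrite mulrDr mulrDl.
- by move=> z x; rewrite -scalerAr -scalerAl.
- by rewrite mulr1.
- by move=> x y; rewrite -!mulrA (mulrA u) uu' mul1r.
by exists f; split=> // x; rewrite !fE !starM starK mulrA.
Qed.

Lemma cnorm_conj x : cnorm (star u * x * u) = cnorm x.
Proof. by rewrite cnorm_isoMr// cnorm_isoMl ?starK. Qed.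

Lemma sat_conj (d : Defs.cst -> Q) p : sat d p -> sat (fun x => star u * d x * u) p.
Proof.
have [f [fs fE]] := inner_automorphism => dp e pe.
rewrite (@qeval_isometry _ _ d _ _ e.1); first exact: dp.
move=> k s t; rewrite -(cnorm_conj (teval d s - teval d t)) -fE.
have -> : f (teval d s - teval d t) = f (teval d s) - f (teval d t) by exact: raddfB.
rewrite -!teval_hom//.
by have -> : (fun x => f (d x)) = (fun x => star u * d x * u) by apply/funext.
Qed.

End Conjugation.

Section TermLimit.
Variables (R : realType) (Q : cstarAlgType R) (I : Type) (U : set_system I).
Variable FU : UltraFilter U.
Variables (c : I -> Defs.cst -> Q) (cl : Defs.cst -> Q).
Hypothesis cb : forall i, in_balls cst_sort (c i).
Hypothesis clb : in_balls cst_sort cl.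
Hypothesis ccl : forall x (e : R), 0 < e -> U [set i | cnorm (c i x - cl x) < e].

Let UF : Filter U := @ultra_proper _ _ FU.

(** Convergence along [U] is equality of classes in the ultrapower, where the induction on terms
    becomes algebraic. *)
Lemma teval_cvg k (t : cterm cst_sort k) (e : R) : 0 < e ->
  U [set i | cnorm (teval (c i) t - teval cl t) < e].
Proof.
have bc j (s : cterm cst_sort j) : bounded (fun i => teval (c i) s).
  by exists j%:R => i; exact: teval_bound.
have bl j (s : cterm cst_sort j) : bounded (fun _ : I => teval cl s).
  by exists j%:R => i; exact: teval_bound.
move: e; apply/(ucl_eqP FU (bc _ t) (bl _ t)); elim: t => /=.
- move=> g; apply/(ucl_eqP FU (bc _ (TGen _ g)) (bl _ (TGen _ g))); exact: ccl.
- by [].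
- by [].
- by move=> j l s IHs t IHt; rewrite !uclD// IHs IHt.
- by move=> j l s IHs t IHt; rewrite !uclM// IHs IHt.
- by move=> j s IHs; rewrite !ucl_star// IHs.
- by move=> a b j l _ _ s IHs; rewrite !uclZ// IHs.
- by [].
Qed.

Lemma dist_cvg k (s t : cterm cst_sort k) (e : R) : 0 < e -> U [set i |
  `|cnorm (teval (c i) s - teval (c i) t) - cnorm (teval cl s - teval cl t)| < e].
Proof.
move=> e0; have e2 : 0 < e / 2 by rewrite divr_gt0.
apply: filterS (filterI (teval_cvg s e2) (teval_cvg t e2)) => i [/= hs ht].
rewrite (le_lt_trans (ler_cnorm_dist _ _))//.
have -> : teval (c i) s - teval (c i) t - (teval cl s - teval cl t) =
    teval (c i) s - teval cl s - (teval (c i) t - teval cl t).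
  by rewrite !opprB [teval cl t - teval cl s]addrC addrACA [- _ + teval cl t]addrC.
by rewrite (le_lt_trans (ler_cnormB _ _))// (splitr e) ltrD.
Qed.

End TermLimit.

Section Enforce.
Variables (R : realType) (F : connectives R).
Hypothesis hF : admissible F.
Variables (Q : cstarAlgType R) (k : nat -> nat).
Variable f : forall n, {lrmorphism 'M[R[i]]_((k n).+1) -> Q}.
Hypothesis fstar : forall n, star_preserving (f n).
Hypothesis finj : forall n, injective (f n).
Hypothesis fsub : forall n, range (f n) `<=` range (f n.+1).
Hypothesis fdense : forall x (e : R), 0 < e -> exists n X, cnorm (x - f n X) < e.
Variables (U : set_system nat) (FU : UltraFilter U).
Hypothesis Unp : forall j, ~ U [set j].
Variables (t : nat -> any_term) (q : nat -> Q).
Hypothesis tP : forall s, exists n, t n = s.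
Hypothesis qP : forall x (e : R) N, 0 < e ->
  exists2 i, (N <= i)%N & cnorm (x - q i) < e.
Hypothesis realized : forall p, condition F p ->
  exists d : Defs.cst -> Q, in_balls cst_sort d /\ sat d p.

Let UF : ProperFilter U := @ultra_proper _ _ FU.
Let state : Type := ((Defs.cst -> Q) * nat)%type.
Implicit Types s : state.

Definition box N (x : Defs.cst) := (x.1 < N)%N && (x.2 < N)%N.

(* The new interpretation realizes [p], is close to the old one on the old box,
   and takes the value [q i] at some constant of the new box. *)
Definition next_spec i s (p : set (expr R)) s' :=
  [/\ in_balls cst_sort s'.1 /\ sat s'.1 p, (s.2 <= s'.2)%N, (i < s'.2)%N,
      forall x, box s.2 x -> cnorm (s'.1 x - s.1 x) <= 2^-1 ^+ i
    & exists2 y, box s'.2 y & s'.1 y = q i].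

(** A constant outside both the old box and the support of [p] is free to take the value [q i], once
    its ball is large enough. *)
Lemma next_state_exists i s p (d : Defs.cst -> Q) : finite_set p ->
  in_balls cst_sort d -> sat d p ->
  (forall x, box s.2 x -> cnorm (d x - s.1 x) <= 2^-1 ^+ i) ->
  exists s', next_spec i s p s'.
Proof.
move=> fp db dp ds; have [N HN] := sat_support fp.
pose b := Num.bound (cnorm (q i)); pose M := maxn s.2 N; pose y : Defs.cst := (b, M).
pose c (x : Defs.cst) := if x == y then q i else d x.
have cE (x : Defs.cst) : (x.2 < M)%N -> c x = d x.
  by move=> xM; rewrite /c; case: eqP => // xy; rewrite xy ltnn in xM.
exists (c, (maxn i (maxn b M)).+1); split=> /=.
- split=> [x|].
    rewrite /c; case: eqP => [->|_]; last exact: db.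
    rewrite (le_trans (ltW (archi_boundP (cnorm_ge0 (q i)))))//.
    by rewrite ler_nat leqnSn.
  apply: HN dp => x xN; rewrite cE//.
  by rewrite (leq_trans xN)// leq_maxr.
- by rewrite leqW// !leq_max leqnn !orbT.
- by rewrite ltnS leq_maxl.
- move=> x xb; rewrite cE; first exact: ds.
  by case/andP: xb => _ x2; rewrite (leq_trans x2)// leq_maxl.
- exists y; last by rewrite /c eqxx.
  rewrite /box /= !ltnS (leq_trans (leq_maxl b M)) ?leq_maxr//=.
  by rewrite (leq_trans (leq_maxr b M)) ?leq_maxr.
Qed.

Definition next_state i s p : state :=
  if pselect (exists s', next_spec i s p s') is left h then projT1 (cid h) else s.

Lemma next_stateP i s p : (exists s', next_spec i s p s') -> next_spec i s p (next_state i s p).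
Proof. by move=> h; rewrite /next_state; case: pselect => // h'; case: (cid h'). Qed.

(** The default [p] keeps the strategy legal at positions that its own play does not reach. *)
Definition answer i s p : set (expr R) :=
  if pselect (exists p', answer_spec F t i s.1 s.2 p p') is left h
  then projT1 (cid h) else p.

Lemma answerP i s p : (exists p', answer_spec F t i s.1 s.2 p p') ->
  answer_spec F t i s.1 s.2 p (answer i s p).
Proof. by move=> h; rewrite /answer; case: pselect => // h'; case: (cid h'). Qed.

Lemma answer_legal i s p : condition F p ->
  condition F (answer i s p) /\ p `<=` answer i s p.
Proof.
move=> cp; rewrite /answer; case: pselect => [h|_]; last by split.
by case: (cid h) => p' /= [].
Qed.

(* The interpretations chosen before round [i]; they depend only on the moves of
   the first player, which have even index. *)
Fixpoint play_state (p : nat -> set (expr R)) i : state :=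
  if i is j.+1 then next_state j (play_state p j) (p j.*2) else (fun=> 0, 0%N).

Lemma play_state_ext p p' i : (forall j, (j < i)%N -> p j.*2 = p' j.*2) ->
  play_state p i = play_state p' i.
Proof.
elim: i => //= i IH pp; rewrite pp// IH// => j ji.
by rewrite pp// ltnS ltnW.
Qed.

(** The last move has even index [n = 2 i] in a play; the state at [i + 1] already takes that move
    into account. *)
Definition chase (h : seq (set (expr R))) : set (expr R) :=
  let n := (size h).-1 in
  answer n./2 (play_state (nth set0 h) n./2.+1) (nth set0 h n).

Lemma chase_legal : legal_strategy F chase.
Proof.
move=> h p cp; rewrite /chase size_rcons [_.-1]/= nth_rcons ltnn eqxx.
exact: answer_legal.
Qed.

Section Play.
Variable p : nat -> set (expr R).
Hypothesis pP : play F chase p.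

Let st := play_state p.
Let c i := (st i).1.
Let N i := (st i).2.

Lemma chase_move i : p i.*2.+1 = answer i (st i.+1) (p i.*2).
Proof.
have [_ _ ->] := pP; rewrite /chase size_mkseq [_.-1]/= doubleK nth_mkseq//.
congr (answer _ _ _); apply: play_state_ext => j ji.
by rewrite nth_mkseq// ltnS leq_double.
Qed.

Lemma play_mono i j : (i <= j)%N -> p i `<=` p j.
Proof.
have [_ pS _] := pP; elim: j => [|j IH]; first by rewrite leqn0 => /eqP ->.
rewrite leq_eqVlt => /predU1P[-> //|/IH ij e pe]; exact: pS (ij _ pe).
Qed.

(* A realization of the opponent's next move in [Q] is conjugated back, by the
   previous answer, to one close to the current interpretation. *)
Lemma play_spec i : next_spec i (st i) (p i.*2) (st i.+1) /\
  answer_spec F t i (c i.+1) (N i.+1) (p i.*2) (p i.*2.+1).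
Proof.
have [cp _ _] := pP.
have step j : (exists d : Defs.cst -> Q, [/\ in_balls cst_sort d, sat d (p j.*2) &
    forall x, box (N j) x -> cnorm (d x - c j x) <= 2^-1 ^+ j]) ->
    next_spec j (st j) (p j.*2) (st j.+1) /\
    answer_spec F t j (c j.+1) (N j.+1) (p j.*2) (p j.*2.+1).
  move=> [d [db dp dc]].
  have nj : next_spec j (st j) (p j.*2) (st j.+1).
    by apply: next_stateP; apply: (next_state_exists (d := d)) => //; case: (cp j.*2).
  split=> //; rewrite chase_move; apply: answerP.
  have [[cb sp] _ _ _ _] := nj.
  exact: (answer_exists hF fstar finj fsub fdense FU Unp).
elim: i => [|i [_ [_ _ _ mb _]]]; apply: step.
  (* The initial box is empty, so any realization will do. *)
  by have [d [db dp]] := realized (cp 0%N); exists d; split.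
have [d [db dp]] := realized (cp i.+1.*2).
have [|u [uu uu' uP]] := mb d db.
  by move=> e pe; apply: dp; apply: (play_mono (leqnSn _)).
exists (fun x => star u * d x * u); split.
- by move=> x; rewrite cnorm_conj.
- exact: sat_conj.
- by move=> x /andP[x1 x2]; exact: uP.
Qed.

Lemma play_in_balls i : in_balls cst_sort (c i).
Proof.
case: i => [|i]; first by move=> x; rewrite cnorm0 ler0n.
by have [[[]]] := play_spec i.
Qed.

Lemma limit_exists : exists cl : Defs.cst -> Q, forall x i, box (N i) x ->
  cnorm (cl x - c i x) <= 2 * 2^-1 ^+ i.
Proof.
have Nmono i j : (i <= j)%N -> (N i <= N j)%N.
  elim: j => [|j IH]; first by rewrite leqn0 => /eqP ->.
  rewrite leq_eqVlt => /predU1P[-> //|/IH ij]; rewrite (leq_trans ij)//.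
  by have [[]] := play_spec j.
have bmono i j x : (i <= j)%N -> box (N i) x -> box (N j) x.
  by move=> /Nmono ij /andP[x1 x2]; rewrite /box !(leq_trans _ ij).
have H x : exists l, forall i, box (N i) x -> cnorm (l - c i x) <= 2 * 2^-1 ^+ i.
  have bx : exists i, box (N i) x.
    exists (maxn x.1 x.2).+1; have [[_ _ h _ _] _] := play_spec (maxn x.1 x.2).
    by rewrite /box !(leq_ltn_trans _ h)// ?leq_maxl ?leq_maxr.
  have [i ix imin] := ex_minnP bx.
  have [|l Hl] := @geometric_cvg R Q (fun n => c n x) i.
    move=> n inn; have [[_ _ _ h _] _] := play_spec n.
    by apply: h; apply: bmono ix.
  by exists l => n nx; apply: Hl; apply: imin.
by have [cl Hcl] := choice H; exists cl.
Qed.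

Lemma half_pow_small (e : R) : 0 < e -> exists n, forall i, (n <= i)%N ->
  (2^-1 : R) ^+ i < e.
Proof.
move=> e0; have [n ne] := exp_half_lt e0; exists n => i ni.
rewrite (le_lt_trans _ ne)// -(subnKC ni) exprD ler_piMr ?exprn_ge0 ?invr_ge0//.
by rewrite exprn_ile1 ?invr_ge0// invf_le1// ler1n.
Qed.

Lemma play_compiled : definitive (\bigcup_i p i) /\
  exists cl : Defs.cst -> Q, compiled (\bigcup_i p i) cl.
Proof.
have [cl clP] := limit_exists; have tl := nonprincipal_tail FU Unp.
have ccl x e : 0 < e -> U [set i | cnorm (c i x - cl x) < e].
  move=> e0; have e2 : 0 < e / 2 by rewrite divr_gt0.
  have [n Hn] := half_pow_small e2.
  apply: filterS (tl (maxn n (maxn x.1 x.2).+1)) => -[|i] /=.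
    by rewrite geq_max ltn0 andbF.
 
  rewrite geq_max => /andP[ni xi]; rewrite cnorm_distC (le_lt_trans (clP x i.+1 _))//.
    have [[_ _ h _ _] _] := play_spec i; move: xi; rewrite ltnS geq_max => /andP[x1 x2].
    by rewrite /box (leq_ltn_trans x1 h) (leq_ltn_trans x2 h).
  by have := Hn _ ni; lra.
have clb : in_balls cst_sort cl.
  move=> x; apply/ler_addgt0Pr => e e0; have [i /= h] := filter_ex (ccl x e e0).
  rewrite -[cl x](subrK (c i x)) (le_trans (ler_cnormD _ _))// addrC lerD//.
    exact: play_in_balls.
  by rewrite cnorm_distC ltW.
have dc := dist_cvg FU play_in_balls clb ccl.
(* An inequality [phi < r] of some move was answered by [phi < r'] with [r' < r]. All later
   interpretations satisfy the latter, so the limit satisfies the former. *)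
have clsat : sat cl (\bigcup_i p i).
  move=> [phi r] [m _ pm] /=; have [_ [_ _ hr _ _]] := play_spec m.
  have [|r' rr' pr'] := hr phi r; first by apply: play_mono pm; rewrite -addnn leq_addr.
  have e0 : 0 < r - r' by rewrite subr_gt0.
  have hq := @qeval_cvg R nat U UF Q Q c cl phi dc _ e0.
  have [j0 [h mj0]] := filter_ex (filterI hq (tl m.+2)).
  case: j0 h mj0 => [|j] /= h mj; first by [].
  have mj2 : (m.*2.+1 <= j.*2)%N by rewrite ltn_double.
  have [[[_ sj] _ _ _ _] _] := play_spec j.
  have h3 : qeval (c j.+1) phi < r' := sj (phi, r') (play_mono mj2 pr').
  by move: h; rewrite ltr_norml => /andP[h1 h2]; lra.
have sQ : stably_finite Q by exact: (tower_stably_finite finj fsub fdense).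
(* In any model the distance is within [2^-i] of its value under [c i.+1], as soon as [i] exceeds
   the positions of both terms; these values converge to the one under [cl]. *)
have ent j (s s' : cterm cst_sort j) :
    entails_dist (\bigcup_i p i) s s' (cnorm (teval cl s - teval cl s')).
  move=> M d [_ db dp]; have [a ta] := tP (existT _ j s); have [b tb] := tP (existT _ j s').
  apply/eqP; rewrite -subr_eq0 -normr_le0; apply/ler_addgt0Pr => e e0; rewrite add0r.
  have e2 : 0 < e / 2 by rewrite divr_gt0.
  have [n Hn] := half_pow_small e2.
  have [i0 [h ni0]] :=
    filter_ex (filterI (dc _ s s' _ e2) (tl (maxn n (maxn a b).+1).+1)).
  case: i0 h ni0 => [|i] /= h; first by [].
  rewrite ltnS geq_max gtn_max => /and3P[ni ai bi].
  have [_ [_ _ _ _ hd]] := play_spec i.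
  have := hd M d a b db _ ai bi; rewrite /term_value ta tb /= => /(_ _) hM.
  have {}hM : `|cnorm (teval d s - teval d s') -
      cnorm (teval (c i.+1) s - teval (c i.+1) s')| < 2^-1 ^+ i.
    by apply: hM => x px; apply: dp; exists i.*2.+1.
  have := Hn i ni; move: h hM; rewrite !ltr_norml => /andP[h1 h2] /andP[h3 h4] h5.
  by apply: ltW; rewrite ltr_norml; apply/andP; split; lra.
split.
  move=> j s s'; exists (cnorm (teval cl s - teval cl s')); split; first exact: ent.
  (* [Q] with [cl] is itself a model, so no other value is entailed. *)
  by move=> r' /(_ Q cl); apply; split.
(* The constant set to [q i] at round [i] lies in the box of the state [i + 1], so its limit is
   within [2 * 2^-(i+1) = 2^-i] of [q i]. *)
exists cl; split=> // x e e0; have e2 : 0 < e / 2 by rewrite divr_gt0.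
have [n Hn] := half_pow_small e2; have [i ni xi] := qP x n e2.
have [[_ _ _ _ [y yb yq]] _] := play_spec i.
exists _, (TGen cst_sort y) => /=.
rewrite (le_lt_trans (cnorm_dist_trans (q i) _ _))// (splitr e) ltrD//.
rewrite -yq cnorm_distC (le_lt_trans (clP _ _ yb))//.
by rewrite exprS mulrA divff ?mul1r ?Hn// pnatr_eq0.
Qed.

End Play.

Lemma realized_enforceable (P : cstarAlgType R -> Prop) : P Q -> enforceable F P.
Proof.
move=> PQ; exists chase; first exact: chase_legal.
move=> p pP; have [dp [cl Hcl]] := play_compiled pP.
by split=> //; exists Q, cl.
Qed.

End Enforce.

(** * The equivalences *)

Lemma embeds_trans (R : realType) (A B C : starAlgType R) :
  embeds A B -> embeds B C -> embeds A C.
Proof.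
move=> [f [fs fi]] [g [gs gi]]; exists (g \o f : {lrmorphism A -> C}).
by split=> [x|x y /= /gi/fi//]; rewrite /= fs gs.
Qed.

Lemma diagonal_embeds (R : realType) (Q : cstarAlgType R) (I : Type)
  (U : set_system I) (FU : UltraFilter U) : embeds Q (ultrapower Q FU).
Proof.
have bc x : bounded (fun _ : I => x : Q) by exists (cnorm x).
have [|||x y|f fE] := @lrmorphism_of R Q (ultrapower Q FU) (fun x => ucl FU (fun=> x)).
- by move=> x y; exact: uclD.
- by move=> z x; exact: uclZ.
- exact: ucl1.
- exact: uclM.
exists f; split=> [x|x y]; rewrite !fE; first exact: ucl_star.
move=> /(ucl_eqP FU (bc x) (bc y)) xy; apply/eqP; rewrite -subr_eq0; apply/eqP.
apply: (@cnorm_small_eq0 _ _ _ 1) => e e0.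
have [i /= h] := @filter_ex _ _ (@ultra_proper _ _ FU) _ (xy e e0).
by rewrite mul1r ltW.
Qed.

Lemma universal_UHF_mx (R : realType) (Q : cstarAlgType R) : universal_UHF Q ->
  forall n, exists g : {lrmorphism 'M[R[i]]_n.+1 -> Q},
    star_preserving g /\ injective g.
Proof.
move=> [k [f [fsi _ _]] kQ] n; have [m nm] := kQ n.+1 isT.
exact: (@embeds_trans R 'M[R[i]]_n.+1 'M[R[i]]_((k m).+1) Q (mx_embed R nm)
  (ex_intro _ (f m) (fsi m))).
Qed.

Section SentenceValue.
Variables (R : realType) (A : cstarAlgType R).

Lemma sentence_value_ge0 (s : sup_inf_sentence R) : (0 <= sentence_value A s)%E.
Proof.
pose x0 (_ : 'I_(outer s)) : A := 0.
apply: le_trans (ereal_sup_ubound _); last first.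
  by exists x0 => // g; rewrite cnorm0 ler0n.
apply: le_ereal_inf_tmp => _ [n _ <-]; apply: le_ereal_inf_tmp => _ [y yb <-].
rewrite lee_fin; apply: matrix_ge0 => -[g|g] /=; last exact: yb.
by rewrite cnorm0 ler0n.
Qed.

Lemma sup_value_eq0 (sigma : nat -> sup_inf_sentence R) :
  sup_value A sigma = 0%E <-> forall j, sentence_value A (sigma j) = 0%E.
Proof.
split=> [s0 j|s0].
  apply/eqP; rewrite eq_le sentence_value_ge0 andbT -s0.
  by apply: ereal_sup_ubound; exists j.
rewrite /sup_value (_ : [set _ | j in _] = [set 0%E]) ?ereal_sup1//.
by apply/seteqP; split=> [_ [j _ <-]//|_ ->]; exists 0%N.
Qed.

End SentenceValue.

Theorem theorem5p9 (R : realType)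
  (F : connectives R) (hF : admissible F)
  (Q : cstarAlgType R) (hQ : universal_UHF Q)
  (U : set_system nat) (hU : UltraFilter U) (hUnp : forall n, ~ U [set n])
  (sigma_UHF sigma_QD : nat -> sup_inf_sentence R)
  (hUHF : defined_by (@UHF R) sigma_UHF)
  (hQD : defined_by (@quasidiagonal R) sigma_QD) :
  [<-> MF_problem_positive Q;
       enforceable F (fun A => sup_value A sigma_UHF = 0%E);
       enforceable F (fun A => isomorphic A Q);
       enforceable F (fun A => sup_value A sigma_QD = 0%E);
       enforceable F (fun A => embeds A (ultrapower Q hU))].
Proof.
have mxQ := universal_UHF_mx hQ.
have [k [f [fsi fsub fdense]] _] := hQ.
have fstar n := (fsi n).1; have finj n := (fsi n).2.
have uQ : UHF Q by exists k, f.
have sQ : separable Q := tower_separable fstar finj fdense.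
have QDu A : quasidiagonal A -> ultra_embeds Q A.
  by move=> qA; exact: (locally_embeds_ultra (quasidiagonal_locally_embeds mxQ qA)).
have toMF P : (forall A, separable A -> P A -> ultra_embeds Q A) ->
    enforceable F P -> MF_problem_positive Q.
  by move=> PQ /(enforceable_realized PQ) /(realized_MF hF).
have ofMF (P : cstarAlgType R -> Prop) : P Q -> MF_problem_positive Q -> enforceable F P.
  move=> PQ MF; have [t tP] := enum_terms.
  have [q qP] := dense_sequence fstar finj fdense.
  apply: (realized_enforceable hF fstar finj fsub fdense hU hUnp tP qP) PQ.
  move=> p [fp _ [A [c [sA cb cp]]]]; have [I [V [FV AQ]]] := MF A sA.
  exact: (los_realize AQ cb fp cp).
(* Implications between two enforceability statements pass through the MF problem by [toMF] and
   [ofMF]. *)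
tfae.
- by apply: ofMF; apply/sup_value_eq0; apply/hUHF.
- move=> e; apply: ofMF; first by exists idfun; split=> //; exists idfun.
  apply: toMF e => A sA /sup_value_eq0 /(hUHF A sA) uA.
  exact/QDu/UHF_quasidiagonal.
- move=> e; apply: ofMF.
    by apply/sup_value_eq0/hQD => //; exact: UHF_quasidiagonal.
  apply: toMF e => A sA [g [gs gb]]; exists nat, U, hU.
  apply: embeds_trans (diagonal_embeds Q hU); exists g; split=> //.
  exact: bij_inj.
- move=> e; apply: ofMF; first exact: diagonal_embeds.
  by apply: toMF e => A sA /sup_value_eq0 /(hQD A sA) /QDu.
- by apply: toMF => A sA AQ; exists nat, U, hU.
Qed.
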